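(* Let $r\ge3$, $s\ge2$, $1\le t\le r-1$ be fixed integers and let $p>1$ be a fixed real number. Then, for all sufficiently large $n$, every $P_{2s}^r$-free family $\mathcal{H}\subseteq\binom{[n]}{r}$ satisfies $$\left\|\mathcal{H}\right\|_{t,p}\le \left\|\mathcal{E}_{n,r,s}\right\|_{t,p}.$$ Equality holds if and only if $\mathcal{H}$ is isomorphic to $\mathcal{E}_{n,r,s}(A,Q)$ for some $(s-1)$-set $A\subseteq[n]$ and some pair $Q\subseteq[n]\setminus A$.
   Context: $[n]=\{1,\dots,n\}$ and $\binom{X}{r}$ is the collection of all $r$-subsets of $X$. For a family $\mathcal{H}\subseteq\binom{[n]}{r}$ and $T\subseteq[n]$, $d_{\mathcal{H}}(T)=|\{H\in\mathcal{H}:T\subseteq H\}|$, and $\|\mathcal{H}\|_{t,p}=\sum_{T\in\binom{[n]}{t}}d_{\mathcal{H}}(T)^p$. The $r$-uniform linear path $P_\ell^r$ consists of $\ell$ edges ($r$-sets) $E_1,\dots,E_\ell$ such that $|E_i\cap E_{i+1}|=1$ for every $1\le i<\ell$ and $E_i\cap E_j=\emptyset$ whenever $|i-j|\ge2$. A family is $P_\ell^r$-free if it contains no $\ell$ members forming a copy of $P_\ell^r$. For an $(s-1)$-set $A\subseteq[n]$ and a pair (2-element set) $Q\subseteq[n]\setminus A$, $$\mathcal{E}_{n,r,s}(A,Q)=\Bigl\{E\in\tbinom{[n]}{r}:E\cap A\neq\emptyset\Bigr\}\cup\Bigl\{E\in\tbinom{[n]\setminus A}{r}:Q\subseteq E\Bigr\},$$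 and $\mathcal{E}_{n,r,s}$ denotes this family for any choice of $A,Q$ (its isomorphism type, hence its norm, does not depend on the choice). Two families on $[n]$ are isomorphic if a permutation of $[n]$ maps one onto the other. *)

(* Defs.v *)
From mathcomp Require Import all_boot all_order all_fingroup all_algebra.
From mathcomp Require Import reals exp.

Set Implicit Arguments.
Unset Strict Implicit.
Unset Printing Implicit Defensive.

(* The ground set [n] is 'I_n; a family of subsets of [n] is a
   {set {set 'I_n}}. *)

Section Families.
Variable n : nat.
Implicit Types (H G : {set {set 'I_n}}) (A Q T : {set 'I_n}).

Definition rsubsets (X : {set 'I_n}) (r : nat) : {set {set 'I_n}} :=
  [set E : {set 'I_n} | (E \subset X) && (#|E| == r)].

Definition degree H T : nat := #|[set E in H | T \subset E]|.

(* Real powers of natural numbers; for p > 0 one has 0 `^ p = 0. *)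
Definition tpnorm (R : realType) (t : nat) (p : R) H : R :=
  (\sum_(T in rsubsets [set: 'I_n] t) ((degree H T)%:R `^ p))%R.

Definition linear_path (r l : nat) (E : 'I_l -> {set 'I_n}) : Prop :=
  [/\ injective E,
      forall i, #|E i| = r,
      forall i j : 'I_l, j = i.+1 :> nat -> #|E i :&: E j| = 1
    & forall i j : 'I_l, i.+1 < j -> E i :&: E j = set0].

Definition path_free (r l : nat) H : Prop :=
  ~ exists E : 'I_l -> {set 'I_n}, linear_path r E /\ forall i, E i \in H.

Definition extremal (r : nat) A Q : {set {set 'I_n}} :=
  [set E in rsubsets [set: 'I_n] r | E :&: A != set0]
    :|: [set E in rsubsets (~: A) r | Q \subset E].

Definition admissible (s : nat) A Q : Prop :=
  [/\ #|A| = s - 1, #|Q| = 2 & Q \subset ~: A].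

Definition isomorphic H G : Prop :=
  exists f : {perm 'I_n}, [set f @: E | E : {set 'I_n} in H] = G.

End Families.

(* Main.v *)
Require Import Defs.
From mathcomp Require Import all_boot all_order all_fingroup all_algebra.
From mathcomp Require Import reals exp.
From mathcomp Require Import zify_ssreflect.
From Stdlib Require Import Lia.

(** Call a set W flexible in H when a member of H above W can be chosen off any
    prescribed bounded set disjoint from W.  Flexible sets that meet each other
    like the edges of a linear path can be replaced one after the other by
    members of H above them without creating new intersections, so a family
    without a path of 2s edges contains no such pattern of 2s flexible sets
    ([no_seeds]).  Every configuration excluded below is excluded by exhibiting
    such a pattern.  A set that is not flexible has small degree
    ([flex_degree]); when H is nearly complete it also lies in many missing
    edges ([nonflex_missing]).

    Let H be path-free with norm at least that of the extremal family, and let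
    D = 'C(n - t, r - t) be the largest possible degree of a t-set.  Since p > 1
    and H has O(n^(r-1)) members ([free_card_le_shadow]), the t-sets of degree
    below eps n^(r-t) contribute only a small multiple of n^(t-1) D^p.  There is
    a bounded set C of vertices which meets all the other, dense, t-sets if
    t < r - 1; if t = r - 1, the dense sets missing C may form a family M in which
    no two members meet in exactly one vertex ([dense_cover]).  Indeed, averaging
    finds a path among many disjoint dense sets if t < r - 1, and among many
    disjoint pairs of dense sets with one common vertex if t = r - 1.  The family
    M is smaller by a constant factor than a star ([unit_free_card]).  All but
    O(n^(r-2)) of the (r-1)-sets are completed to a member by at most s - 1
    vertices of C ([common_link_small]), and, with boundedly many exceptions, a
    vertex that completes many members of M sees few (r-1)-sets with s - 1
    completions in C ([card_bad_vertex]).  So the degrees of the dense sets sum to at most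
    (s - 1) 'C(n - 1, t - 1) D + O(n^(r-2)) ([dense_weight]).  Since
    d^p <= D^(p-1) d, with a definite loss for d < (1 - 1/k) D, a norm as large
    as the extremal one forces almost (s - 1) 'C(n - 1, t - 1) sets of degree at
    least (1 - 1/k) D ([many_nearfull]).  Two such sets can always be joined
    through a common vertex, so all but a few of them pass through s - 1
    vertices L, each of almost full degree ([stability]).

    It remains to count exactly.  The bounds
    x^(p-1) (x - y) <= x^p - y^p <= N x^(p-1) (x - y) turn a comparison of norms
    into one of cardinals ([norm_compare]): if H is at least as heavy as G, it
    misses at most a constant times as many members of G as it has members
    outside G.  With G the sets meeting L, the number m of missing edges is at
    most a constant times the number of members avoiding L.  Two members
    avoiding L that meet in at most one vertex extend to a path through L,
    unless their connections to L are destroyed by missing edges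
    ([good_members]).  Playing these two facts against each other gives
    m = O(n^(r-2)), and then a pair Q contained in all but O(n^(r-3)) of the
    members avoiding L; moreover, a single exception costs a constant times
    n^(r-2) missing edges of the extremal family given by L and Q
    ([rigidity]).  A second comparison of norms, with that family as G, excludes
    exceptions and then missing edges. *)

Set Implicit Arguments.
Unset Strict Implicit.
Unset Printing Implicit Defensive.

(** The membership and inclusion hypotheses carry no arithmetic, but they make
    the preprocessing of [lia] very slow. *)
Ltac nlia :=
  repeat match goal with
  | h : is_true (in_mem _ _) |- _ => clear h
  | h : is_true (~~ in_mem _ _) |- _ => clear h
  | h : is_true (disjoint _ _) |- _ => clear h
  | h : is_true (subset _ _) |- _ => clear h
  | h : is_true (~~ (@eq_op ?T _ _)) |- _ => lazymatch T with context [ordinal] => clear h end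
  end; lia.

(** * Counting in finite sets *)

Lemma card_bigcup_le (I T : finType) (P : pred I) (F : I -> {set T}) :
  #|\bigcup_(i | P i) F i| <= \sum_(i | P i) #|F i|.
Proof.
elim/big_rec2: _ => [|i m A _ IH]; first by rewrite cards0.
by rewrite (leq_trans (leq_card_setU _ _)) ?leq_add2l.
Qed.

Lemma card_between (T : finType) (W X : {set T}) k :
  W \subset X -> #|W| <= k ->
  #|[set E : {set T} | [&& W \subset E, E \subset X & #|E| == k]]|
    = 'C(#|X| - #|W|, k - #|W|).
Proof.
move=> sWX leWk; rewrite -cardsDS // -cards_draws.
set S := [set F : {set T} | F \subset X :\: W & _].
have inj : {in S &, injective (fun F => W :|: F)}.
  move=> F G; rewrite !inE => /andP[/subsetP sF _] /andP[/subsetP sG _] /setP eq.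
  apply/setP=> x; have := eq x; have := sF x; have := sG x; rewrite !inE.
  by do 3!case: (x \in _) => //=; (move=> /(_ isT) + _ || move=> _ /(_ isT)).
rewrite -(card_in_imset inj); apply: eq_card => E; rewrite [LHS]inE.
apply/and3P/imsetP => [[sWE sEX /eqP cE]|[F]].
  exists (E :\: W); last by rewrite setDE setUIr setUCr setIT; apply/esym/setUidPr.
  by rewrite inE setSD //= cardsDS // cE.
rewrite inE subsetD => /andP[/andP[sFX dFW] /eqP cF] ->; split.
- exact: subsetUl.
- by rewrite subUset sWX.
- by move: dFW; rewrite cardsU -setI_eq0 setIC => /eqP->; rewrite cards0 cF; apply/eqP; lia.
Qed.

Lemma exists_subset_card (T : finType) (A : {set T}) q : q <= #|A| ->
  exists2 J : {set T}, J \subset A & #|J| = q.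
Proof.
move=> qA; have : 0 < #|[set J : {set T} | J \subset A & #|J| == q]|.
  by rewrite cards_draws bin_gt0.
by case/card_gt0P=> J; rewrite inE => /andP[JA /eqP cJ]; exists J.
Qed.

Lemma exists_between (T : finType) (W X : {set T}) k : W \subset X -> #|W| <= k -> k <= #|X| ->
  exists F : {set T}, [/\ W \subset F, F \subset X & #|F| = k].
Proof.
move=> WX Wk kX.
have : 0 < #|[set F : {set T} | [&& W \subset F, F \subset X & #|F| == k]]|.
  by rewrite card_between // bin_gt0; lia.
by case/card_gt0P=> F; rewrite inE => /and3P[h1 h2 /eqP h3]; exists F.
Qed.

Lemma pigeonhole (T I : finType) (P : {set T}) (Q : {set I}) (G : I -> {set T}) :
  P != set0 -> (forall x, x \in P -> exists2 J, J \in Q & x \in G J) ->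
  exists2 J, J \in Q & #|P| <= #|Q| * #|G J|.
Proof.
case/set0Pn=> x0 x0P h; have [J0 J0Q _] := h x0 x0P.
case: (arg_maxnP (fun J => #|G J|) J0Q) => J JQ Jmax.
exists J; first exact: JQ.
have sub : P \subset \bigcup_(J in Q) G J.
  by apply/subsetP=> x /h [K KQ xK]; apply/bigcupP; exists K.
apply: leq_trans (subset_leq_card sub) (leq_trans (card_bigcup_le _ _) _).
by rewrite -sum_nat_const; apply: leq_sum => K; exact: Jmax.
Qed.

Lemma card_sets (I : finType) (Q : {set {set I}}) : #|Q| <= 2 ^ #|I|.
Proof. by rewrite -[#|I|]cardsT -card_powerset powersetT cardsT; exact: max_card. Qed.

(** Averaging: 2aq sets of density at least 1/a cover at least a proportion
    1/(2a) of P at least q times, and some q of the sets account for a fixed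
    proportion of these points. *)
Lemma common_subfamily (T : finType) (P : {set T}) a q (A : 'I_(2 * a * q) -> {set T}) :
  0 < q -> 0 < a -> P != set0 ->
  (forall i, A i \subset P) -> (forall i, #|P| <= a * #|A i|) ->
  exists2 J : {set 'I_(2 * a * q)}, #|J| = q &
    #|P| <= 2 * a * 2 ^ (2 * a * q) * #|\bigcap_(i in J) A i|.
Proof.
move=> q0 a0 P0 AP leA; set K := 2 * a * q in A AP leA *.
pose P' := [set x in P | q <= #|[set i | x \in A i]|].
have lePP' : #|P| <= 2 * a * #|P'|.
  have : \sum_(i < K) #|A i| <= q * #|P| + K * #|P'|.
    rewrite (eq_bigr (fun i => \sum_(x in P) (x \in A i))); last first.
      move=> i _; rewrite -sum1_card big_mkcond [RHS]big_mkcond /=; apply: eq_bigr => x _.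
      by case: ifP => [/(subsetP (AP i))->|_] //; rewrite if_same.
    rewrite exchange_big /= (bigID (mem P')) /= addnC; apply: leq_add.
      apply: leq_trans (_ : \sum_(x in P) q <= _); last by rewrite sum_nat_const mulnC.
      rewrite big_mkcondr /=; apply: leq_sum => x xP; rewrite inE xP /= -ltnNge.
      case: ifP => // lt; apply: ltnW; apply: leq_ltn_trans lt.
      by rewrite -sum1_card [X in _ <= X]big_mkcond /=; apply: leq_sum => i _; rewrite inE;
        case: (_ \in _).
    apply: leq_trans (_ : \sum_(x in P') K <= _); last by rewrite sum_nat_const mulnC.
    rewrite (eq_bigl (mem P')); last by move=> x; rewrite !inE; case: (x \in P).
    apply: leq_sum => x _; apply: leq_trans (_ : \sum_(i < K) 1 <= _).
      by apply: leq_sum => i _; case: (_ \in _).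
    by rewrite sum_nat_const card_ord muln1.
  have : K * #|P| <= a * \sum_(i < K) #|A i|.
    rewrite big_distrr /= -[X in X * _ <= _]card_ord -sum_nat_const.
    exact: leq_sum.
  rewrite /K; nia.
have P'0 : P' != set0.
  by move: P0; rewrite -!card_gt0; move: lePP'; case: #|P'| => //; rewrite muln0; lia.
have [x|J] := @pigeonhole T _ P' [set J : {set 'I_K} | #|J| == q]
    (fun J => \bigcap_(i in J) A i) P'0.
  rewrite inE => /andP[xP /exists_subset_card[J sJ cJ]].
  exists J; first by rewrite inE cJ.
  by apply/bigcapP=> i /(subsetP sJ); rewrite inE.
rewrite inE => /eqP cJ leJ; exists J => //.
apply: leq_trans lePP' _; rewrite -[X in _ <= X]mulnA leq_mul2l; apply/orP; right.
apply: leq_trans leJ _; rewrite leq_mul2r; apply/orP; right.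
by apply: leq_trans (card_sets _) _; rewrite card_ord.
Qed.

(** A maximal collection of disjoint objects is either large, or its union meets
    every object. *)
Lemma pack_or_cover (V : finType) (P : pred {set V}) a k :
  (forall X, P X -> #|X| <= a) ->
  (exists X : nat -> {set V}, (forall i, i < k -> P (X i)) /\
     (forall i j, i < k -> j < k -> i != j -> X i :&: X j = set0)) \/
  (exists2 C : {set V}, #|C| <= a * k & forall X, P X -> X :&: C != set0).
Proof.
move=> leP; elim: k => [|k [[X [XP XI]]|[C cC hC]]].
- by left; exists (fun=> set0).
- pose C := \bigcup_(i < k) X i.
  have [/existsP[Y /andP[PY YC]]|/existsPn h] := boolP [exists Y, P Y && (Y :&: C == set0)].
    left; exists (fun i => if i == k then Y else X i).
    have YX i : i < k -> Y :&: X i = set0.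
      move=> ik; apply/eqP; rewrite -subset0 -(eqP YC) setIS //.
      exact: (bigcup_sup (Ordinal ik)).
    split=> [i ik|i j ik jk ij]; first by case: eqP => // ne; apply: XP; lia.
    case: eqP => [ei|ni]; case: eqP => [ej|nj].
    + by move: ij; rewrite ei ej eqxx.
    + by apply: YX; lia.
    + by rewrite setIC; apply: YX; lia.
    + by apply: XI; lia.
  right; exists C.
    apply: leq_trans (card_bigcup_le _ _) _.
    apply: leq_trans (_ : \sum_(i < k) a <= _).
      by apply: leq_sum => i _; apply: leP; exact: XP.
    by rewrite sum_nat_const card_ord mulnC leq_mul2l leqnSn orbT.
  by move=> Y PY; have := h Y; rewrite PY.
- by right; exists C => //; rewrite mulnS (leq_trans cC) ?leq_addl.
Qed.

Lemma double_count (I J : finType) (A : {pred I}) (B : {pred J}) (R : I -> J -> bool) :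
  \sum_(i in A) #|[set j in B | R i j]| = \sum_(j in B) #|[set i in A | R i j]|.
Proof.
have e (T : finType) (D : {pred T}) (P : pred T) : #|[set x in D | P x]| = \sum_(x in D) P x.
  rewrite -sum1_card big_mkcond [RHS]big_mkcond /=; apply: eq_bigr => x _.
  by rewrite inE; case: (x \in D); case: (P x).
rewrite (eq_bigr _ (fun i _ => e _ B (R i))) exchange_big /=.
by apply: eq_bigr => j _; rewrite e.
Qed.

Lemma sum_except (T : finType) (A : {set T}) (f : T -> nat) j m :
  (forall x, x \in A -> f x <= m) ->
  \sum_(x in A) f x <= j * #|A| + m * #|[set x in A | j < f x]|.
Proof.
move=> fm.
have -> : #|[set x in A | j < f x]| = \sum_(x in A) (j < f x).
  rewrite -sum1_card big_mkcond [RHS]big_mkcond /=; apply: eq_bigr => x _.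
  by rewrite inE; case: (x \in A); case: (j < f x).
rewrite mulnC -sum_nat_const big_distrr /= -big_split /=; apply: leq_sum => x xA.
by case: ltnP => h; [have := fm x xA; rewrite muln1; nlia | rewrite muln0 addn0].
Qed.

Lemma enum_fun (T : finType) (A : {set T}) q : 0 < q -> q <= #|A| ->
  exists e : nat -> T, (forall i, i < q -> e i \in A) /\
    (forall i j, i < q -> j < q -> e i = e j -> i = j).
Proof.
move=> q0 qA; have /card_gt0P[x0 _] : 0 < #|A| by lia.
exists (nth x0 (enum A)); split=> [i iq|i j iq jq /eqP].
  by rewrite -mem_enum mem_nth // -cardE; lia.
by rewrite nth_uniq ?enum_uniq -?cardE //; [move/eqP | lia | lia].
Qed.

Lemma distinct_reps (T : finType) (A : nat -> {set T}) m : 0 < m ->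
  (forall i, i < m -> m <= #|A i|) ->
  exists x : nat -> T, (forall i, i < m -> x i \in A i) /\
    (forall i j, i < m -> j < m -> x i = x j -> i = j).
Proof.
move=> m0 hA.
suff : forall k, k <= m -> exists x : nat -> T, (forall i, i < k -> x i \in A i) /\
    (forall i j, i < k -> j < k -> x i = x j -> i = j) by move=> /(_ m (leqnn m)).
elim=> [_|k IH km].
  by have /card_gt0P[x0 _] : 0 < #|A 0| by [have := hA 0 m0; lia]; exists (fun=> x0).
have [x [xA xI]] := IH (ltnW km).
have : 0 < #|A k :\: [set x i | i : 'I_k]|.
  rewrite cardsD subn_gt0; apply: leq_ltn_trans (subset_leq_card (subsetIr _ _)) _.
  by apply: leq_ltn_trans (leq_imset_card _ _) _; rewrite card_ord; apply: leq_trans km (hA _ km).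
case/card_gt0P=> y; rewrite inE => /andP[/imsetP yN yA].
exists (fun i => if i == k then y else x i); split=> [i ik|i j ik jk].
  by case: eqP => [->//|/eqP ne]; apply: xA; lia.
case: eqP => [->|/eqP ni]; case: eqP => [->|/eqP nj] //.
- move=> eq; case: yN; have jk' : j < k by lia.
  by exists (Ordinal jk').
- move=> eq; case: yN; have ik' : i < k by lia.
  by exists (Ordinal ik').
- by apply: xI; lia.
Qed.

(** If two members meet in exactly j points, a third member that does not contain
    their intersection forces j + 1 points of every member into the union of the
    three; if no two do (a member paired with itself included), any single member
    can serve as U. *)
Lemma intersecting_kernel (V : finType) (F : {set {set V}}) k j :
  (forall E, E \in F -> #|E| = k) ->
  {in F &, forall E E', j <= #|E :&: E'|} ->
  (exists2 Q : {set V}, #|Q| = j & forall E, E \in F -> Q \subset E) \/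
  (exists2 U : {set V}, #|U| <= 3 * k & forall E, E \in F -> j < #|E :&: U|).
Proof.
move=> uF int.
have [/existsP[E1 /existsP[E2 /and3P[F1 F2 /eqP c12]]]|/existsPn h] :=
  boolP [exists E1 : {set V}, exists E2 : {set V}, [&& E1 \in F, E2 \in F & #|E1 :&: E2| == j]].
  have [/existsP[G /andP[FG nG]]|/existsPn h] :=
    boolP [exists G : {set V}, (G \in F) && ~~ (E1 :&: E2 \subset G)]; last first.
    left; exists (E1 :&: E2) => // E FE; have := h E; rewrite FE /=.
    by move/negbNE.
  right; exists (E1 :|: E2 :|: G).
    apply: leq_trans (leq_card_setU _ _) _; rewrite (uF _ FG).
    have := leq_card_setU E1 E2; rewrite (uF _ F1) (uF _ F2).
    by move=> [le _]; lia.
  move=> E FE; have [QE|nQE] := boolP (E1 :&: E2 \subset E).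
    apply: leq_trans (_ : #|E :&: ((E1 :&: E2) :|: G)| <= _); last first.
      apply: subset_leq_card; apply: setIS; apply: setSU.
      exact: subset_trans (subsetIl _ _) (subsetUl _ _).
    rewrite setIUr cardsU (setIidPr QE) c12.
    have lt : #|(E1 :&: E2) :&: (E :&: G)| < j.
      rewrite -c12; apply: proper_card; rewrite properE subsetIl /=.
      by apply: contra nG => /subset_trans; apply; rewrite setIA subsetIr.
    by have := int E G FE FG; lia.
  apply: leq_trans (_ : #|E :&: (E1 :|: E2)| <= _); last by apply: subset_leq_card;
    rewrite setIS ?subsetUl.
  rewrite setIUr cardsU; have -> : E :&: E1 :&: (E :&: E2) = E1 :&: E2 :&: E.
    by apply/setP=> x; rewrite !inE; do 3!case: (x \in _).
  have lt : #|E1 :&: E2 :&: E| < j.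
    rewrite -c12; apply: proper_card; rewrite properE subsetIl /=.
    by apply: contra nQE => /subset_trans; apply; exact: subsetIr.
  by have := int E E1 FE F1; have := int E E2 FE F2; lia.
right; case: (set_0Vmem F) => [->|[E0 FE0]].
  by exists set0; rewrite ?cards0 // => E; rewrite inE.
exists E0; first by rewrite uF //; lia.
move=> E FE; have := int E E0 FE FE0; rewrite leq_eqVlt => /orP[/eqP eq|//].
by have /existsPn/(_ E0) := h E; rewrite FE FE0 -eq eqxx.
Qed.

(** * Orders of magnitude *)

Lemma leq_bin_exp m k : 'C(m, k) <= m ^ k.
Proof.
elim: k m => [|k IH] m; first by rewrite bin0.
case: m => [|m]; first by rewrite bin0n.
rewrite -(@leq_pmul2l k.+1) // -mul_bin_diag.
have lek : m ^ k <= m.+1 ^ k by case: (k) => // j; rewrite leq_exp2r.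
rewrite expnS; apply: leq_trans (leq_pmull _ (ltn0Sn k)).
by rewrite leq_mul2l (leq_trans (IH m) lek).
Qed.

(** Constants are always chosen before n, so statements for large n are combined
    through this predicate. *)
Definition eventually (P : nat -> Prop) := exists N, forall n, N <= n -> P n.

Lemma eventually_and P Q : eventually P -> eventually Q -> eventually (fun n => P n /\ Q n).
Proof. by move=> [N hN] [M hM]; exists (maxn N M) => n;
  rewrite geq_max => /andP[/hN ? /hM ?]. Qed.

Lemma eventually_mono (P Q : nat -> Prop) : (forall n, P n -> Q n) -> eventually P ->
  eventually Q.
Proof. by move=> PQ [N hN]; exists N => n /hN /PQ. Qed.

Lemma eventually_ge m : eventually (leq m).
Proof. by exists m. Qed.

Lemma exp_le_ffact m k : (m - k) ^ k <= m ^_ k.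
Proof.
elim: k m => [|k IH] m //; case: m => [|m]; first by rewrite sub0n exp0n.
by rewrite ffactSS subSS expnS leq_mul ?IH //; lia.
Qed.

Lemma leq_exp2r_weak a b k : a <= b -> a ^ k <= b ^ k.
Proof. by move=> ab; case: k => // k; rewrite leq_exp2r. Qed.

(** A constant for the comparison of n ^ k with binomial coefficients. *)
Definition bin_scale k := 2 ^ k * k`!.

Lemma bin_scale_gt0 k : 0 < bin_scale k.
Proof. by rewrite /bin_scale muln_gt0 expn_gt0 fact_gt0. Qed.

Lemma exp_le_bin a k n : 2 * (a + k) <= n -> n ^ k <= bin_scale k * 'C(n - a, k).
Proof.
move=> le; rewrite /bin_scale -mulnA [k`! * _]mulnC bin_ffact.
apply: leq_trans (_ : 2 ^ k * (n - a - k) ^ k <= _); last by rewrite leq_mul2l exp_le_ffact orbT.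
by rewrite -expnMn leq_exp2r_weak //; lia.
Qed.

Lemma lower_order K j n : K < n -> K * n ^ j < n ^ j.+1.
Proof. by move=> Kn; rewrite expnS ltn_pmul2r // expn_gt0; apply/orP; left; lia. Qed.

Lemma eventually_lower_order A t : eventually (fun n =>
  A * ((t - 1) * n ^ (t - 2)) <= 'C(n - 1, t - 1)).
Proof.
have [t1|t2] := leqP t 1.
  by exists 0 => n _; rewrite (_ : t - 1 = 0) ?mul0n ?muln0 //; lia.
exists (2 * t + bin_scale (t - 1) * (A * (t - 1))).+1 => n nN.
have nt : 2 * t < n by apply: leq_ltn_trans nN; exact: leq_addr.
rewrite -(leq_pmul2l (bin_scale_gt0 (t - 1))); apply: leq_trans (exp_le_bin _); last by lia.
have lt : bin_scale (t - 1) * (A * (t - 1)) < n by apply: leq_ltn_trans nN; exact: leq_addl.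
have := lower_order (t - 2) lt; rewrite (_ : (t - 2).+1 = t - 1) ?mulnA; [exact: ltnW | lia].
Qed.

(** * Degrees in uniform families *)

Definition uniform n k (H : {set {set 'I_n}}) := forall E, E \in H -> #|E| = k.

Lemma degree_le_bin n k (H : {set {set 'I_n}}) (W : {set 'I_n}) :
  uniform k H -> #|W| <= k -> degree H W <= 'C(n - #|W|, k - #|W|).
Proof.
move=> uH leW; rewrite -[X in X - #|W|]card_ord -cardsT -card_between ?subsetT //.
apply: subset_leq_card; apply/subsetP=> E; rewrite !inE subsetT => /andP[/uH-> ->].
by rewrite eqxx.
Qed.

Lemma degree_gt_card n k (H : {set {set 'I_n}}) (W : {set 'I_n}) :
  uniform k H -> k < #|W| -> degree H W = 0.
Proof.
move=> uH ltW; apply/eqP; rewrite cards_eq0 -subset0; apply/subsetP=> E.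
by rewrite !inE => /andP[/uH cE /subset_leq_card]; rewrite cE leqNgt ltW.
Qed.

(** The factor (#|W| <= k) keeps the bound exact when W is too large, where the
    truncated exponent would otherwise give 1. *)
Lemma degree_le_exp n k (H : {set {set 'I_n}}) (W : {set 'I_n}) :
  uniform k H -> degree H W <= (#|W| <= k) * n ^ (k - #|W|).
Proof.
move=> uH; case: (leqP #|W| k) => [leW|ltW]; last by rewrite (degree_gt_card uH).
rewrite mul1n; apply: leq_trans (degree_le_bin uH leW) (leq_trans (leq_bin_exp _ _) _).
by case: (k - _) => // j; rewrite leq_exp2r // leq_subr.
Qed.

Lemma uniformS n k (H G : {set {set 'I_n}}) : H \subset G -> uniform k G -> uniform k H.
Proof. by move=> /subsetP sHG uG E /sHG /uG. Qed.

Lemma uniform_rsubsets n k X : uniform k (@rsubsets n X k).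
Proof. by move=> E; rewrite inE => /andP[_ /eqP]. Qed.

Lemma degreeS n (H G : {set {set 'I_n}}) (W : {set 'I_n}) : H \subset G ->
  degree H W <= degree G W.
Proof.
by move=> sHG; apply: subset_leq_card; apply/subsetP=> E;
  rewrite !inE => /andP[/(subsetP sHG)-> ->].
Qed.

(** The factor k - #|W| makes the bound vanish for #|W| = k, so that it covers
    members of H and proper subsets of members alike. *)
Lemma card_meet_le n k (H : {set {set 'I_n}}) (W Z : {set 'I_n}) :
  uniform k H -> [disjoint Z & W] ->
  #|[set E in H | (W \subset E) && ~~ [disjoint E & Z]]|
    <= #|Z| * ((k - #|W|) * n ^ (k - #|W| - 1)).
Proof.
move=> uH dZW.
(* A member above W that meets Z contains z |: W for some z in Z. *)
have sub : [set E in H | (W \subset E) && ~~ [disjoint E & Z]] \subset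
  \bigcup_(z in Z) [set E in H | z |: W \subset E].
  apply/subsetP=> E; rewrite !inE => /and3P[HE WE /pred0Pn[z /andP[/= zE zZ]]].
  by apply/bigcupP; exists z => //; rewrite !inE HE subUset sub1set zE.
apply: leq_trans (subset_leq_card sub) _.
apply: leq_trans (card_bigcup_le _ _) _ => //.
rewrite -sum_nat_const; apply: leq_sum => z zZ.
have zW : z \notin W by move: dZW; rewrite disjoint_subset => /subsetP/(_ z zZ).
apply: leq_trans (degree_le_exp _ uH) _.
rewrite cardsU1 zW add1n -subnDA addn1.
by case: (ltnP #|W| k) => //= h; rewrite mul1n leq_pmull // subn_gt0.
Qed.

Lemma degree_gt0 n (H : {set {set 'I_n}}) (W : {set 'I_n}) :
  reflect (exists2 E, E \in H & W \subset E) (0 < degree H W).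
Proof.
apply: (iffP card_gt0P) => [[E]|[E HE WE]]; first by rewrite inE => /andP[]; exists E.
by exists E; rewrite inE HE.
Qed.

Lemma card_rsubsets n k : #|rsubsets [set: 'I_n] k| = 'C(n, k).
Proof. by rewrite cards_draws cardsT card_ord. Qed.

Lemma card_rsubsets_mem n k (x : 'I_n) : 0 < k ->
  #|[set Y in rsubsets [set: 'I_n] k | x \in Y]| = 'C(n - 1, k - 1).
Proof.
move=> k0; have := @card_between _ [set x] [set: 'I_n] k (subsetT _).
rewrite cards1 cardsT card_ord => /(_ k0) <-; apply: eq_card => Y.
by rewrite !inE sub1set subsetT /= andbC.
Qed.

(** A member with j points in U contains one of at most 2 ^ #|U| sets of size j. *)
Lemma card_trace_le n k (H : {set {set 'I_n}}) (U : {set 'I_n}) j : uniform k H ->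
  #|[set E in H | j <= #|E :&: U|]| <= 2 ^ #|U| * ((j <= k) * n ^ (k - j)).
Proof.
move=> uH.
have sub : [set E in H | j <= #|E :&: U|] \subset
   \bigcup_(W in [set W : {set 'I_n} | W \subset U & #|W| == j]) [set E in H | W \subset E].
  apply/subsetP=> E; rewrite inE => /andP[HE jE].
  have : 0 < #|[set W : {set 'I_n} | W \subset E :&: U & #|W| == j]|.
    by rewrite cards_draws bin_gt0.
  case/card_gt0P=> W; rewrite inE subsetI => /andP[/andP[WE WU] cW].
  by apply/bigcupP; exists W; rewrite inE ?WU ?HE.
apply: leq_trans (subset_leq_card sub) (leq_trans (card_bigcup_le _ _) _).
apply: leq_trans (_ : \sum_(W in [set W :
  {set 'I_n} | W \subset U & #|W| == j]) ((j <= k) * n ^ (k - j)) <= _).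
  by apply: leq_sum => W; rewrite inE => /andP[_ /eqP <-]; exact: degree_le_exp.
rewrite sum_nat_const leq_mul2r; apply/orP; right.
rewrite -card_powerset; apply: subset_leq_card; apply/subsetP=> W.
by rewrite !inE => /andP[].
Qed.

(** Pairs of a t-set T and a member E of H with W inside T inside E are counted
    in two ways. *)
Lemma sum_degree_sup n k t (H : {set {set 'I_n}}) (W : {set 'I_n}) : uniform k H -> #|W| <= t ->
  \sum_(T in [set T in rsubsets [set: 'I_n] t | W \subset T]) degree H T
     = 'C(k - #|W|, t - #|W|) * degree H W.
Proof.
move=> uH leW; rewrite /degree double_count mulnC -sum_nat_const.
rewrite (bigID (fun E : {set 'I_n} => W \subset E)) /= addnC big1 ?add0n => [|E /andP[_ nWE]];
  last first.
  apply/eqP; rewrite cards_eq0 -subset0; apply/subsetP=> T; rewrite !inE.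
  by case/andP=> /andP[_ WT] TE; rewrite (subset_trans WT TE) in nWE.
apply: eq_big => [E|E /andP[HE WE]]; first by rewrite inE.
rewrite -(uH _ HE) -card_between //; apply: eq_card => T; rewrite !inE subsetT /=.
by rewrite -!andbA; do !bool_congr.
Qed.

Lemma sum_degree n k t (H : {set {set 'I_n}}) : uniform k H ->
  \sum_(T in rsubsets [set: 'I_n] t) degree H T = 'C(k, t) * #|H|.
Proof.
move=> uH; have := @sum_degree_sup n k t H set0 uH; rewrite cards0 !subn0 => /(_ isT).
have -> : degree H set0 = #|H| by apply: eq_card => E; rewrite !inE sub0set andbT.
by move=> <-; apply: eq_bigl => T; rewrite !inE sub0set andbT.
Qed.

Lemma sum_degree1 n (H : {set {set 'I_n}}) (X : {set 'I_n}) :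
  \sum_(v in X) degree H [set v] = \sum_(E in H) #|E :&: X|.
Proof.
rewrite /degree double_count; apply: eq_bigr => E _; apply: eq_card => v.
by rewrite !inE sub1set andbC.
Qed.

Lemma sum_degree1_uniform n k (H : {set {set 'I_n}}) : uniform k H ->
  \sum_(v : 'I_n) degree H [set v] = k * #|H|.
Proof.
move=> uH; have -> : \sum_(v : 'I_n) degree H [set v] = \sum_(v in [set: 'I_n]) degree H [set v].
  by apply: eq_bigl => v; rewrite inE.
rewrite sum_degree1 (eq_bigr (fun=> k)) ?sum_nat_const 1?mulnC // => E HE.
by rewrite setIT uH.
Qed.

Lemma degree_complete n r (T : {set 'I_n}) : #|T| <= r ->
  degree (rsubsets [set: 'I_n] r) T = 'C(n - #|T|, r - #|T|).
Proof.
move=> Tr; rewrite -[X in X - #|T|]card_ord -cardsT -card_between ?subsetT //.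
by apply: eq_card => E; rewrite !inE subsetT /= andbC.
Qed.

(** Both sides count the pairs of a t-set inside an r-set that contain a fixed
    vertex. *)
Lemma bin_flags n r t : 0 < t -> t <= r -> 0 < n ->
  'C(n - 1, t - 1) * 'C(n - t, r - t) = 'C(r - 1, t - 1) * 'C(n - 1, r - 1).
Proof.
case: n => // n t0 tr _; pose v : 'I_n.+1 := ord0.
have := sum_degree_sup (W := [set v]) (@uniform_rsubsets n.+1 r setT); rewrite cards1.
move=> /(_ t t0); rewrite degree_complete cards1; last by lia.
move=> <-; rewrite (eq_bigr (fun=> 'C(n.+1 - t, r - t))) => [|T]; last first.
  by rewrite !inE subsetT /= => /andP[/eqP cT _]; rewrite degree_complete cT.
rewrite sum_nat_const; congr (_ * _).
rewrite -(card_rsubsets_mem v t0); apply: eq_card => T; rewrite !inE sub1set //.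
Qed.

Definition link n (H : {set {set 'I_n}}) (T : {set 'I_n}) :=
  [set S : {set 'I_n} | [disjoint S & T] && (T :|: S \in H)].

Lemma card_link n (H : {set {set 'I_n}}) (T : {set 'I_n}) : #|link H T| = degree H T.
Proof.
have inj : {in link H T &, injective (fun S => T :|: S)}.
  move=> A B; rewrite !inE => /andP[dA _] /andP[dB _] /setP eq; apply/setP=> x.
  move: (eq x) dA dB; rewrite -!setI_eq0 => + /eqP/setP/(_ x) + /eqP/setP/(_ x).
  by rewrite !inE; do 3!case: (x \in _).
rewrite -(card_in_imset inj); apply: eq_card => E; rewrite [RHS]inE.
apply/imsetP/andP => [[S]|[HE TE]].
  by rewrite inE => /andP[_ HS] ->; rewrite HS subsetUl.
have TU : T :|: (E :\: T) = E by rewrite setDE setUIr setUCr setIT; apply/setUidPr.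
by exists (E :\: T) => //; rewrite inE TU HE andbT disjoints_subset subsetDr.
Qed.

Lemma uniform_link n r (H : {set {set 'I_n}}) (T : {set 'I_n}) :
  uniform r H -> uniform (r - #|T|) (link H T).
Proof.
move=> uH S; rewrite inE => /andP[dS /uH <-].
by rewrite cardsU setIC disjoint_setI0 // cards0; lia.
Qed.

Lemma degree_extensions n k (H : {set {set 'I_n}}) (T : {set 'I_n}) : uniform k H ->
  #|T| = k - 1 -> 0 < k ->
  degree H T = #|[set x | (x \notin T) && (x |: T \in H)]|.
Proof.
move=> uH cT k0; rewrite -card_link -[RHS](card_imset _ set1_inj); apply: eq_card => S.
apply/idP/imsetP => [lS|[x]].
  have := uniform_link uH lS; rewrite cT subKn // => /eqP/cards1P[x xS].
  exists x => //; move: lS; rewrite xS !inE disjoints1 setUC; exact: id.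
by rewrite inE => /andP[xT Hx] ->; rewrite inE disjoints1 xT setUC.
Qed.

(** * Flexible sets and seeds of linear paths *)

(** The members above a flexible set play the role of a large sunflower with
    kernel W; the formulation as an avoidance property is the one that greedy
    constructions use, and it is decidable. *)
Definition flex n (H : {set {set 'I_n}}) c (W : {set 'I_n}) : bool :=
  [forall Z : {set 'I_n}, (#|Z| <= c) && [disjoint Z & W] ==>
     [exists E in H, (W \subset E) && [disjoint E & Z]]].

Lemma flexP n (H : {set {set 'I_n}}) c (W : {set 'I_n}) :
  reflect (forall Z : {set 'I_n}, #|Z| <= c -> [disjoint Z & W] ->
             exists E, [/\ E \in H, W \subset E & [disjoint E & Z]])
          (flex H c W).
Proof.
apply: (iffP forallP) => [h Z cZ dZ|h Z].
  have := h Z; rewrite cZ dZ => /exists_inP[E HE /andP[sWE dE]].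
  by exists E.
by apply/implyP=> /andP[cZ dZ]; have [E [HE sE dE]] := h Z cZ dZ;
  apply/exists_inP; exists E; rewrite ?sE.
Qed.

Lemma flex_mem n (H : {set {set 'I_n}}) c E : E \in H -> flex H c E.
Proof. by move=> HE; apply/flexP=> Z _ dZ; exists E; split=> //; rewrite disjoint_sym. Qed.

Lemma flexS n (H G : {set {set 'I_n}}) c (W : {set 'I_n}) : H \subset G -> flex H c W ->
  flex G c W.
Proof.
move=> /subsetP sHG /flexP h; apply/flexP=> Z cZ dZ.
by have [E [HE sE dE]] := h Z cZ dZ; exists E; split=> //; exact: sHG.
Qed.

(** The members above W that meet a set Z of size c are too few to exhaust the
    degree of W.  For #|W| = k the condition just says that W belongs to H. *)
Lemma flex_degree n k c (H : {set {set 'I_n}}) (W : {set 'I_n}) : uniform k H ->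
  c * ((k - #|W|) * n ^ (k - #|W| - 1)) < degree H W -> flex H c W.
Proof.
move=> uH lt; apply/flexP=> Z cZ dZ.
have := card_meet_le uH dZ; set S := [set _ in _ | _] => leS.
have : 0 < #|[set E in H | W \subset E] :\: S|.
  rewrite cardsD subn_gt0; apply: leq_ltn_trans lt.
  apply: leq_trans (subset_leq_card (subsetIr _ _)) (leq_trans leS _).
  by rewrite leq_mul2r cZ orbT.
case/card_gt0P=> E; rewrite !inE negb_and => /andP[+ /andP[HE WE]].
by rewrite HE WE /= negbK => dE; exists E.
Qed.

(** One seed is enlarged at a time, off all other current sets.  The members
    already chosen are flexible too, so the state of the process is again a
    sequence of flexible sets with the same pairwise intersections. *)
Lemma expand_seeds n r c l (H : {set {set 'I_n}}) (W : nat -> {set 'I_n}) :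
  uniform r H -> l * r <= c -> (forall i, i < l -> flex H c (W i)) ->
  exists E : nat -> {set 'I_n},
    (forall i, i < l -> E i \in H /\ W i \subset E i) /\
    (forall i j, i < l -> j < l -> i != j -> E i :&: E j = W i :&: W j).
Proof.
move=> uH lec fW.
suff [E [EH EW EI]] : exists E : nat -> {set 'I_n},
    [/\ forall i, i < l -> flex H c (E i) /\ (i < l -> E i \in H),
        forall i, i < l -> W i \subset E i &
        forall i j, i < l -> j < l -> i != j -> E i :&: E j = W i :&: W j].
  by exists E; split=> // i li; split; [exact: (EH i li).2 | exact: EW].
suff : forall m, exists E : nat -> {set 'I_n},
    [/\ forall i, i < l -> flex H c (E i) /\ (i < m -> E i \in H),
        forall i, i < l -> W i \subset E i &
        forall i j, i < l -> j < l -> i != j -> E i :&: E j = W i :&: W j].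
  by move=> /(_ l).
elim=> [|m [E [EH EW EI]]]; first by exists W; split=> // i li; split=> //; exact: fW.
have [lm|gm] := ltnP m l; last first.
  exists E; split=> // i li; split; first by case: (EH i li).
  by move=> _; apply: (EH i li).2; apply: leq_trans gm.
have [/flexP fm _] := EH m lm.
pose Z := (\bigcup_(k < l | k != m :> nat) E k) :\: E m.
have cZ : #|Z| <= c.
  apply: leq_trans lec; apply: leq_trans (subset_leq_card (subsetDl _ _)) _.
  apply: leq_trans (card_bigcup_le _ _) _ => //.
  apply: leq_trans (_ : \sum_(k < l | k != m :> nat) r <= _); last first.
    by rewrite sum_nat_const leq_mul2r (leq_trans (max_card _)) ?card_ord ?orbT.
  apply: leq_sum => k _; have [/flexP/(_ set0) fk _] := EH k (ltn_ord k).
  have [||F [HF sF _]] := fk; rewrite ?cards0 ?disjoints_subset ?sub0set //.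
  by rewrite -(uH _ HF); exact: subset_leq_card.
have [|F [HF sF dF]] := fm Z cZ.
  by rewrite -setI_eq0 setIC; apply/eqP/setP=> x; rewrite !inE; case: (x \in E m).
have FI k : k < l -> k != m -> F :&: E k = E m :&: E k.
  move=> lk km; apply/setP=> x; rewrite !inE.
  case xE : (x \in E k); rewrite ?andbF // !andbT; apply/idP/idP; last exact: (subsetP sF).
  apply: contraLR => xm; apply/negP=> xF; move: dF; rewrite -setI_eq0 => /eqP/setP/(_ x).
  rewrite !inE xF xm /=; have -> // : x \in \bigcup_(k < l | k != m :> nat) E k.
  by apply/bigcupP; exists (Ordinal lk).
exists (fun i => if i == m then F else E i); split.
- move=> i li; case: eqP => [->|/eqP im]; first by split=> //; exact: flex_mem.
  have [h1 h2] := EH i li; split=> // lim; apply: h2; lia.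
- by move=> i li; case: eqP => [->|_]; [exact: subset_trans (EW m lm) sF | exact: EW].
- move=> i j li lj ij; case: eqP => [im|/eqP im]; case: eqP => [jm|/eqP jm].
  + by move: ij; rewrite im jm eqxx.
  + by rewrite FI // -im EI.
  + by rewrite setIC FI // setIC -jm EI.
  + exact: EI.
Qed.

(** The form in which path-freeness is used everywhere.  Injectivity of the path
    comes for free: equal edges would meet in r >= 3 points. *)
Lemma no_seeds n r l (H : {set {set 'I_n}}) (W : nat -> {set 'I_n}) :
  3 <= r -> uniform r H -> path_free r l H ->
  (forall i, i < l -> flex H (l * r) (W i)) ->
  (forall i j, i < j -> j < l -> #|W i :&: W j| = (j == i.+1)) -> False.
Proof.
move=> r3 uH free fW WI; have [E [EH EI]] := expand_seeds uH (leqnn _) fW.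
have EI' i j : i < j -> j < l -> #|E i :&: E j| = (j == i.+1).
  by move=> ij lj; rewrite EI ?WI //; lia.
apply: free; exists (fun i : 'I_l => E i); split; last by move=> i; case: (EH i (ltn_ord i)).
split.
- suff h (i j : 'I_l) : i < j -> E i = E j -> False.
    move=> i j eqE; apply: val_inj; case: (ltngtP i j) => // lt; first by case: (h i j).
    by case: (h j i).
  move=> ij eqE; have := EI' i j ij (ltn_ord j); rewrite eqE setIid.
  by rewrite (uH _ (EH j (ltn_ord j)).1); case: (_ == _); lia.
- by move=> i; rewrite (uH _ (EH i (ltn_ord i)).1).
- by move=> i j ij; rewrite EI' ?ltn_ord //; lia.
- move=> i j ij; apply/eqP; rewrite -cards_eq0 EI' ?ltn_ord //; lia.
Qed.

(** Seeds whose consecutive intersections are partly provided by the sets U and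
    partly by added vertices: U j receives the vertex x (g j), and two U with the
    same label g are joined through it. *)
Lemma no_joined n r l (H : {set {set 'I_n}}) (U : nat -> {set 'I_n}) (g : nat -> nat) x :
  3 <= r -> uniform r H -> path_free r l H ->
  (forall i j, i < j -> j < l -> #|U i :&: U j| + (g i == g j) = (j == i.+1)) ->
  (forall i j, i < l -> j < l -> x (g i) \notin U j) ->
  (forall i j, i < l -> j < l -> x (g i) = x (g j) -> g i = g j) ->
  (forall i, i < l -> flex H (l * r) (x (g i) |: U i)) -> False.
Proof.
move=> r3 uH free UI xU xI xf.
apply: (no_seeds r3 uH free xf) => i j ij jl; rewrite -UI //.
have il : i < l by lia.
have -> : (x (g i) |: U i) :&: (x (g j) |: U j) =
   (U i :&: U j) :|: (if g i == g j then [set x (g i)] else set0).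
  apply/setP=> y; rewrite !inE.
  have -> : (y \in (if g i == g j then [set x (g i)] else set0)) = (g i == g j) && (y == x (g i)).
    by case: ifP; rewrite inE.
  have xx : (x (g i) == x (g j)) = (g i == g j).
    by apply/eqP/eqP => [/xI|->//]; apply.
  case: (y =P x (g i)) => [->|] /=.
    by rewrite xx (negbTE (xU _ _ _ jl)) // (negbTE (xU _ _ il il)) orbF /= andbT.
  move=> _; rewrite andbF orbF; case: (y =P x (g j)) => [->|] //=.
  by rewrite (negbTE (xU _ _ jl il)).
case: eqP => [_|_]; last by rewrite setU0 addn0.
rewrite setUC cardsU1 !inE (negbTE (xU _ _ il il)) /= addnC //.
Qed.

(** * Walks of flexible pairs *)

Definition shadow n k (H : {set {set 'I_n}}) :=
  [set W in rsubsets [set: 'I_n] k.-1 | 0 < degree H W].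

Lemma shadowE n k (H : {set {set 'I_n}}) W :
  (W \in shadow k H) = (#|W| == k.-1) && (0 < degree H W).
Proof. by rewrite !inE subsetT. Qed.

(** Removing the members above a shadow set of degree at most c removes at most c
    members and at least one shadow set, hence preserves the hypothesis. *)
Lemma full_subfamily n k c (H : {set {set 'I_n}}) :
  c * #|shadow k H| < #|H| ->
  exists G : {set {set 'I_n}}, [/\ G \subset H, G != set0 &
    forall W : {set 'I_n}, #|W| = k.-1 -> 0 < degree G W -> c < degree G W].
Proof.
have [m] := ubnP #|H|; elim: m H => // m IH H; rewrite ltnS => leH lt.
have [/existsP[W /and3P[WS dW]]|/existsPn full] :=
  boolP [exists W : {set 'I_n}, [&& W \in shadow k H, degree H W <= c & true]].
  move=> _; move: (WS); rewrite shadowE => /andP[cW dW0].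
  pose G := H :\: [set E in H | W \subset E].
  have sG : G \subset H by exact: subsetDl.
  have cG : #|G| = #|H| - degree H W.
    by rewrite cardsD (setIidPr _) //; apply/subsetP=> E; rewrite inE => /andP[].
  have lsh : #|shadow k G| < #|shadow k H|.
    apply: proper_card; apply/properP; split.
      apply/subsetP=> U; rewrite !shadowE => /andP[-> h].
      exact: leq_trans h (degreeS _ sG).
    exists W; first by [].
    rewrite shadowE cW /= -eqn0Ngt; apply/eqP/eqP; rewrite -leqn0 leqNgt.
    by apply/negP=> /degree_gt0[E]; rewrite !inE => /andP[+ HE] WE; rewrite HE WE.
  have [||K [sK K0 fK]] := IH G.
  - lia.
  - rewrite cG; nia.
  - by exists K; split=> //; exact: subset_trans sK sG.
exists H; split=> //; first by rewrite -card_gt0; lia.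
move=> W cW dW; have := full W; rewrite shadowE cW eqxx dW /= andbT.
by rewrite -ltnNge.
Qed.

(** If every shadow set has large degree, the points of a member can be exchanged
    one by one, so a member above W that meets Z least must miss Z. *)
Lemma full_flex n k c (G : {set {set 'I_n}}) : 0 < k -> uniform k G ->
  (forall W : {set 'I_n}, #|W| = k.-1 -> 0 < degree G W -> c < degree G W) ->
  forall (E W : {set 'I_n}), E \in G -> W \subset E -> flex G c W.
Proof.
move=> k0 uG full E0 W GE0 sW0; apply/flexP=> Z cZ dZ.
pose P := [pred E | (E \in G) && (W \subset E)].
have PE0 : P E0 by rewrite /= GE0.
case: (arg_minnP (fun E : {set 'I_n} => #|E :&: Z|) PE0) => E /andP[GE WE] minE.
exists E; split=> //; rewrite -setI_eq0; apply/negPn/negP => /set0Pn[z].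
rewrite inE => /andP[zE zZ].
pose W0 := E :\ z.
have cW0 : #|W0| = k.-1 by rewrite -(uG _ GE) (cardsD1 z E) zE.
have dW0 : c < degree G W0.
  by apply: full => //; apply/degree_gt0; exists E => //; exact: subsetDl.
have : 0 < #|[set F in G | W0 \subset F] :\: [set x |: W0 | x in Z]|.
  rewrite cardsD subn_gt0; apply: leq_ltn_trans dW0.
  apply: leq_trans (subset_leq_card (subsetIr _ _)) _.
  exact: leq_trans (leq_imset_card _ _) cZ.
case/card_gt0P=> F; rewrite !inE => /andP[/imsetP nF /andP[GF sF]].
have /cards1P[x xF] : #|F :\: W0| == 1.
  by rewrite cardsDS // (uG _ GF) cW0; apply/eqP; lia.
have FE : F = x |: W0.
  by rewrite -xF; apply/setP=> y; rewrite in_setU in_setD;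
    case: (boolP (y \in W0)) => [/(subsetP sF)->|_]; rewrite ?orbF.
have xZ : x \notin Z by apply/negP=> xZ; apply: nF; exists x.
have : #|E :&: Z| <= #|F :&: Z|.
  apply: minE; rewrite /= GF (subset_trans _ sF) // subsetD1 WE /=.
  by move: dZ; rewrite disjoint_subset => /subsetP/(_ z zZ).
rewrite leqNgt => /negP; apply; apply: proper_card; apply/properP; split.
  apply/subsetP=> y; rewrite FE !inE => /andP[/orP[/eqP->|/andP[_ ->]] yZ] //.
  by rewrite yZ in xZ.
exists z; rewrite ?inE ?zE // FE !inE eqxx orbF zZ andbT; apply: contraNneq xZ => <-.
by [].
Qed.

Definition distinct_upto (T : Type) l (z : nat -> T) :=
  forall i j, i <= l -> j <= l -> z i = z j -> i = j.

(** Inside a full subfamily the flexibility of the last vertex of the walk yields a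
    member off the earlier vertices, which contains a next vertex. *)
Lemma flexible_walk n k c l (H : {set {set 'I_n}}) : 1 < k -> uniform k H -> l <= c ->
  c * #|shadow k H| < #|H| ->
  exists z : nat -> 'I_n, distinct_upto l z /\
    forall i, i < l -> flex H c [set z i; z i.+1].
Proof.
move=> k1 uH lc lt; have [G [sG G0 full]] := full_subfamily lt.
have fG := full_flex (ltnW k1) (uniformS sG uH) full.
suff [z [zI zE]] : exists z : nat -> 'I_n, distinct_upto l z /\
    forall i, i < l -> exists2 E, E \in G & [set z i; z i.+1] \subset E.
  exists z; split=> // i il; have [E GE sE] := zE i il.
  by apply: flexS sG _; exact: fG sE.
suff main : forall m, m <= l -> exists z : nat -> 'I_n, [/\ distinct_upto m z,
    forall i, i < m -> exists2 E, E \in G & [set z i; z i.+1] \subset E &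
    exists2 E, E \in G & z m \in E].
  by have [z [zI zE _]] := main l (leqnn l); exists z.
elim=> [_|m IH ml].
  case/set0Pn: G0 => E GE; have /card_gt0P[x xE] : 0 < #|E| by rewrite (uH _ (subsetP sG _ GE));
    lia.
  by exists (fun=> x); split=> [i j|//|]; [lia | exists E].
have [z [zI zE [E GE zmE]]] := IH (ltnW ml).
have /flexP fm : flex G c [set z m] by apply: (fG E); rewrite ?sub1set.
have [||F [GF]] := fm [set z i | i : 'I_m].
- by apply: leq_trans (leq_imset_card _ _) _; rewrite card_ord; lia.
- rewrite disjoint_sym disjoints1; apply/negP=> /imsetP[i _ eq].
  by have := zI m i (leqnn _) (ltnW (ltn_ord i)) eq; have := ltn_ord i; lia.
rewrite sub1set => zmF dF.
have : 0 < #|F :\ z m| by rewrite cardsDS ?sub1set // cards1 (uH _ (subsetP sG _ GF)); lia.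
case/card_gt0P=> y; rewrite !inE => /andP[ym yF].
have yN i : i <= m -> y != z i.
  rewrite leq_eqVlt => /orP[/eqP->//|im]; apply/negP=> /eqP yi.
  move: dF; rewrite disjoint_subset => /subsetP/(_ y yF)/negP; apply.
  by apply/imsetP; exists (Ordinal im).
exists (fun i => if i == m.+1 then y else z i); split.
- move=> i j im jm; case: eqP => [->|/eqP ni]; case: eqP => [->|/eqP nj] //.
  + by move=> eq; have := yN j; rewrite eq eqxx; lia.
  + by move=> eq; have := yN i; rewrite eq eqxx; lia.
  + by apply: zI; lia.
- move=> i im; rewrite ltn_eqF // eqSS; case: eqP => [->|/eqP ne].
    by exists F => //; rewrite subUset !sub1set zmF.
  by apply: zE; lia.
- by exists F; rewrite ?eqxx.
Qed.

Lemma card_pairI (T : finType) l (z : nat -> T) i j : distinct_upto l z ->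
  i < j -> j < l -> #|[set z i; z i.+1] :&: [set z j; z j.+1]| = (j == i.+1).
Proof.
move=> zI ij jl.
have ne a b : a <= l -> b <= l -> a != b -> (z a == z b) = false.
  by move=> al bl ab; apply/negP=> /eqP/(zI a b al bl)/eqP; apply/negP.
case: eqP => [->|nj].
  have -> : [set z i; z i.+1] :&: [set z i.+1; z i.+2] = [set z i.+1].
    apply/setP=> x; rewrite !inE; case: (x =P z i.+1) => [->|_] //=; first by rewrite orbT.
    by rewrite orbF; case: (x =P z i) => [->|//]; rewrite ne //; lia.
  by rewrite cards1.
apply/eqP; rewrite cards_eq0 -subset0; apply/subsetP=> x; rewrite !inE.
by case/andP=> /orP[] /eqP-> /orP[]; rewrite ne //; lia.
Qed.

(** The path-free analogue of the trivial bound for forests: a walk of flexible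
    pairs is a sequence of seeds. *)
Lemma free_card_le_shadow n r l (H : {set {set 'I_n}}) : 3 <= r -> 0 < l -> uniform r H ->
  path_free r l H -> #|H| <= l * r * #|shadow r H|.
Proof.
move=> r3 l0 uH free; rewrite leqNgt; apply/negP=> lt.
have le : l <= l * r by rewrite leq_pmulr //; lia.
have [z [zI zf]] := flexible_walk (ltnW r3) uH le lt.
by apply: (no_seeds r3 uH free zf) => i j ij jl; rewrite (card_pairI zI).
Qed.

Lemma card_shadow_le n k (H : {set {set 'I_n}}) : #|shadow k H| <= n ^ k.-1.
Proof.
apply: leq_trans (leq_bin_exp _ _); rewrite -card_rsubsets; apply: subset_leq_card.
by apply/subsetP=> W; rewrite inE => /andP[].
Qed.

(** * Detours through a fixed set of vertices *)

(** The walk x 0, v 0, x 1, v 1, ..., v (m - 1), x m; each v lies in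
    two of its pairs, which is how s - 1 vertices carry 2s - 2 edges of a path. *)
Lemma zigzag n (H : {set {set 'I_n}}) c m (x v : nat -> 'I_n) :
  distinct_upto m x -> (forall i j, i < m -> j < m -> v i = v j -> i = j) ->
  (forall i j, i <= m -> j < m -> x i <> v j) ->
  (forall i j, i <= m -> j < m -> flex H c [set x i; v j]) ->
  let z i := if odd i then v i./2 else x i./2 in
  distinct_upto (2 * m) z /\ forall i, i < 2 * m -> flex H c [set z i; z i.+1].
Proof.
move=> xI vI xv fl z; split=> [i j im jm|i im]; rewrite /z.
  case: ifP => oi; case: ifP => oj.
  - by move=> /vI; lia.
  - by move=> /esym/xv; lia.
  - by move=> /xv; lia.
  - by move=> /xI; lia.
rewrite /=; case: ifP => oi /=; last by rewrite uphalf_half oi; apply: fl; lia.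
by rewrite setUC; apply: fl; lia.
Qed.

Section Bridges.
Variables (n r s : nat) (H : {set {set 'I_n}}) (L X : {set 'I_n}).
Let c := 2 * s * r.
Hypotheses (r3 : 3 <= r) (s2 : 2 <= s) (uH : uniform r H) (free : path_free r (2 * s) H).
Hypotheses (XL : [disjoint X & L]) (fX : {in X & L, forall x v, flex H c [set x; v]}).

(** A zigzag through s vertices already has 2s steps. *)
Lemma no_common_walk : s <= #|L| -> s < #|X| -> False.
Proof.
move=> cL cX.
have [|v [vL vI]] := enum_fun (_ : 0 < s) cL; first by nlia.
have [x [xX xI]] := enum_fun (ltn0Sn s) cX.
have XLn x' v' : x' \in X -> v' \in L -> x' <> v'.
  by move=> xX' vL' eq; move: XL; rewrite disjoint_subset => /subsetP/(_ _ xX')/negP; rewrite eq.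
have [||||zI zf] := @zigzag n H c s x v.
- by move=> i j; exact: xI.
- exact: vI.
- by move=> i j is1 js; apply: XLn; [exact: xX | exact: vL].
- by move=> i j is1 js; apply: fX; [exact: xX | exact: vL].
by apply: (no_seeds r3 uH free zf) => i j ij jl; rewrite (card_pairI zI).
Qed.

(** A zigzag through all of L from x0 to x1 whose other vertices outside L avoid
    D.  It has 2s - 2 steps, so two more edges complete a forbidden path. *)
Lemma bridge_walk (D : {set 'I_n}) x0 x1 : #|L| = s - 1 -> s + #|D| <= #|X| ->
  x0 \in X -> x1 \in X -> x0 \in D -> x1 \in D -> x0 != x1 -> exists z : nat -> 'I_n,
   [/\ distinct_upto (2 * (s - 1)) z, forall i, i < 2 * (s - 1) -> flex H c [set z i; z i.+1],
     z 0 = x0, z (2 * (s - 1)) = x1 &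
     forall i, i <= 2 * (s - 1) -> z i \in D :\: L -> i = 0 \/ i = 2 * (s - 1)].
Proof.
move=> cL cX x0X x1X x0D x1D x01.
have [|v [vL vI]] := enum_fun (_ : 0 < s - 1) (eq_leq (esym cL)); first by nlia.
have cXD : s <= #|X :\: D|.
  by rewrite cardsD; have := subset_leq_card (subsetIr X D); nlia.
have [|y [yX yI]] := enum_fun (_ : 0 < s) cXD; first by nlia.
have XLn x' v' : x' \in X -> v' \in L -> x' <> v'.
  by move=> xX' vL' eq; move: XL; rewrite disjoint_subset => /subsetP/(_ _ xX')/negP; rewrite eq.
(* The end points are prescribed; the s points y supply the inner ones. *)
pose x i := if i == 0 then x0 else if i == s - 1 then x1 else y i.
have xX i : i <= s - 1 -> x i \in X.
  by rewrite /x; case: eqP => // _; case: eqP => // ne le; have [|] := setDP (yX i _);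
    first by nlia.
have yD i a : i < s -> a \in D -> y i <> a.
  by move=> is1 aD eq; have [_] := setDP (yX i is1); rewrite eq aD.
have xI : distinct_upto (s - 1) x.
  move=> i j im jm; rewrite /x; case: (i =P 0) => [i0|i0]; case: (j =P 0) => [j0|j0]; try nlia.
  - case: (j =P s - 1) => [_ e|j1 e]; first by rewrite e eqxx in x01.
    by exfalso; apply: (yD j x0) => //; nlia.
  - case: (i =P s - 1) => [_ e|i1 e]; first by rewrite e eqxx in x01.
    by exfalso; apply: (yD i x0) => //; nlia.
  - case: (i =P s - 1) => [i1|i1]; case: (j =P s - 1) => [j1|j1] e; try nlia.
    + by exfalso; apply: (yD j x1) => //; nlia.
    + by exfalso; apply: (yD i x1) => //; nlia.
    + by apply: yI => //; nlia.
have [||zI zf] := @zigzag n H c (s - 1) x v xI vI.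
- by move=> i j im jm; apply: XLn; [exact: xX | exact: vL].
- by move=> i j im jm; apply: fX; [exact: xX | exact: vL].
set z := fun i => _ in zI zf; exists z; split=> //.
- have -> : z (2 * (s - 1)) = x (s - 1) by rewrite /z mul2n odd_double doubleK.
  by rewrite /x eqxx; case: eqP => //; nlia.
- move=> i im; rewrite /z inE; case: ifP => oi.
    by rewrite vL; nlia.
  case/andP=> _; rewrite /x; case: eqP => [i0 _|i0]; first by left; nlia.
  case: eqP => [i1 _|i1]; first by right; nlia.
  by move=> yiD; exfalso; apply: (yD i./2 _ _ yiD) => //; nlia.
Qed.

(** The two additional edges sit at the two ends of the zigzag. *)
Lemma no_bridge A B x0 x1 : #|L| = s - 1 -> s + 2 * r <= #|X| ->
  A \in H -> B \in H -> A :&: B = set0 -> [disjoint A & L] -> [disjoint B & L] ->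
  x0 \in A -> x1 \in B -> x0 \in X -> x1 \in X -> False.
Proof.
move=> cL cX HA HB AB AL BL x0A x1B x0X x1X.
have nAB y : y \in A -> y \in B -> False.
  by move=> yA yB; move/setP/(_ y): AB; rewrite !inE yA yB.
have x01 : x0 != x1 by apply/eqP=> e; apply: (nAB x0); rewrite // e.
have AL' y : y \in A -> y \notin L by move: AL; rewrite disjoint_subset => /subsetP/(_ y).
have BL' y : y \in B -> y \notin L by move: BL; rewrite disjoint_subset => /subsetP/(_ y).
have [||||z [zI zf z0 z1 zD]] := @bridge_walk (A :|: B) x0 x1 cL _ x0X x1X.
- by have [le _] := leq_card_setU A B; move: le; rewrite (uH HA) (uH HB); nlia.
- by rewrite inE x0A.
- by rewrite inE x1B orbT.
- exact: x01.
have zA i : i <= 2 * (s - 1) -> z i \in A -> i = 0.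
  move=> im zA; case: (zD i im) => [|//|e]; first by rewrite !inE AL' ?zA.
  by case: (nAB (z i)) => //; rewrite e z1.
have zB i : i <= 2 * (s - 1) -> z i \in B -> i = 2 * (s - 1).
  move=> im zB; case: (zD i im) => [|e|//]; first by rewrite !inE BL' ?zB ?orbT.
  by case: (nAB (z i)) => //; rewrite e z0.
pose W j := if j == 0 then A else if j == 2 * s - 1 then B else [set z j.-1; z j].
apply: (@no_seeds n r (2 * s) H W) => //.
- move=> i il; rewrite /W; case: eqP => [_|ni]; first exact: flex_mem.
  case: eqP => [_|mi]; first exact: flex_mem.
  by have := zf i.-1; rewrite prednK; [apply; nlia | nlia].
- move=> i j ij jl; rewrite /W; case: (i =P 0) => [i0|ni]; case: (j =P 0) => [j0|nj]; try nlia.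
  + case: eqP => [j1|mj].
      by rewrite AB cards0; nlia.
    case: (j =P i.+1) => [e|ne].
      have -> : A :&: [set z j.-1; z j] = [set x0]; last by rewrite cards1.
      have -> : j.-1 = 0 by nlia.
      rewrite z0; apply/setP=> y; rewrite !inE; case: (y =P x0) => [->|_ /=];
        first by rewrite x0A.
      by apply/andP=> -[yA /eqP e']; have := zA j; rewrite -e' yA; nlia.
    apply/eqP; rewrite cards_eq0 -subset0; apply/subsetP=> y; rewrite !inE.
    by case/andP=> yA /orP[] /eqP e'; [have := zA j.-1 | have := zA j]; rewrite -e' yA; nlia.
  + case: (i =P 2 * s - 1) => [|_]; first by nlia.
    case: eqP => [j1|mj].
      case: (j =P i.+1) => [e|ne].
        have -> : [set z i.-1; z i] :&: B = [set x1]; last by rewrite cards1.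
        have -> : i = 2 * (s - 1) by nlia.
        rewrite z1; apply/setP=> y; rewrite !inE; case: (y =P x1) => [->|_];
          first by rewrite x1B orbT.
        rewrite orbF; apply/andP=> -[/eqP e' yB]; have := zB (2 * (s - 1)).-1; rewrite -e' yB;
          nlia.
      apply/eqP; rewrite cards_eq0 -subset0; apply/subsetP=> y; rewrite !inE.
      by case/andP=> /orP[] /eqP e' yB; [have := zB i.-1 | have := zB i]; rewrite -e' yB; nlia.
    have := @card_pairI _ _ z i.-1 j.-1 zI; rewrite !prednK; [|nlia|nlia].
    by move=> ->; nlia.
Qed.

(** The two additional edges sit at the same end of the zigzag. *)
Lemma no_tail A B x0 : #|L| = s - 1 -> s + 2 * r <= #|X| ->
  A \in H -> B \in H -> #|A :&: B| = 1 -> [disjoint A & L] -> [disjoint B & L] ->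
  x0 \in B -> x0 \notin A -> x0 \in X -> False.
Proof.
move=> cL cX HA HB AB AL BL x0B x0A x0X.
have AL' y : y \in A -> y \notin L by move: AL; rewrite disjoint_subset => /subsetP/(_ y).
have BL' y : y \in B -> y \notin L by move: BL; rewrite disjoint_subset => /subsetP/(_ y).
have cAB : #|A :|: B| = 2 * r - 1 by rewrite cardsU AB (uH HA) (uH HB); nlia.
have /card_gt0P[x1] : 0 < #|X :\: (A :|: B)|.
  by rewrite cardsD; have := subset_leq_card (subsetIr X (A :|: B)); nlia.
rewrite !inE negb_or => /andP[/andP[x1A x1B] x1X].
have x01 : x0 != x1 by apply: contraNneq x1B => <-.
have [||||z [zI zf z0 z1 zD]] := @bridge_walk (x1 |: (A :|: B)) x0 x1 cL _ x0X x1X.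
- by rewrite cardsU1; case: (_ \notin _); nlia.
- by rewrite !inE x0B !orbT.
- by rewrite !inE eqxx.
- exact: x01.
have zAB i : i <= 2 * (s - 1) -> z i \in A :|: B -> i = 0.
  move=> im zAB; case: (zD i im) => [|//|e].
    by rewrite !inE; move: zAB; rewrite inE => /orP[h|h]; rewrite h ?(AL' _ h) ?(BL' _ h) !orbT.
  by move: zAB; rewrite e z1 inE (negbTE x1A) (negbTE x1B).
have zA i : i <= 2 * (s - 1) -> z i \in A -> False.
  move=> im zA; have e : i = 0 by apply: zAB => //; rewrite inE zA.
  by move: zA; rewrite e z0 (negbTE x0A).
have zB i : i <= 2 * (s - 1) -> z i \in B -> i = 0.
  by move=> im zB; apply: zAB => //; rewrite inE zB orbT.
pose W j := if j == 0 then A else if j == 1 then B else [set z j.-2; z j.-1].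
apply: (@no_seeds n r (2 * s) H W) => //.
- move=> i il; rewrite /W; case: eqP => [_|ni]; first exact: flex_mem.
  case: eqP => [_|mi]; first exact: flex_mem.
  by have := zf i.-2; rewrite (_ : i.-2.+1 = i.-1); [apply; nlia | nlia].
- move=> i j ij jl; rewrite /W; case: (i =P 0) => [i0|ni]; case: (j =P 0) => [j0|nj]; try nlia.
  + case: eqP => [j1|mj]; first by rewrite AB; nlia.
    have -> : A :&: [set z j.-2; z j.-1] = set0; last by rewrite cards0; nlia.
    apply/eqP; rewrite -subset0; apply/subsetP=> y; rewrite !inE.
    by case/andP=> yA /orP[] /eqP e'; [case: (zA j.-2) | case: (zA j.-1)]; rewrite -?e' ?yA //;
      nlia.
  + case: (j =P 1) => [|_]; first by nlia.
    case: (i =P 1) => [i1|mi].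
      case: (j =P i.+1) => [e|ne].
        have -> : B :&: [set z j.-2; z j.-1] = [set x0]; last by rewrite cards1.
        have -> : j.-2 = 0 by nlia.
        rewrite z0; apply/setP=> y; rewrite !inE; case: (y =P x0) => [->|_ /=];
          first by rewrite x0B.
        by apply/andP=> -[yB /eqP e']; have := zB j.-1; rewrite -e' yB; nlia.
      apply/eqP; rewrite cards_eq0 -subset0; apply/subsetP=> y; rewrite !inE.
      by case/andP=> yB /orP[] /eqP e'; [have := zB j.-2 | have := zB j.-1]; rewrite -e' yB; nlia.
    have ei : i.-2.+1 = i.-1 by nlia.
    have ej : j.-2.+1 = j.-1 by nlia.
    have := @card_pairI _ _ z i.-2 j.-2 zI; rewrite ei ej => ->; nlia.
Qed.
End Bridges.

(** * Covering the dense sets *)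

Definition dense n r k (H : {set {set 'I_n}}) (T : {set 'I_n}) :=
  n ^ (r - #|T|) <= k * degree H T.

(** Among many disjoint dense t-sets some 2s have a common link of positive
    density.  This is a family of sets of size r - t >= 2, so it contains a walk of
    flexible pairs, and consecutive dense sets are joined along it. *)
Lemma dense_matching_bounded r l t k : 0 < l -> 0 < k -> 0 < t -> t.+1 < r ->
  eventually (fun n => forall H : {set {set 'I_n}}, uniform r H -> path_free r l H ->
    forall T : nat -> {set 'I_n},
      (forall i, i < 2 * k * l -> #|T i| = t /\ dense r k H (T i)) ->
      (forall i j, i < 2 * k * l -> j < 2 * k * l -> i != j -> T i :&: T j = set0) -> False).
Proof.
move=> l0 k0 t0 tr; set m := 2 * k * l; pose K := 2 * k * 2 ^ m; pose u := r - t.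
exists (2 * u + bin_scale u * K * (l * r) + 1) => n nN H uH free T Td TI.
have cP : #|rsubsets [set: 'I_n] u| = 'C(n, u) by exact: card_rsubsets.
have le_nu : n ^ u <= bin_scale u * 'C(n, u) by have := @exp_le_bin 0 u n; rewrite subn0; apply;
  lia.
have u1 : 1 < u by rewrite /u; lia.
have P0 : rsubsets [set: 'I_n] u != set0 by rewrite -card_gt0 cP bin_gt0; lia.
have [||J cJ leJ] := @common_subfamily _ (rsubsets [set: 'I_n] u) k l (fun i =>
  link H (T i)) l0 k0 P0.
- move=> i; apply/subsetP=> S lS; rewrite inE subsetT (uniform_link uH lS).
  by rewrite (Td i (ltn_ord i)).1 eqxx.
- move=> i; rewrite cP card_link; apply: leq_trans (leq_bin_exp _ _) _.
  by have [cT] := Td i (ltn_ord i); rewrite /dense cT.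
have lJ : l <= #|J| by rewrite cJ.
have [e [eJ eI]] := enum_fun l0 lJ.
set S := \bigcap_(i in J) link H (T i) in leJ.
have SJ A i : i < l -> A \in S -> A \in link H (T (e i)).
  by move=> il /bigcapP; apply; exact: eJ.
have uS : uniform u S.
  move=> A /(SJ _ 0 l0)/(uniform_link uH).
  by rewrite (Td _ (ltn_ord (e 0))).1.
have r3 : 3 <= r by lia.
have lS : (l * r) * #|shadow u S| < #|S|.
  apply: leq_ltn_trans (leq_mul (leqnn _) (card_shadow_le u S)) _.
  rewrite -(@ltn_pmul2l (bin_scale u * K));
    last by rewrite muln_gt0 bin_scale_gt0 /K !muln_gt0 k0 expn_gt0.
  apply: leq_trans (_ : n ^ u <= _).
    have lt : bin_scale u * K * (l * r) < n by lia.
    by have := lower_order u.-1 lt; rewrite prednK ?mulnA // ltnW.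
  apply: leq_trans le_nu _; rewrite -mulnA leq_mul2l; apply/orP; right.
  by rewrite -cP.
have lr : l <= l * r by rewrite leq_pmulr //; lia.
have [z [zI zf]] := flexible_walk u1 uS lr lS.
have zT i j : i <= l -> j < l -> z i \notin T (e j).
  move=> il jl; have [a al zia] : exists2 a, a < l & z i \in [set z a; z a.+1].
    case: (ltnP i l) => [lt|ge]; first by exists i; rewrite // !inE eqxx.
    exists l.-1; first by lia.
    have -> : l.-1.+1 = i by lia.
    by rewrite !inE eqxx orbT.
  have /flexP/(_ set0) := zf a al; rewrite cards0 disjoints_subset sub0set.
  move=> /(_ isT isT)[A [SA sA _]]; have := SJ A j jl SA; rewrite inE => /andP[dA _].
  by move: dA; rewrite disjoint_subset => /subsetP/(_ (z i)); apply; apply: (subsetP sA).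
apply: (@no_seeds n r l H (fun i => T (e i) :|: [set z i; z i.+1])) => //.
- move=> i il; apply/flexP=> Z cZ dZ.
  have /flexP/(_ Z cZ)[|A [SA sA dA]] := zf i il.
    by apply: disjointWr dZ; exact: subsetUr.
  have := SJ A i il SA; rewrite inE => /andP[_ HA].
  exists (T (e i) :|: A); split=> //; first exact: setUS.
  rewrite disjoint_sym -setI_eq0 setIUr setU_eq0 !setI_eq0 [_ && _]andbC disjoint_sym dA /=.
  by apply: disjointWr dZ; exact: subsetUl.
- move=> i j ij jl; rewrite -(card_pairI zI ij jl).
  have il : i < l by lia.
  have TT : T (e i) :&: T (e j) = set0.
    apply: TI => //; apply/negP=> /eqP/val_inj /eI; lia.
  congr #|pred_of_set _|; apply/setP=> y; rewrite !inE.
  move/setP/(_ y): TT; rewrite !inE => TT.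
  case: (boolP (y \in T (e i))) TT => [yi /= yj|_ _ /=].
    have ne a : a <= l -> (y == z a) = false.
      by move=> al; apply: contraTF yi => /eqP->; exact: zT.
    by rewrite yj !ne //; lia.
  case: (boolP (y \in T (e j))) => // yj; rewrite !andbT.
  have ne a : a <= l -> (y == z a) = false.
    by move=> al; apply: contraTF yj => /eqP->; exact: zT.
  by rewrite !ne //; lia.
Qed.

(** For t = r - 1 links consist of single vertices, which can serve one junction
    only; the other junctions are the vertices that T i and T' i share.  Averaging
    is done on pairs of vertices, as the links of T i and of T' i may be
    disjoint. *)
Lemma dense_pairs_bounded r s k : 3 <= r -> 0 < s -> 0 < k ->
  eventually (fun n => forall H : {set {set 'I_n}}, uniform r H -> path_free r (2 * s) H ->
    forall T T' : nat -> {set 'I_n},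
      (forall i, i < 2 * k ^ 2 * s -> [/\ #|T i| = r - 1, #|T' i| = r - 1, dense r k H (T i),
        dense r k H (T' i)
         & #|T i :&: T' i| = 1]) ->
      (forall i j, i < 2 * k ^ 2 * s -> j < 2 * k ^ 2 * s -> i != j ->
        (T i :|: T' i) :&: (T j :|: T' j) = set0) -> False).
Proof.
move=> r3 s0 k0; set m := 2 * k ^ 2 * s; pose K := 2 * k ^ 2 * 2 ^ m.
exists (K * (s.+1 + 2 * s * r) + 1) => n nN H uH free T T' Td TI.
pose X (A : {set 'I_n}) := [set x | (x \notin A) && (x |: A \in H)].
have cX (A : {set 'I_n}) : #|A| = r - 1 -> dense r k H A -> n <= k * #|X A|.
  by move=> cA; rewrite /dense cA subKn ?expn1 ?(degree_extensions uH cA) //; lia.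
have k2 : 0 < k ^ 2 by rewrite expn_gt0 k0.
have n0 : 0 < n by lia.
have P0 : [set: 'I_n * 'I_n] != set0 by rewrite -card_gt0 cardsT card_prod card_ord muln_gt0 n0.
have [||J cJ leJ] := @common_subfamily _ [set: 'I_n * 'I_n] (k ^ 2) s
    (fun i => setX (X (T i)) (X (T' i))) s0 k2 P0.
- by move=> i; exact: subsetT.
- move=> i; rewrite cardsT card_prod card_ord cardsX.
  have [c1 c2 d1 d2 _] := Td i (ltn_ord i).
  have h := leq_mul (cX _ c1 d1) (cX _ c2 d2); apply: leq_trans h _.
  by rewrite mulnACA leq_mul // -expn2.
have lJ : s <= #|J| by rewrite cJ.
have [e [eJ eI]] := enum_fun s0 lJ.
pose X1 := \bigcap_(i in J) X (T i); pose X2 := \bigcap_(i in J) X (T' i).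
have leX : n * n <= K * (#|X1| * #|X2|).
  move: leJ; rewrite cardsT card_prod card_ord -/K => /leq_trans; apply.
  rewrite leq_mul2l; apply/orP; right; rewrite -cardsX; apply: subset_leq_card.
  apply/subsetP=> -[x y] /bigcapP h; rewrite inE /=.
  by apply/andP; split; apply/bigcapP => i iJ; have := h i iJ; rewrite inE => /andP[].
have cn (A : {set 'I_n}) : #|A| <= n by rewrite -[X in _ <= X]card_ord max_card.
have leX1 : n <= K * #|X1| by rewrite -(leq_pmul2r n0); apply: leq_trans leX _;
  rewrite -mulnA !leq_mul2l cn !orbT.
have leX2 : n <= K * #|X2|.
  by rewrite -(leq_pmul2r n0); apply: leq_trans leX _;
    rewrite -mulnA leq_mul2l [#|X1| * _]mulnC leq_mul2l cn !orbT.
(* The order is T 0, T' 0, T' 1, T 1, T 2, T' 2, ...: inside a pair the junction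
is the shared vertex, and between two pairs it is a vertex of X2 or X1
alternately. *)
pose U j := if odd (uphalf j) then T' (e j./2) else T (e j./2).
have cU j : j./2 < s -> #|U j| = r - 1.
  by move=> js; have [c1 c2 _ _ _] := Td (e j./2) (ltn_ord _); rewrite /U; case: ifP.
pose Z := \bigcup_(j < 2 * s) U j.
have cZ : #|Z| <= 2 * s * r.
  apply: leq_trans (card_bigcup_le _ _) _.
  apply: leq_trans (_ : \sum_(j < 2 * s) r <= _); last by rewrite sum_nat_const card_ord.
  by apply: leq_sum => j _; rewrite cU; have := ltn_ord j; lia.
have [||x [xX xI]] := @distinct_reps _ (fun i => (if odd i then X2 else X1) :\: Z) s.+1.
- by [].
- move=> i _; have h : s.+1 + 2 * s * r <= #|(if odd i then X2 else X1)|.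
    have [K0|K0] := posnP K; first by move: leX1; rewrite K0; lia.
    by rewrite -(leq_pmul2l K0); case: odd; lia.
  rewrite cardsD; have := subset_leq_card (subsetIr (if odd i then X2 else X1) Z); lia.
apply: (@no_joined n r (2 * s) H U uphalf x) => //.
- move=> i j ij jl.
  have [i2 j2] : i./2 < s /\ j./2 < s by lia.
  have [c1 c2 _ _ c12] := Td (e i./2) (ltn_ord _).
  case: (i./2 =P j./2) => [eq|ne].
    have ji : j = i.+1 by lia.
    have oi : odd (uphalf j) = ~~ odd (uphalf i) by lia.
    have -> : #|U i :&: U j| = 1.
      by rewrite /U oi -eq; case: odd => /=; rewrite // setIC.
    lia.
  have -> : #|U i :&: U j| = 0.
    apply/eqP; rewrite cards_eq0 -subset0 -(TI (e i./2) (e j./2)) //.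
      by apply: setISS; rewrite /U; case: odd; rewrite ?subsetUl ?subsetUr.
    by apply/negP=> /eqP/val_inj/eI; lia.
  lia.
- move=> i j il jl; have [|] := setDP (xX (uphalf i) _); first by lia.
  move=> _; apply: contra => xU; apply/bigcupP; exists (Ordinal jl) => //.
- by move=> i j il jl; apply: xI; lia.
- move=> i il; apply: flex_mem.
  have [|+ _] := setDP (xX (uphalf i) _); first by lia.
  have i2 : i./2 < s by lia.
  rewrite /U; case: odd => /bigcapP/(_ _ (eJ _ i2)); by rewrite inE => /andP[].
Qed.

Definition dense_family n r t k (H : {set {set 'I_n}}) :=
  [set T in rsubsets [set: 'I_n] t | n ^ (r - t) <= k * degree H T].

Lemma dense_familyP n r t k (H : {set {set 'I_n}}) (T : {set 'I_n}) :
  reflect (#|T| = t /\ dense r k H T) (T \in dense_family r t k H).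
Proof.
rewrite inE inE subsetT /= /dense; apply: (iffP andP) => [[/eqP-> //]|[-> ->]].
by rewrite eqxx.
Qed.

(** A bounded set C meets all dense sets, except that for t = r - 1 there may
    remain a family without two members meeting in a single vertex.  A large
    matching of pairs, each contained in many triples, shows that such a family
    need not be bounded. *)
Lemma dense_cover r s t k : 3 <= r -> 0 < s -> 0 < k -> 0 < t -> t < r ->
  exists K, eventually (fun n => forall H : {set {set 'I_n}}, uniform r H ->
    path_free r (2 * s) H ->
    exists2 C : {set 'I_n}, #|C| <= K &
     forall T, T \in dense_family r t k H -> [disjoint T & C] ->
        t.+1 = r /\ forall T', T' \in dense_family r t k H -> [disjoint T' & C] ->
          #|T :&: T'| <> 1).
Proof.
move=> r3 s0 k0 t0; rewrite leq_eqVlt => /orP[/eqP tr|tr]; last first.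
  have s2 : 0 < 2 * s by lia.
  exists (t * (2 * k * (2 * s))).
  apply: eventually_mono (dense_matching_bounded s2 k0 t0 tr) => n hn H uH free.
  have [|[X [XP XI]]|[C cC hC]] :=
    @pack_or_cover _ (fun T : {set 'I_n} => T \in dense_family r t k H) t (2 * k * (2 * s)).
  - by move=> T /dense_familyP[->].
  - by case: (hn H uH free X) => // i im; apply/dense_familyP; exact: XP.
  - by exists C => // T dT dTC; have := hC T dT; rewrite setI_eq0 dTC.
have t1 : t = r - 1 by lia.
exists (2 * t * (2 * k ^ 2 * s)).
apply: eventually_mono (dense_pairs_bounded r3 s0 k0) => n hn H uH free.
pose Q (X : {set 'I_n}) (p : {set 'I_n} * {set 'I_n}) :=
  [&& p.1 \in dense_family r t k H, p.2 \in dense_family r t k H, #|p.1 :&: p.2| == 1 & X == p.1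
    :|: p.2].
have [|[X [XP XI]]|[C cC hC]] :=
    @pack_or_cover _ (fun X : {set 'I_n} => [exists p, Q X p]) (2 * t) (2 * k ^ 2 * s).
- move=> X /existsP[[T T'] /and4P[/dense_familyP[/= cT _] /dense_familyP[cT' _] _ /eqP->]].
  by have [le _] := leq_card_setU T T'; move: le; rewrite cT cT' /=; lia.
  (* The default value is never reached, as each X i is the union of a pair. *)
- pose p i := odflt (set0, set0) [pick q | Q (X i) q].
  have Qp i : i < 2 * k ^ 2 * s -> Q (X i) (p i).
    by move=> /XP/existsP[q Qq]; rewrite /p; case: pickP => [//|/(_ q)]; rewrite Qq.
  case: (hn H uH free (fun i => (p i).1) (fun i => (p i).2)) => [i im|i j im jm ij].
    have /and4P[/dense_familyP[c1 d1] /dense_familyP[c2 d2] /eqP c12 _] := Qp i im.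
    by rewrite -t1.
  have /and4P[_ _ _ /eqP <-] := Qp i im; have /and4P[_ _ _ /eqP <-] := Qp j jm.
  exact: XI.
- exists C => // T dT dTC; split=> // T' dT' dTC' c1.
  have := hC (T :|: T'); rewrite setIUl !disjoint_setI0 // setU0 eqxx => h; suff : false by [].
  by apply: h; apply/existsP; exists (T, T'); rewrite /Q /= dT dT' c1 !eqxx.
Qed.

(** * Families without two members meeting in a single vertex *)

Section NoUnitMeet.
Variables (n t : nat) (M : {set {set 'I_n}}).
Hypotheses (t2 : 1 < t) (uM : uniform t M) (MI : {in M &, forall T T', #|T :&: T'| <> 1}).

Lemma unit_free_star v : {in [set T in M | v \in T] &, forall T T', 2 <= #|T :&: T'|}.
Proof.
move=> T T'; rewrite !inE => /andP[MT vT] /andP[MT' vT'].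
have : 0 < #|T :&: T'| by apply/card_gt0P; exists v; rewrite inE vT.
by have := MI MT MT'; lia.
Qed.

Lemma unit_free_degree v : degree M [set v] <= 2 ^ t * n ^ (t - 2).
Proof.
have [->//|] := posnP (degree M [set v]); case/degree_gt0=> T0 MT0; rewrite sub1set => vT0.
apply: leq_trans (_ : #|[set T in M | 2 <= #|T :&: T0|]| <= _).
  apply: subset_leq_card; apply/subsetP=> T; rewrite !inE sub1set => /andP[MT vT].
  by rewrite MT (@unit_free_star v) // inE ?MT ?MT0.
by have := card_trace_le T0 2 uM; rewrite (uM MT0) t2 mul1n.
Qed.

(** The members through a vertex form a 2-intersecting family, so they essentially
    share a pair and number at most 'C(n - 2, t - 2).  Summing over the vertices
    saves the factor (t - 1) / t against 'C(n - 1, t - 1); half of the saving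
    absorbs the lower order terms. *)
Lemma unit_free_card : 2 * t + 4 + 2 ^ (3 * t) * bin_scale (t - 2) < n ->
  2 * t * #|M| <= (2 * t - 1) * 'C(n - 1, t - 1).
Proof.
move=> nN.
have dv v : degree M [set v] <= 'C(n - 2, t - 2).
  set F := [set T in M | v \in T].
  have dF : degree M [set v] = #|F| by apply: eq_card => T; rewrite !inE sub1set.
  have uF : uniform t F by apply: uniformS uM; apply/subsetP=> T; rewrite inE => /andP[].
  rewrite dF; case: (intersecting_kernel uF (@unit_free_star v)) => [[Q cQ QF]|[U cU UF]].
    rewrite -cQ; apply: leq_trans (degree_le_bin uF _); rewrite ?cQ //.
    by apply: subset_leq_card; apply/subsetP=> T FT; rewrite inE FT QF.
  apply: leq_trans (_ : #|[set T in F | 2 < #|T :&: U|]| <= _).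
    by apply: subset_leq_card; apply/subsetP=> T FT; rewrite inE FT UF.
  apply: leq_trans (card_trace_le _ _ uF) _.
  case: (ltnP 2 t) => [t3|_]; last by rewrite muln0.
  rewrite mul1n; apply: leq_trans (_ : 2 ^ (3 * t) * n ^ (t - 3) <= _).
    by rewrite leq_mul2r leq_exp2l // cU orbT.
  rewrite -(@leq_pmul2l (bin_scale (t - 2))) ?bin_scale_gt0 // mulnA.
  apply: leq_trans (_ : n ^ (t - 2) <= _); last by apply: exp_le_bin; lia.
  have lt : bin_scale (t - 2) * 2 ^ (3 * t) < n by rewrite mulnC; lia.
  by have := lower_order (t - 3) lt; rewrite (_ : (t - 3).+1 = t - 2); [exact: ltnW | lia].
have leM : t * #|M| <= n * 'C(n - 2, t - 2).
  rewrite -(sum_degree1_uniform uM) -[X in X * _]card_ord -sum_nat_const.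
  exact: leq_sum.
have eqb : (n - 1) * 'C(n - 2, t - 2) = (t - 1) * 'C(n - 1, t - 1).
  have := mul_bin_diag (n - 1) (t - 2).
  have -> : (n - 1).-1 = n - 2 by lia.
  by have -> : (t - 2).+1 = t - 1 by lia.
have n1 : 0 < n - 1 by lia.
rewrite -(leq_pmul2l n1).
apply: leq_trans (_ : 2 * (n * ((t - 1) * 'C(n - 1, t - 1))) <= _); last first.
  rewrite !mulnA leq_mul2r; apply/orP; right; nia.
by rewrite -eqb; nia.
Qed.
End NoUnitMeet.

(** * Common links of s vertices *)

Definition nbrs n (H : {set {set 'I_n}}) (Y : {set 'I_n}) :=
  [set v | (v \notin Y) && (v |: Y \in H)].

Definition common_link n r (H : {set {set 'I_n}}) (L : {set 'I_n}) :=
  [set Y in rsubsets [set: 'I_n] (r - 1) | L \subset nbrs H Y].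

Lemma degree_nbrs n r (H : {set {set 'I_n}}) (v : 'I_n) : uniform r H ->
  degree H [set v] = #|[set Y in rsubsets [set: 'I_n] (r - 1) | v \in nbrs H Y]|.
Proof.
move=> uH; rewrite -card_link; apply: eq_card => Y;
  rewrite !inE subsetT /= disjoint_sym disjoints1.
apply/andP/andP=> [[vY HY]|[_ /andP[]] //].
by rewrite vY HY; have := uH _ HY; rewrite cardsU1 vY => <-; rewrite addKn.
Qed.

Lemma sum_degree_nbrs n r (H : {set {set 'I_n}}) (C : {set 'I_n}) : uniform r H ->
  \sum_(v in C) degree H [set v] = \sum_(Y in rsubsets [set: 'I_n] (r - 1)) #|C :&: nbrs H Y|.
Proof.
move=> uH; rewrite (eq_bigr _ (fun v _ => degree_nbrs v uH)) double_count.
by apply: eq_bigr => Y _; apply: eq_card => v; rewrite [LHS]inE [RHS]inE.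
Qed.

Section CommonLink.
Variables (n r s : nat) (H : {set {set 'I_n}}).
Let c := 2 * s * r.
Let theta := c * ((r - 2) * n ^ (r - 3)).
Hypotheses (r3 : 3 <= r) (s2 : 2 <= s) (uH : uniform r H) (free : path_free r (2 * s) H).

Lemma common_link_notin (L Y : {set 'I_n}) x v : Y \in common_link r H L -> x \in Y ->
  v \in L -> x <> v.
Proof.
rewrite inE => /andP[_ /subsetP sL] xY /sL; rewrite inE => /andP[vY _] e.
by rewrite -e xY in vY.
Qed.

(** Distinct members of the common link through x give distinct members of H
    through x and v. *)
Lemma flex_common_link (L : {set 'I_n}) x v : v \in L ->
  theta < degree (common_link r H L) [set x] ->
  flex H c [set x; v].
Proof.
move=> vL lt.
have [Y0 Y0L] : exists2 Y, Y \in common_link r H L & [set x] \subset Y.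
  by apply/degree_gt0; apply: leq_ltn_trans lt.
rewrite sub1set => xY0; have xv := common_link_notin Y0L xY0 vL.
apply: (flex_degree uH); rewrite cards2 (_ : x != v) /=; last exact/eqP.
rewrite -subnDA; apply: leq_trans lt _.
set F := [set Y in common_link r H L | [set x] \subset Y].
have inj : {in F &, injective (fun Y => v |: Y)}.
  have vY Y : Y \in F -> v \notin Y.
    by rewrite !inE => /andP[/andP[_ /subsetP/(_ v vL)]]; rewrite inE => /andP[].
  by move=> Y Y' /vY vY1 /vY vY' e; rewrite -(setU1K vY1) -(setU1K vY') e.
rewrite -[degree _ [set x]]/#|F| -(card_in_imset inj).
apply: subset_leq_card; apply/subsetP=> E /imsetP[Y].
rewrite inE sub1set => /andP[YL xY] ->; rewrite inE.
move: YL; rewrite inE => /andP[_ /subsetP/(_ v vL)]; rewrite inE => /andP[_ ->] /=.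
by rewrite subUset !sub1set !inE eqxx xY orbT.
Qed.

(** If more than s vertices had large degree in the common link of s vertices,
    there would be a zigzag of 2s steps; otherwise the sum of the degrees bounds the
    common link. *)
Lemma common_link_small (L : {set 'I_n}) : s <= #|L| ->
  #|common_link r H L| <= (s + c * (r - 2)) * n ^ (r - 2).
Proof.
move=> cL; set F := common_link r H L.
have uF : uniform (r - 1) F by move=> Y; rewrite inE => /andP[/uniform_rsubsets].
pose X := [set x | theta < degree F [set x]].
have XL : [disjoint X & L].
  rewrite -setI_eq0 -subset0; apply/subsetP=> x; rewrite !inE => /andP[lt xL].
  have /degree_gt0[Y FY] : 0 < degree F [set x] by apply: leq_ltn_trans lt.
  by rewrite sub1set => xY; case: (common_link_notin FY xY xL).
have cX : #|X| <= s.
  rewrite leqNgt; apply/negP=> sX; apply: (no_common_walk r3 s2 uH free XL _ cL sX).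
  by move=> x v; rewrite inE => lt vL; exact: flex_common_link lt.
have : \sum_(x : 'I_n) degree F [set x] <= s * n ^ (r - 2) + n * theta.
  rewrite (bigID (mem X)) /=; apply: leq_add.
    apply: leq_trans (_ : \sum_(x in X) n ^ (r - 2) <= _);
      last by rewrite sum_nat_const leq_mul2r cX orbT.
    apply: leq_sum => x _; apply: leq_trans (degree_le_exp _ uF) _.
    by rewrite cards1 -subnDA -[X in _ <= X]mul1n leq_mul2r leq_b1 orbT.
  apply: leq_trans (_ : \sum_(x | x \notin X) theta <= _).
    by apply: leq_sum => x xX; rewrite leqNgt; apply: contra xX => lt; rewrite /= inE.
  rewrite sum_nat_const leq_mul2r; apply/orP; right.
  by rewrite -[X in _ <= X]card_ord max_card.
rewrite (sum_degree1_uniform uF) /theta.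
have -> : n * (c * ((r - 2) * n ^ (r - 3))) = c * (r - 2) * n ^ (r - 2).
  by rewrite (_ : r - 2 = (r - 3).+1) ?expnS; [nia | nlia].
rewrite -mulnDl; apply: leq_trans; rewrite leq_pmull //; nlia.
Qed.

Lemma many_nbrs_cover (C : {set 'I_n}) j Y : Y \in rsubsets [set: 'I_n] (r - 1) ->
  j <= #|C :&: nbrs H Y| ->
  exists2 L, L \in [set L : {set 'I_n} | L \subset C & #|L| == j] & Y \in common_link r H L.
Proof.
move=> cY /exists_subset_card[L]; rewrite subsetI => /andP[LC LN] cL.
by exists L; rewrite inE ?LC ?cL ?eqxx // cY.
Qed.

Lemma card_subsets_le (C : {set 'I_n}) j : #|[set L :
  {set 'I_n} | L \subset C & #|L| == j]| <= 2 ^ #|C|.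
Proof.
rewrite -card_powerset; apply: subset_leq_card; apply/subsetP=> L.
by rewrite !inE => /andP[].
Qed.

Lemma many_nbrs_small (C : {set 'I_n}) :
  #|[set Y in rsubsets [set: 'I_n] (r - 1) | s <= #|C :&: nbrs H Y|]|
    <= 2 ^ #|C| * ((s + c * (r - 2)) * n ^ (r - 2)).
Proof.
apply: leq_trans (_ : #|\bigcup_(L in [set L :
  {set 'I_n} | L \subset C & #|L| == s]) common_link r H L| <= _).
  apply: subset_leq_card; apply/subsetP=> Y; rewrite inE => /andP[YR le].
  by have [L LS YL] := many_nbrs_cover YR le; apply/bigcupP; exists L.
apply: leq_trans (card_bigcup_le _ _) _.
apply: leq_trans (_ : \sum_(L in [set L :
  {set 'I_n} | L \subset C & #|L| == s]) ((s + c * (r - 2)) * n ^ (r - 2)) <= _).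
  by apply: leq_sum => L; rewrite inE => /andP[_ /eqP cL]; apply: common_link_small; rewrite cL.
by rewrite sum_nat_const leq_mul2r card_subsets_le orbT.
Qed.

(** Each (r-1)-set in question belongs to the common link of some j-set inside C,
    and there are boundedly many such j-sets. *)
Lemma flex_many_nbrs (C : {set 'I_n}) x j :
  2 ^ #|C| * theta < #|[set Y in rsubsets [set: 'I_n] (r - 1) | (x \in Y) && (j <=
    #|C :&: nbrs H Y|)]| ->
  exists2 L, L \in [set L : {set 'I_n} | L \subset C & #|L| == j] &
     x \notin L /\ forall v, v \in L -> flex H c [set x; v].
Proof.
move=> lt.
have [/existsP[L /andP[LS dL]]|/existsPn h] :=
  boolP [exists L : {set 'I_n}, (L \in [set L :
    {set 'I_n} | L \subset C & #|L| == j]) && (theta < degree (common_link r H L) [set x])].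
  exists L => //; split; last by move=> v vL; exact: flex_common_link dL.
  have /degree_gt0[Y YL] : 0 < degree (common_link r H L) [set x] by apply: leq_ltn_trans dL.
  by rewrite sub1set => xY; apply/negP=> xL; case: (common_link_notin YL xY xL).
move: lt; rewrite ltnNge => /negP[].
apply: leq_trans (_ : #|\bigcup_(L in [set L :
  {set 'I_n} | L \subset C & #|L| == j]) [set Y in common_link r H L | [set x] \subset Y]| <= _).
  apply: subset_leq_card; apply/subsetP=> Y; rewrite inE => /and3P[YR xY le].
  have [L LS YL] := many_nbrs_cover YR le; apply/bigcupP; exists L => //.
  by rewrite inE YL sub1set.
apply: leq_trans (card_bigcup_le _ _) _.
apply: leq_trans (_ : \sum_(L in [set L : {set 'I_n} | L \subset C & #|L| == j]) theta <= _).
  by apply: leq_sum => L LS; have := h L; rewrite LS -leqNgt.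
by rewrite sum_nat_const leq_mul2r card_subsets_le orbT.
Qed.

Variables (C : {set 'I_n}) (M : {set {set 'I_n}}).
Hypotheses (uM : uniform (r - 1) M) (MI : {in M &, forall T T', #|T :&: T'| <> 1})
  (MC : {in M, forall T : {set 'I_n}, [disjoint T & C]}).

Lemma avoid_in_family (N : {set {set 'I_n}}) (Z : {set 'I_n}) : N \subset M ->
  #|Z| * (2 ^ (r - 1) * n ^ (r - 3)) < #|N| -> exists2 T, T \in N & [disjoint T & Z].
Proof.
move=> NM lt.
have [/existsP[T /andP[NT dT]]|/existsPn h] :=
  boolP [exists T : {set 'I_n}, (T \in N) && [disjoint T & Z]].
  by exists T.
move: lt; rewrite ltnNge => /negP[].
apply: leq_trans (_ : \sum_(z in Z) degree M [set z] <= _).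
  apply: leq_trans (card_bigcup_le _ _); apply: subset_leq_card; apply/subsetP=> T NT.
  have := h T; rewrite NT /= => /pred0Pn[z /andP[/= zT zZ]].
  by apply/bigcupP; exists z; rewrite // inE sub1set zT (subsetP NM).
rewrite -sum_nat_const; apply: leq_sum => z _.
have r1 : 1 < r - 1 by nlia.
by have := unit_free_degree r1 uM MI z; rewrite -subnDA.
Qed.

(** A vertex through which a zigzag along s - 1 vertices of C could be attached, by
    its second property, and ended by a member x |: T with T in M, by its first. *)
Definition bad_vertex (x : 'I_n) :=
  (r * (2 ^ (r - 1) * n ^ (r - 3)) < #|[set T in M | x \in nbrs H T]|) &&
  (2 ^ #|C| * theta < #|[set Y in rsubsets [set: 'I_n] (r - 1) | (x \in Y) && (s - 1 <=
    #|C :&: nbrs H Y|)]|).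

(** Many bad vertices would share the same s - 1 vertices of C; then two of them,
    completed by disjoint members of M, would be the ends of a forbidden path. *)
Lemma card_bad_vertex : #|[set x | bad_vertex x]| <= 2 ^ #|C| * (s + 2 * r).
Proof.
set P := [set x | bad_vertex x].
have [->|P0] := eqVneq P set0; first by rewrite cards0.
pose G (L : {set 'I_n}) := [set x in P | (x \notin L) && [forall v in L, flex H c [set x; v]]].
have [x|L] := @pigeonhole _ _ P [set L : {set 'I_n} | L \subset C & #|L| == s - 1] G P0.
  move=> xP; move: (xP); rewrite inE => /andP[_ /flex_many_nbrs[L LS [xL fL]]].
  exists L => //; rewrite inE xP xL; apply/forall_inP => v; exact: fL.
rewrite inE => /andP[LC /eqP cL] le.
apply: leq_trans le _; apply: leq_mul; first exact: card_subsets_le.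
rewrite leqNgt; apply/negP=> ltG.
have [x0 [x1 [x0G x1G x01]]] : exists x0 x1, [/\ x0 \in G L, x1 \in G L & x0 != x1].
  have /card_gt0P[x0 x0G] : 0 < #|G L| by nlia.
  have /card_gt0P[x1] : 0 < #|G L :\ x0| by have := cardsD1 x0 (G L); rewrite x0G; nlia.
  by rewrite in_setD1 => /andP[x10 x1G]; exists x0, x1; rewrite eq_sym.
have NP x : x \in G L -> r * (2 ^ (r - 1) * n ^ (r - 3)) < #|[set T in M | x \in nbrs H T]|.
  by rewrite !inE => /andP[/andP[]].
have sN x : [set T in M | x \in nbrs H T] \subset M by apply/subsetP=> T; rewrite inE => /andP[].
have [|T0] := avoid_in_family (Z := [set x1]) (sN x0).
  by apply: leq_ltn_trans (NP _ x0G); rewrite cards1 leq_mul2r; apply/orP; right; nlia.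
rewrite !inE => /and3P[MT0 x0T0 HT0] T0x1.
have [|T1] := avoid_in_family (Z := x0 |: T0) (sN x1).
  apply: leq_ltn_trans (NP _ x1G); rewrite cardsU1 x0T0 (uM MT0) leq_mul2r; apply/orP; right;
    nlia.
rewrite !inE => /and3P[MT1 x1T1 HT1] dT1.
have GX x : x \in G L -> x \notin L by rewrite inE => /and3P[].
have GL : [disjoint G L & L] by rewrite disjoint_subset; apply/subsetP=> x /GX.
have fG : {in G L & L, forall x v, flex H c [set x; v]}.
  by move=> x v; rewrite inE => /and3P[_ _ /forall_inP h]; exact: h.
have dL T x : T \in M -> x \in G L -> [disjoint x |: T & L].
  move=> MT xG; rewrite -setI_eq0 setIUl setU_eq0 !setI_eq0 disjoints1 GX //=.
  by apply: disjointWr LC _; exact: MC.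
apply: (no_bridge r3 s2 uH free GL fG (A := x0 |: T0) (B := x1 |: T1) (x0 := x0) (x1 :=
  x1)) => //.
- exact: ltnW.
- apply/eqP; rewrite setIUl setU_eq0 !setIUr !setU_eq0.
  move: dT1; rewrite -setI_eq0 setIUr setU_eq0 => /andP[a b].
  rewrite [X in _ && X]andbC [T0 :&: T1]setIC b [[set x0] :&: T1]setIC a /= andbT.
  rewrite !setI_eq0 disjoints1 inE x01 /= disjoint_sym disjoints1.
  by move: T0x1; rewrite disjoint_sym disjoints1.
- exact: dL.
- exact: dL.
- by rewrite !inE eqxx.
- by rewrite !inE eqxx.
Qed.
End CommonLink.

(** * The total degree of the dense sets *)

Definition weight_const r s a :=
  a * ((r - 1) * (2 ^ a * (s + 2 * s * r * (r - 2))))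
    + r * 2 ^ (r - 1) + a * (2 ^ a * (2 * s * r * (r - 2)))
    + (a + 1) * (2 ^ a * (s + 2 * r)).

Lemma weight_const_le r s a b : a <= b -> weight_const r s a <= weight_const r s b.
Proof.
move=> ab; have e : 2 ^ a <= 2 ^ b by rewrite leq_exp2l.
by rewrite /weight_const !leq_add // ?leq_mul // ?leq_add // ?leq_mul.
Qed.

(** The case t = r - 1.  The left-hand side is summed vertex by vertex: for a
    vertex x that is not bad, either few members of M are completed by x, and the
    sets Y through x contribute at most s - 1 each up to exceptions; or almost all
    of them contribute at most s - 2 each, which leaves room for the whole of M. *)
Lemma cover_weight_bound n r s (H : {set {set 'I_n}}) (C : {set 'I_n}) (M : {set {set 'I_n}}) :
  3 <= r -> 2 <= s -> uniform r H -> path_free r (2 * s) H ->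
  uniform (r - 1) M -> {in M &, forall T T', #|T :&: T'| <> 1} ->
  {in M, forall T : {set 'I_n}, [disjoint T & C]} ->
  #|M| <= 'C(n - 1, r - 2) -> 0 < n ->
  (r - 1) * (\sum_(v in C) degree H [set v]) + \sum_(T in M) degree H T <=
   (s - 1) * (r - 1) * 'C(n, r - 1) +
   weight_const r s #|C| * n ^ (r - 2).
Proof.
move=> r3 s2 uH free uM MI MC cM n0; set c := 2 * s * r; set R := rsubsets [set: 'I_n] (r - 1).
rewrite (sum_degree_nbrs _ uH) -/R.
have -> : (r - 1) * (\sum_(Y in R) #|C :&: nbrs H Y|) =
    \sum_(x : 'I_n) \sum_(Y in [set Y in R | x \in Y]) #|C :&: nbrs H Y|.
  have -> : \sum_(x : 'I_n) \sum_(Y in [set Y in R | x \in Y]) #|C :&: nbrs H Y|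
      = \sum_(x : 'I_n) \sum_(Y in R) (x \in Y) * #|C :&: nbrs H Y|.
    apply: eq_bigr => x _; rewrite big_mkcond [RHS]big_mkcond /=; apply: eq_bigr => Y _.
    by rewrite inE; case: (Y \in R); case: (x \in Y); rewrite ?mul1n.
  rewrite exchange_big /= big_distrr /=; apply: eq_bigr => Y YR.
  rewrite -big_distrl /=; congr (_ * _).
  rewrite -(uniform_rsubsets YR) -sum1_card [LHS]big_mkcond; apply: eq_bigr => x _.
  by case: (x \in Y).
have -> : \sum_(T in M) degree H T = \sum_(x : 'I_n) #|[set T in M | x \in nbrs H T]|.
  have := @double_count 'I_n {set 'I_n} (mem [set: 'I_n]) (mem M) (fun x T => x \in nbrs H T).
  have -> : \sum_(x in mem [set: 'I_n]) #|[set T in mem M | x \in nbrs H T]| = \sum_(x :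
    'I_n) #|[set T in M | x \in nbrs H T]|.
    by apply: eq_big => x; rewrite ?inE.
  move=> ->; apply: eq_bigr => T MT.
  rewrite (degree_extensions uH (uM _ MT)); last by nlia.
  by apply: eq_card => x; rewrite !inE.
rewrite -big_split /=.
set Es := [set Y in R | s <= #|C :&: nbrs H Y|].
pose bound x := (s - 1) * 'C(n - 1, r - 2) + #|C| * #|[set Y in Es | x \in Y]|
  + (r * 2 ^ (r - 1) + #|C| * (2 ^ #|C| * (c * (r - 2)))) * n ^ (r - 3)
  + bad_vertex r s H C M x * ((#|C| + 1) * n ^ (r - 2)).
have cS x : #|[set Y in R | x \in Y]| = 'C(n - 1, r - 2).
  by rewrite card_rsubsets_mem -?subnDA //; nlia.
have leC (Y : {set 'I_n}) : #|C :&: nbrs H Y| <= #|C| by exact: subset_leq_card (subsetIl _ _).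
have binle : 'C(n - 1, r - 2) <= n ^ (r - 2).
  by apply: leq_trans (leq_bin_exp _ _) _; apply: leq_exp2r_weak; nlia.
have fbound x : \sum_(Y in [set Y in R | x \in Y]) #|C :&: nbrs H Y|
    + #|[set T in M | x \in nbrs H T]| <= bound x.
  rewrite /bound; case: (boolP (bad_vertex r s H C M x)) => [_|].
    rewrite mul1n; apply: leq_trans (_ : (#|C| + 1) * n ^ (r - 2) <= _); last by rewrite leq_addl.
    rewrite mulnDl mul1n; apply: leq_add.
      apply: leq_trans (_ : \sum_(Y in [set Y in R | x \in Y]) #|C| <= _);
        first by apply: leq_sum.
      by rewrite sum_nat_const cS mulnC leq_mul2l binle orbT.
    apply: leq_trans (leq_trans cM binle).
    by apply: subset_leq_card; apply/subsetP=> T; rewrite inE => /andP[].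
  rewrite negb_and -!leqNgt mul0n addn0 => /orP[small|small].
    have := @sum_except _ [set Y in R | x \in Y] (fun Y =>
      #|C :&: nbrs H Y|) (s - 1) #|C| (fun Y _ => leC Y).
    have -> : [set Y in [set Y in R | x \in Y] | s - 1 < #|C :&: nbrs H Y|] = [set Y in Es | x
      \in Y].
      apply/setP=> Y; rewrite !inE -!andbA; congr (_ && (_ && _)); rewrite [RHS]andbC;
        congr (_ && _).
      by rewrite subn1 prednK //; nlia.
    rewrite cS mulnA in small * => le1; rewrite mulnDl addnA.
    by apply: leq_trans (leq_add le1 small) (leq_addr _ _).
  have := @sum_except _ [set Y in R | x \in Y] (fun Y =>
    #|C :&: nbrs H Y|) (s - 2) #|C| (fun Y _ => leC Y).
  have -> : [set Y in [set Y in R | x \in Y] | s - 2 < #|C :&: nbrs H Y|] =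
       [set Y in R | (x \in Y) && (s - 1 <= #|C :&: nbrs H Y|)].
    apply/setP=> Y; rewrite !inE -!andbA; congr (_ && (_ && (_ && _))).
    by have -> : s - 1 = (s - 2).+1 by nlia.
  rewrite cS => le1.
  have le2 : #|[set T in M | x \in nbrs H T]| <= 'C(n - 1, r - 2).
    by apply: leq_trans cM; apply: subset_leq_card; apply/subsetP=> T; rewrite inE => /andP[].
  have le3 : #|C| * #|[set Y in R | (x \in Y) && (s - 1 <= #|C :&: nbrs H Y|)]|
      <= #|C| * (2 ^ #|C| * (c * (r - 2))) * n ^ (r - 3).
    by rewrite -mulnA leq_mul2l -mulnA -mulnA small orbT.
  apply: leq_trans (leq_add (leq_trans le1 (leq_add (leqnn _) le3)) le2) _.
  have -> : (s - 1) * 'C(n - 1, r - 2) = (s - 2) * 'C(n - 1, r - 2) + 'C(n - 1, r - 2).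
    by rewrite -mulSnr; congr (_ * _); nlia.
  rewrite mulnDl; nlia.
apply: leq_trans (_ : \sum_(x < n) bound x <= _); first by apply: leq_sum => x _; exact: fbound.
rewrite /bound !big_split /= !sum_nat_const card_ord.
have nbin : n * 'C(n - 1, r - 2) = (r - 1) * 'C(n, r - 1).
  have := mul_bin_diag n (r - 2); rewrite (_ : (r - 2).+1 = r - 1) ?subn1 //; nlia.
have e1 : n * ((s - 1) * 'C(n - 1, r - 2)) = (s - 1) * (r - 1) * 'C(n, r - 1).
  by rewrite mulnCA nbin mulnA.
have e2 : \sum_(x < n) #|C| * #|[set Y in Es | x \in Y]| <=
   #|C| * ((r - 1) * (2 ^ #|C| * (s + c * (r - 2)))) * n ^ (r - 2).
  rewrite -big_distrr /= -!mulnA leq_mul2l; apply/orP; right.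
  have uE : uniform (r - 1) Es by move=> Y; rewrite inE => /andP[/uniform_rsubsets].
  have -> : \sum_(x < n) #|[set Y in Es | x \in Y]| = (r - 1) * #|Es|.
    rewrite -(sum_degree1_uniform uE); apply: eq_bigr => x _; apply: eq_card => Y.
    by rewrite !inE sub1set.
  by rewrite leq_mul2l; apply/orP; right; have := many_nbrs_small r3 s2 uH free C;
    rewrite -!mulnA.
have e3 : n * ((r * 2 ^ (r - 1) + #|C| * (2 ^ #|C| * (c * (r - 2)))) * n ^ (r - 3)) =
   (r * 2 ^ (r - 1) + #|C| * (2 ^ #|C| * (c * (r - 2)))) * n ^ (r - 2).
  by rewrite mulnCA -expnS; congr (_ * _ ^ _); nlia.
have e4 : \sum_(x < n) bad_vertex r s H C M x * ((#|C| + 1) * n ^ (r - 2)) <=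
   (#|C| + 1) * (2 ^ #|C| * (s + 2 * r)) * n ^ (r - 2).
  have cb : \sum_(x < n) bad_vertex r s H C M x = #|[set x | bad_vertex r s H C M x]|.
    rewrite -sum1_card [RHS]big_mkcond; apply: eq_bigr => x _.
    by rewrite inE; case: (bad_vertex _ _ _ _ _ _).
  have le := card_bad_vertex r3 s2 uH free uM MI MC.
  rewrite -big_distrl /= cb mulnA [X in _ <= X * _]mulnC leq_mul2r; apply/orP; right.
  by rewrite leq_mul2r le orbT.
rewrite e1 e3 /weight_const -/c.
apply: leq_trans (leq_add (leq_add (leq_add (leqnn _) e2) (leqnn _)) e4) _.
by rewrite -!addnA leq_add2l !mulnDl !addnA.
Qed.

(** The sharp bound for the total degree of the dense sets, with the information on
    the family M of uncovered dense sets that the stability argument needs. *)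
Lemma dense_weight r s t k : 3 <= r -> 2 <= s -> 0 < k -> 0 < t -> t < r ->
  exists K, eventually (fun n => forall H : {set {set 'I_n}}, uniform r H ->
    path_free r (2 * s) H ->
    exists2 C : {set 'I_n}, #|C| <= K &
    let M := [set T in dense_family r t k H | [disjoint T & C]] in
    [/\ \sum_(T in dense_family r t k H) degree H T
          <= (s - 1) * 'C(r - 1, t - 1) * 'C(n, r - 1) + K * n ^ (r - 2),
        forall v, degree M [set v] <= K * ((t - 1) * n ^ (t - 2)),
        2 * t * #|M| <= (2 * t - 1) * 'C(n - 1, t - 1) &
        (M != set0 -> 1 < t)]).
Proof.
move=> r3 s2 k0 t0 tr; have s0 : 0 < s by nlia.
have [K0 evC] := dense_cover r3 s0 k0 t0 tr.
pose K1 := weight_const r s K0.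
pose K := K0 + 'C(r - 1, t - 1) * K1 + K1 + 2 ^ t.
exists K.
apply: eventually_mono (eventually_and evC (eventually_ge (2 * t + 4 + 2 ^ (3 * t) * bin_scale
  (t - 2)).+1)) => n [hn nN] H uH free.
have [C cC hC] := hn H uH free; exists C; first by rewrite /K; nlia.
set M := [set T in _ | _] => /=.
have n0 : 0 < n by nlia.
have MT T : T \in M -> [/\ t.+1 = r, #|T| = t & [disjoint T & C]].
  rewrite inE => /andP[dT dTC]; have [e _] := hC T dT dTC.
  by have /dense_familyP[] := dT.
have M1 : M != set0 -> t.+1 = r by case/set0Pn=> T /MT[].
have uM : uniform t M by move=> T /MT[].
have MI : {in M &, forall T T' : {set 'I_n}, #|T :&: T'| <> 1}.
  move=> T T'; rewrite in_set => /andP[dT TC]; rewrite in_set => /andP[dT' TC'].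
  by have [_] := hC T dT TC; apply.
have uM1 : uniform (r - 1) M by move=> T /MT[e cT _]; rewrite cT; nlia.
have MC : {in M, forall T : {set 'I_n}, [disjoint T & C]} by move=> T /MT[].
have cM : 2 * t * #|M| <= (2 * t - 1) * 'C(n - 1, t - 1).
  have [->|/M1 tr1] := eqVneq M set0; first by rewrite cards0 muln0.
  by apply: unit_free_card => //; nlia.
have cM' : #|M| <= 'C(n - 1, r - 2).
  have [->|/M1 tr1] := eqVneq M set0; first by rewrite cards0.
  have -> : r - 2 = t - 1 by nlia.
  have t2 : 0 < 2 * t by nlia.
  rewrite -(leq_pmul2l t2); apply: leq_trans cM _; rewrite leq_mul2r; apply/orP; right; nlia.
have aux := cover_weight_bound r3 s2 uH free uM1 MI MC cM' n0.
have aux' := leq_trans aux (leq_add (leqnn _) (leq_mul (weight_const_le r s cC) (leqnn _))).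
split=> //; last first.
- by move/M1 => e; nlia.
- move=> v; have [M0|/M1 tr1] := eqVneq M set0.
    suff -> : degree M [set v] = 0 by [].
    by apply/eqP; rewrite -leqn0 leqNgt; apply/negP=> /degree_gt0[E]; rewrite M0 inE.
  have t1 : 1 < t by nlia.
  apply: leq_trans (unit_free_degree t1 uM MI v) _; apply: leq_mul; first by rewrite /K leq_addl.
  by rewrite leq_pmull // subn_gt0.
- have split1 : \sum_(T in dense_family r t k H) degree H T <=
     'C(r - 1, t - 1) * \sum_(v in C) degree H [set v] + \sum_(T in M) degree H T.
    rewrite (bigID (fun T : {set 'I_n} => [disjoint T & C])) /= addnC; apply: leq_add; last first.
      by rewrite [X in _ <= X](eq_bigl (fun T =>
        (T \in dense_family r t k H) && [disjoint T & C])) // => T; rewrite inE.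
    rewrite big_distrr /=.
    apply: leq_trans (_ : \sum_(v in C) \sum_(T in rsubsets [set: 'I_n] t) (v \in T) * degree H
      T <= _); last first.
      apply: leq_sum => v _; have := @sum_degree_sup n r t H [set v] uH.
      rewrite cards1 => /(_ t0) <-; rewrite [X in _ <= X]big_mkcond [X in X <= _]big_mkcond /=.
      apply: leq_sum => T _; rewrite !inE sub1set subsetT /=.
      by case: (_ == t); case: (v \in T); rewrite /= ?mul1n ?mul0n.
    rewrite exchange_big /= [X in X <= _]big_mkcond [X in _ <= X]big_mkcond /=.
    apply: leq_sum => T _; case: ifP => // /andP[/dense_familyP[cT _] nT].
    rewrite inE subsetT cT eqxx /=; case/pred0Pn: nT => v /andP[/= vT vC].
    by rewrite (bigD1 v vC) /= vT mul1n leq_addr.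
  apply: leq_trans split1 _; move: aux'; rewrite -/K1.
  set S1 := \sum_(v in C) _; set S2 := \sum_(T in M) _.
  set B := 'C(n, r - 1); set P := n ^ (r - 2) => le.
  have [M0|/M1 tr1] := eqVneq M set0.
    have S20 : S2 = 0 by rewrite /S2 M0 big_set0.
    have le1 : S1 <= (s - 1) * B + K1 * P.
      have r1 : 0 < r - 1 by nlia.
      rewrite -(leq_pmul2l r1) mulnDr; move: le; rewrite S20 addn0 => /leq_trans; apply.
      by rewrite mulnCA mulnA leq_add2l leq_pmull.
    rewrite S20 addn0; apply: leq_trans (leq_mul (leqnn _) le1) _.
    rewrite mulnDr mulnA ['C(_, _) * (s - 1)]mulnC leq_add2l mulnA leq_mul2r; apply/orP; right.
    by rewrite /K; nlia.
  have e : 'C(r - 1, t - 1) = r - 1.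
    have e1 : r - 1 = (t - 1).+1 by nlia.
    by rewrite e1 binSn.
  rewrite e; apply: leq_trans le _; rewrite leq_add2l leq_mul2r; apply/orP; right.
  by rewrite /K; nlia.
Qed.

(** * Nearly full sets and the stability of the norm *)

(** Non-flexibility is witnessed by a bounded set Z, and all r-sets above W off Z
    are missing. *)
Lemma nonflex_missing n r c (H : {set {set 'I_n}}) (W : {set 'I_n}) : #|W| <= r ->
  ~~ flex H c W ->
  'C(n - #|W| - c, r - #|W|) <= #|[set E in rsubsets [set: 'I_n] r | (W \subset E) && (E \notin
    H)]|.
Proof.
move=> Wr; rewrite negb_forall => /existsP[Z]; rewrite negb_imply => /andP[/andP[cZ dZ] nE].
have sW : W \subset ~: Z by rewrite -disjoints_subset disjoint_sym.
have cZC : #|~: Z| = n - #|Z| by rewrite cardsCs setCK card_ord.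
have := card_between sW Wr; rewrite cZC => eq.
apply: leq_trans (_ : 'C(n - #|Z| - #|W|, r - #|W|) <= _); first by apply: leq_bin2l; lia.
rewrite -eq; apply: subset_leq_card; apply/subsetP=> E; rewrite !inE subsetT => /and3P[WE EZ ->].
rewrite WE /=; apply: contra nE => HE; apply/exists_inP; exists E => //.
by rewrite WE disjoints_subset.
Qed.

Definition missing n r (H : {set {set 'I_n}}) (T : {set 'I_n}) :=
  #|[set E in rsubsets [set: 'I_n] r | (T \subset E) && (E \notin H)]|.

Lemma missingE n r (H : {set {set 'I_n}}) (T : {set 'I_n}) : uniform r H -> #|T| <= r ->
  missing r H T + degree H T = 'C(n - #|T|, r - #|T|).
Proof.
move=> uH Tr; rewrite -degree_complete // addnC.
rewrite /degree -[RHS](cardsID H); congr (_ + _); apply: eq_card => E; rewrite !inE subsetT /=.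
  by case: (boolP (E \in H)) => HE; rewrite ?andbF // (uH _ HE) eqxx andbT.
by rewrite andbA andbC.
Qed.

Lemma sum_missing n r t (H : {set {set 'I_n}}) (v : 'I_n) : uniform r H -> 0 < t -> t <= r ->
  \sum_(T in [set T in rsubsets [set: 'I_n] t | v \in T]) missing r H T
   = 'C(r - 1, t - 1) * missing r H [set v].
Proof.
move=> uH t0 tr; pose G := rsubsets [set: 'I_n] r :\: H.
have uG : uniform r G by move=> E; rewrite inE => /andP[_ /uniform_rsubsets].
have mG T : missing r H T = degree G T.
  by apply: eq_card => E; rewrite !inE; case: (E \in H); rewrite /= ?andbF ?andbT.
have := sum_degree_sup (W := [set v]) uG; rewrite cards1 => /(_ t t0).
rewrite -mG => <-; apply: eq_big => [T|T _]; last exact: mG.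
by rewrite !inE sub1set.
Qed.

Definition nearfull n r t k (H : {set {set 'I_n}}) (T : {set 'I_n}) :=
  (#|T| == t) && (k * missing r H T <= 'C(n - t, r - t)).

Section NearFull.
Variables (n r s t k : nat) (H : {set {set 'I_n}}).
Let c := 2 * s * r.
Hypotheses (r3 : 3 <= r) (s2 : 2 <= s) (t0 : 0 < t) (tr : t < r).
Hypotheses (uH : uniform r H) (free : path_free r (2 * s) H).
Hypotheses (kbig : 4 * s * bin_scale (r - t - 1) <= k) (nbig :
  2 * (c + r + r) + 2 * (2 * s * r + s + 1) <= n).

(** Each x for which x |: T is not flexible accounts for a positive proportion of
    the r-sets above x |: T, all of which are missing above T. *)
Lemma nearfull_nonflex (T : {set 'I_n}) : nearfull r t k H T ->
  4 * s * #|[set x | (x \notin T) && ~~ flex H c (x |: T)]| <= n.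
Proof.
case/andP=> /eqP cT le; set NF := [set x | _].
pose m0 := 'C(n - (c + t + 1), r - t - 1).
have m0_gt0 : 0 < m0 by rewrite bin_gt0; nlia.
have le1 : #|NF| * m0 <= (r - t) * missing r H T.
  apply: leq_trans (_ : \sum_(x in NF) #|[set E in [set E in rsubsets [set: 'I_n] r | (T \subset
    E) && (E \notin H)] | x \in E]| <= _).
    rewrite -sum_nat_const; apply: leq_sum => x; rewrite inE => /andP[xT nf].
    have cx : #|x |: T| = t.+1 by rewrite cardsU1 xT cT.
    have := @nonflex_missing n r c H (x |: T) _ nf; rewrite cx => /(_ tr).
    rewrite (_ : n - t.+1 - c = n - (c + t + 1)); last by nlia.
    rewrite (_ : r - t.+1 = r - t - 1); last by nlia.
    move=> h; apply: leq_trans h _; apply: subset_leq_card; apply/subsetP=> E.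
    rewrite !inE subUset sub1set -!andbA => /and4P[-> -> -> /andP[-> ->]] //.
  rewrite double_count mulnC -sum_nat_const; apply: leq_sum => E.
  rewrite inE => /andP[/uniform_rsubsets cE /andP[TE _]].
  rewrite -cE -cT -cardsDS //; apply: subset_leq_card; apply/subsetP=> x.
  by rewrite !inE => /andP[/andP[-> _] ->].
have le2 : (r - t) * 'C(n - t, r - t) <= n * (bin_scale (r - t - 1) * m0).
  have := mul_bin_diag (n - t) (r - t - 1).
  rewrite (_ : (r - t - 1).+1 = r - t); last by nlia.
  move=> <-; apply: leq_mul; first by nlia.
  apply: leq_trans (leq_bin_exp _ _) _; apply: leq_trans (_ : n ^ (r - t - 1) <= _).
    by apply: leq_exp2r_weak; nlia.
  by apply: exp_le_bin; nlia.
rewrite -(leq_pmul2r (bin_scale_gt0 (r - t - 1))) -(leq_pmul2r m0_gt0).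
apply: leq_trans (_ : k * (#|NF| * m0) <= _).
  rewrite mulnA leq_mul2r; apply/orP; right.
  by rewrite mulnAC leq_mul2r kbig orbT.
apply: leq_trans (_ : k * ((r - t) * missing r H T) <= _); first by rewrite leq_mul2l le1 orbT.
rewrite mulnCA; apply: leq_trans (_ : (r - t) * 'C(n - t, r - t) <= _).
  by rewrite leq_mul2l le orbT.
by rewrite -mulnA.
Qed.

(** The exceptional vertices of all U j together are at most about half of the
    vertices, so a common supply of joining vertices remains. *)
Lemma nearfull_join (U : nat -> {set 'I_n}) (g : nat -> nat) :
  (forall j, j < 2 * s -> nearfull r t k H (U j)) ->
  (forall j, j < 2 * s -> g j <= s) ->
  (forall i j, i < j -> j < 2 * s -> #|U i :&: U j| + (g i == g j) = (j == i.+1)) -> False.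
Proof.
move=> nU gs UI.
pose NF (T : {set 'I_n}) := [set x | (x \notin T) && ~~ flex H c (x |: T)].
pose Z := \bigcup_(j < 2 * s) (U j :|: NF (U j)).
have cZ : 2 * #|Z| <= 2 * (2 * s * r) + n.
  apply: leq_trans (_ : 2 * \sum_(j < 2 * s) (r + #|NF (U j)|) <= _).
    rewrite leq_mul2l /=; apply: leq_trans (card_bigcup_le _ _) _; apply: leq_sum => j _.
    have [le _] := leq_card_setU (U j) (NF (U j)); apply: leq_trans le _.
    by rewrite leq_add2r; have /andP[/eqP-> _] := nU j (ltn_ord j); exact: ltnW.
  rewrite big_split /= sum_nat_const card_ord mulnDr leq_add2l.
  have s4 : 0 < 2 * s by nlia.
  rewrite -(leq_pmul2l s4) big_distrr big_distrr /= -[X in _ <= X * n]card_ord -sum_nat_const.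
  apply: leq_sum => j _; apply: leq_trans (nearfull_nonflex (nU j (ltn_ord j))).
  by rewrite mulnA leq_mul2r; apply/orP; right; nlia.
have cX : s.+1 <= #|~: Z| by rewrite cardsCs setCK card_ord; nlia.
have [x [xX xI]] := enum_fun (ltn0Sn s) cX.
have xZ i j : i < 2 * s -> j < 2 * s -> x (g i) \notin U j :|: NF (U j).
  move=> il jl; have := xX (g i) (gs i il); rewrite inE; apply: contra => h.
  by apply/bigcupP; exists (Ordinal jl).
apply: (@no_joined n r (2 * s) H U g x) => //.
- by move=> i j il jl; have := xZ i j il jl; rewrite inE negb_or => /andP[].
- by move=> i j il jl; apply: xI; exact: gs.
- move=> i il; have := xZ i i il il; rewrite !inE negb_or negb_and !negbK.
  by case/andP=> /negbTE-> /=.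
Qed.
End NearFull.

(** Let S be the family of dense nearly full sets and L the set of those vertices
    of C that are flexible in S.  If L had s elements, S would contain s
    pairs of sets, each pair sharing a vertex of L and nothing else, and these could
    be joined.  Vertices of
    C outside L and sets in M cannot make up for a missing element of L, so
    #|L| = s - 1; then M contributes little, since two disjoint members of M could
    be put at the ends of the chain.  Hence S is almost all of the s - 1 stars. *)
Lemma stability r s t k k' : 3 <= r -> 2 <= s -> 0 < k -> 0 < t -> t < r ->
  4 * s * bin_scale (r - t - 1) <= k' -> 4 * t < k' ->
  eventually (fun n => forall H : {set {set 'I_n}}, uniform r H -> path_free r (2 * s) H ->
    k' * (s - 1) * 'C(n - 1, t - 1) <=
      k' * #|[set T in dense_family r t k H | nearfull r t k' H T]| + 'C(n - 1, t - 1) ->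
    exists2 L : {set 'I_n}, #|L| = s - 1 &
      forall v, v \in L -> k' * missing r H [set v] <= 3 * 'C(n - 1, r - 1)).
Proof.
move=> r3 s2 k0 t0 tr kb kt.
have [K evK] := dense_weight r3 s2 k0 t0 tr.
pose c := 2 * s * r.
have ev1 := eventually_lower_order (k' * (K * c + t * K)) t.
apply: eventually_mono (eventually_and evK (eventually_and ev1 (eventually_ge (2 * (c + r + r) +
  2 * (2 * s * r + s + 1) + r)))) => n [hK [hlow nN]] H uH free.
set S := [set T in _ | _]; set N1 := 'C(n - 1, t - 1) => lower.
have [C cC] := hK H uH free; set M := [set T : {set 'I_n} in _ | [disjoint T & C]].
case=> _ degM cM M1.
have nbig : 2 * (c + r + r) + 2 * (2 * s * r + s + 1) <= n by nlia.
have SN T : T \in S -> nearfull r t k' H T by rewrite inE => /andP[].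
have join := @nearfull_join n r s t k' H r3 s2 t0 tr uH free kb nbig.
have uS : uniform t S by move=> T /SN/andP[/eqP].
have SM T : T \in S -> [disjoint T & C] -> T \in M.
  by rewrite [T \in S]inE => /andP[dT _] dTC; rewrite inE dT.
have lec : 2 * s * t <= c by rewrite leq_mul2l (ltnW tr) orbT.
pose L := [set v in C | flex S c [set v]].
have cL : #|L| < s.
  rewrite ltnNge; apply/negP=> sL.
  have [|v [vL vI]] := enum_fun (_ : 0 < s) sL; first by nlia.
  have [|U [US UI]] := @expand_seeds n t c (2 * s) S (fun j => [set v j./2]) uS lec.
    by move=> i il; have := vL i./2; rewrite inE => /(_ _)/andP[|_]; [nlia | apply].
  (* U (2i) and U (2i + 1) share v i; uphalf gives U (2i + 1) and U (2i + 2) the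
  same added vertex. *)
  apply: (join U uphalf).
  - by move=> j jl; apply: SN; case: (US j jl).
  - by move=> j jl; clear -jl; lia.
  - move=> i j ij jl; rewrite UI; [|clear -ij jl; lia|clear -ij jl; lia|clear -ij jl; lia].
    case: (i./2 =P j./2) => [e|ne].
      by rewrite e setIid cards1; clear -ij jl e s2; lia.
    have -> : [set v i./2] :&: [set v j./2] = set0.
      apply/eqP; rewrite setI_eq0 disjoints1 inE; apply/negP=> /eqP/vI; clear -ij jl ne s2; lia.
    by rewrite cards0; clear -ij jl ne s2; lia.
pose Ms := [set T : {set 'I_n} in S | [disjoint T & C]].
have degS v : degree S [set v] <= N1.
  by have := degree_le_bin (W := [set v]) uS; rewrite cards1; apply.
have cover : #|S| <= \sum_(v in L) degree S [set v] + K * c * ((t - 1) * n ^ (t - 2)) + #|Ms|.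
  rewrite -(cardsID [set T : {set 'I_n} | [disjoint T & C]] S) addnC; apply: leq_add; last first.
    by apply: subset_leq_card; apply/subsetP=> T; rewrite !inE.
  apply: leq_trans (_ : \sum_(v in C) degree S [set v] <= _).
    apply: leq_trans (card_bigcup_le _ _); apply: subset_leq_card; apply/subsetP=> T.
    rewrite in_setD inE => /andP[/pred0Pn[v /andP[/= vT vC]] TS].
    by apply/bigcupP; exists v => //; rewrite inE TS sub1set.
  rewrite (bigID (mem L)) /=; apply: leq_add.
    by rewrite [X in X <= _](eq_bigl (mem L)) // => v; rewrite !inE andbA andbb.
  apply: leq_trans (_ : \sum_(v in C) c * ((t - 1) * n ^ (t - 2)) <= _); last first.
    by rewrite sum_nat_const mulnA leq_mul2r leq_mul2r cC !orbT.
  rewrite [X in X <= _]big_mkcond [X in _ <= X]big_mkcond /=; apply: leq_sum => v _.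
  case: (boolP (v \in C)) => //= vC; case: ifP => // nL.
  rewrite leqNgt; apply: contra nL => lt; rewrite inE vC /=.
  by apply: (flex_degree uS); rewrite cards1 -subnDA.
have sMs : Ms \subset M by apply/subsetP=> T; rewrite inE => /andP[TS /(SM T TS)].
have kE : k' * (K * c * ((t - 1) * n ^ (t - 2))) + k' * (t * K * ((t - 1) * n ^ (t - 2))) <= N1.
  by rewrite -mulnDr -mulnDl mulnA.
set E1 := K * c * _ in cover kE; set E2 := t * K * _ in kE.
have N10 : 0 < N1 by rewrite bin_gt0; nlia.
have sumL : \sum_(v in L) degree S [set v] <= #|L| * N1.
  by rewrite -sum_nat_const; apply: leq_sum.
have cL1 : #|L| = s - 1.
  suff : s - 2 < #|L| by nlia.
  rewrite ltnNge; apply/negP=> Ls.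
  have cMs : #|Ms| <= #|M| by exact: subset_leq_card.
  have le1 : #|S| <= (s - 2) * N1 + E1 + #|M|.
    apply: leq_trans cover (leq_add (leq_add (leq_trans sumL _) (leqnn _)) cMs).
    by rewrite leq_mul2r Ls orbT.
  have le2 : k' * N1 <= 2 * N1 + k' * #|M|.
    have e : k' * (s - 1) * N1 = k' * ((s - 2) * N1) + k' * N1.
      by rewrite -mulnA -mulnDr -mulSnr; congr (_ * (_ * _)); nlia.
    have := leq_mul (leqnn k') le1; rewrite !mulnDr; move: lower; rewrite e.
    by clear -kE; nlia.
  have : 2 * t * (k' * N1) <= 2 * t * (2 * N1) + k' * ((2 * t - 1) * N1).
    apply: leq_trans (leq_mul (leqnn _) le2) _; rewrite mulnDr leq_add2l mulnCA leq_mul2l.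
    by rewrite cM orbT.
  have -> : 2 * t * (k' * N1) = k' * ((2 * t - 1) * N1) + k' * N1.
    by rewrite -mulnDr -mulSnr mulnCA; congr (_ * (_ * _)); nlia.
  rewrite addnC leq_add2r mulnA leq_mul2r => /orP[|]; first by nlia.
  by nlia.
have cMs : #|Ms| <= E2.
  have [->|/set0Pn[T0 MT0]] := eqVneq Ms set0; first by rewrite cards0.
  rewrite leqNgt; apply/negP=> lt.
  have t1 : 1 < t by apply: M1; apply/set0Pn; exists T0; exact: (subsetP sMs).
  have T0S : T0 \in S by move: MT0; rewrite inE => /andP[].
  have T0C : [disjoint T0 & C] by move: MT0; rewrite inE => /andP[].
  have [T1 MT1 T01] : exists2 T1, T1 \in Ms & [disjoint T1 & T0].
    have [/existsP[T /andP[NT dT]]|/existsPn h] :=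
      boolP [exists T : {set 'I_n}, (T \in Ms) && [disjoint T & T0]].
      by exists T.
    move: lt; rewrite ltnNge => /negP[].
    apply: leq_trans (_ : \sum_(z in T0) degree M [set z] <= _).
      apply: leq_trans (card_bigcup_le _ _); apply: subset_leq_card; apply/subsetP=> T NT.
      have := h T; rewrite NT /= => /pred0Pn[z /andP[/= zT zZ]].
      by apply/bigcupP; exists z; rewrite // inE sub1set zT (subsetP sMs).
    rewrite /E2 -mulnA -[X in _ <= X * _](uS _ T0S) -sum_nat_const; apply: leq_sum => z _.
    exact: degM.
  have T1S : T1 \in S by move: MT1; rewrite inE => /andP[].
  have T1C : [disjoint T1 & C] by move: MT1; rewrite inE => /andP[].
  have [|v [vL vI]] := enum_fun (_ : 0 < s - 1) (eq_leq (esym cL1)); first by nlia.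
  have vT (T : {set 'I_n}) i : i < s - 1 -> [disjoint T & C] -> v i \notin T.
    move=> is1 dT; have := vL i is1; rewrite inE => /andP[vC _].
    by move: dT; rewrite disjoint_sym disjoint_subset => /subsetP/(_ _ vC).
  pose W j := if j == 0 then T0 else if j == 2 * s - 1 then T1 else [set v j.-1./2].
  have [|U [US UI]] := @expand_seeds n t c (2 * s) S W uS lec.
    move=> i il; rewrite /W; case: eqP => [_|ni]; first exact: flex_mem.
    case: eqP => [_|mi]; first exact: flex_mem.
    by have := vL i.-1./2; rewrite inE => /(_ _)/andP[|_]; [nlia | apply].
  (* Now T0 and T1 are the ends, U (2i + 1) and U (2i + 2) share v i, and half
  gives U (2i) and U (2i + 1) the same added vertex. *)
  apply: (join U half).
  - by move=> j jl; apply: SN; case: (US j jl).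
  - by move=> j jl; clear -jl; lia.
  - move=> i j ij jl; rewrite UI; [|clear -ij jl; lia|clear -ij jl; lia|clear -ij jl; lia].
    rewrite /W; case: (i =P 0) => [i0|i0]; case: (j =P 0) => [j0|j0]; try (clear -ij i0 j0; lia).
    + case: (j =P 2 * s - 1) => [j1|j1].
        by rewrite setIC disjoint_setI0 // cards0; clear -ij jl i0 j0 j1 s2; lia.
      rewrite disjoint_setI0 ?cards0; first by clear -ij jl i0 j0 j1 s2; lia.
      by rewrite disjoint_sym disjoints1; apply: vT => //; clear -ij jl i0 j0 j1 s2; lia.
    + case: (i =P 2 * s - 1) => [|i1]; first by clear -ij jl; lia.
      case: (j =P 2 * s - 1) => [j1|j1].
        rewrite disjoint_setI0 ?cards0; first by clear -ij jl i0 j0 j1 s2; lia.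
        by rewrite disjoints1; apply: vT => //; clear -ij jl i0 j0 j1 s2; lia.
      case: (i.-1./2 =P j.-1./2) => [e|ne].
        by rewrite e setIid cards1; clear -ij jl e s2 i0 j0 i1 j1; lia.
      have -> : [set v i.-1./2] :&: [set v j.-1./2] = set0.
        apply/eqP; rewrite setI_eq0 disjoints1 inE; apply/negP=> /eqP/vI;
          clear -ij jl ne s2 i0 j0 i1 j1; lia.
      by rewrite cards0; clear -ij jl ne s2 i0 j0 i1 j1; lia.
exists L => // v vL.
have degv : k' * N1 <= k' * degree S [set v] + 2 * N1.
  have le1 : \sum_(w in L) degree S [set w] <= degree S [set v] + (s - 2) * N1.
    rewrite (bigD1 v vL) /= leq_add2l.
    apply: leq_trans (_ : \sum_(w in L :\ v) N1 <= _).
      rewrite [X in X <= _](eq_bigl (mem (L :\ v))) => [|w];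
        last by rewrite -[RHS]/(w \in L :\ v) in_setD1 andbC.
      exact: leq_sum.
    by rewrite sum_nat_const leq_mul2r; have := cardsD1 v L; rewrite vL cL1; nlia.
  have le2 : #|S| <= degree S [set v] + (s - 2) * N1 + E1 + E2.
    by apply: leq_trans cover (leq_add (leq_add le1 (leqnn _)) cMs).
  have e : k' * (s - 1) * N1 = k' * ((s - 2) * N1) + k' * N1.
    by rewrite -mulnA -mulnDr -mulSnr; congr (_ * (_ * _)); nlia.
  have := leq_mul (leqnn k') le2; rewrite !mulnDr; move: lower; rewrite e.
  by clear -kE; nlia.
set D := 'C(n - t, r - t).
have bf : N1 * D = 'C(r - 1, t - 1) * 'C(n - 1, r - 1) by apply: bin_flags; nlia.
have bt0 : 0 < 'C(r - 1, t - 1) by rewrite bin_gt0; nlia.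
rewrite -(leq_pmul2l bt0) mulnCA [X in _ <= X]mulnCA -bf -(sum_missing _ uH t0 (ltnW tr)).
set A := [set T in rsubsets _ _ | v \in T].
have cA : #|A| = N1 by rewrite card_rsubsets_mem.
have cAS : #|A :&: S| = degree S [set v].
  apply: eq_card => T; rewrite in_setI [RHS]inE andbC sub1set.
  case: (boolP (T \in S)) => //= TS.
  by rewrite [T \in A]inE [T \in rsubsets _ _]inE subsetT (uS _ TS) eqxx.
rewrite big_distrr (bigID (mem S)) /=.
apply: leq_trans (_ : \sum_(T in A :&: S) D + \sum_(T in A :\: S) k' * D <= _).
  apply: leq_add.
    rewrite [X in _ <= X](eq_bigl (fun T => (T \in A) && (T \in S))); last by move=> T;
      rewrite inE.
    by apply: leq_sum => T /andP[_ /SN/andP[_]].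
  rewrite [X in _ <= X](eq_bigl (fun T => (T \in A) && (T \notin S))); last by move=> T;
    rewrite inE andbC.
  apply: leq_sum => T /andP[AT _]; rewrite leq_mul2l; apply/orP; right.
  have cT : #|T| = t by move: AT; rewrite inE => /andP[/uniform_rsubsets].
  by have := missingE (T := T) uH; rewrite cT => /(_ (ltnW tr)); rewrite -/D => <-;
    rewrite leq_addr.
rewrite !sum_nat_const -[#|A :\: S|](addKn #|A :&: S|) cardsID cA cAS mulnA -mulnDl [3 * _]mulnA
  leq_mul2r.
apply/orP; right; have := degS v; clear -degv; nia.
Qed.

(** * Members avoiding the almost full vertices *)

Definition touching n r (L : {set 'I_n}) := [set E in rsubsets [set: 'I_n] r | E :&: L != set0].

Definition avoiding n (H : {set {set 'I_n}}) (L : {set 'I_n}) := [set E in H | [disjoint E & L]].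

Lemma path_freeS n r l (H G : {set {set 'I_n}}) : H \subset G -> path_free r l G ->
  path_free r l H.
Proof.
move=> /subsetP sHG free [E [lin EH]]; apply: free; exists E; split=> // i; exact/sHG/EH.
Qed.

Lemma uniform_sub n r (H : {set {set 'I_n}}) : H \subset rsubsets [set: 'I_n] r -> uniform r H.
Proof. by move=> /subsetP h E /h; exact: uniform_rsubsets. Qed.

Lemma extremalE n r (A Q E : {set 'I_n}) :
  (E \in extremal r A Q) = (#|E| == r) && ((E :&: A != set0) || (Q \subset E)).
Proof.
rewrite !inE subsetT /= -disjoints_subset -setI_eq0.
by case: (E :&: A == set0); case: (#|E| == r); rewrite /= ?orbF.
Qed.

Lemma touching_extremal n r (A Q : {set 'I_n}) : touching r A \subset extremal r A Q.
Proof.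
apply/subsetP=> E; rewrite extremalE inE => /andP[/uniform_rsubsets -> ->].
by rewrite eqxx.
Qed.

Section Rigidity.
Variables (n r s : nat) (H : {set {set 'I_n}}) (L : {set 'I_n}).
Let c := 2 * s * r.
Hypotheses (r3 : 3 <= r) (s2 : 2 <= s) (uH : uniform r H) (free : path_free r (2 * s) H).
Hypothesis (cL : #|L| = s - 1).

(** The vertices through which a walk can pass from any vertex of L to any other. *)
Definition good_vertices := [set x | (x \notin L) && [forall v in L, flex H c [set x; v]]].
Definition bad_vertices := ~: L :\: good_vertices.
Let X := good_vertices.
Let B := avoiding H L.
Let m := #|touching r L :\: H|.
Let beta := #|bad_vertices|.

(** Every bad vertex lies in at least a constant times n ^ (r - 2) missing edges,
    and each missing edge is counted at most r times. *)
Lemma bad_vertices_le : 2 * (c + r + r) <= n -> beta * n ^ (r - 2) <= bin_scale (r - 2) * r * m.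
Proof.
move=> nbig.
have nf x : x \in bad_vertices -> exists2 v, v \in L & (x \notin L) && ~~ flex H c [set x; v].
  rewrite !inE => /andP[+ xL]; rewrite xL /= => /forall_inPn[v vL nf].
  by exists v.
have le1 : \sum_(x in bad_vertices) 'C(n - (2 + c), r - 2) <= r * m.
  apply: leq_trans (_ : \sum_(x in bad_vertices) #|[set E in touching r L :\: H | x \in E]| <= _).
    apply: leq_sum => x /nf[v vL /andP[xL nfx]].
    have xv : x != v by apply: contraNneq xL => ->.
    have c2 : #|[set x; v]| = 2 by rewrite cards2 xv.
    have := @nonflex_missing n r c H [set x; v] _ nfx; rewrite c2 subnDA => /(_ (ltnW r3)) h.
    apply: leq_trans h _; apply: subset_leq_card; apply/subsetP=> E.
    rewrite inE subUset !sub1set => /andP[ER /andP[/andP[xE vE] HE]].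
    rewrite inE xE andbT inE HE inE ER; apply/set0Pn; exists v.
    by rewrite inE vE.
  rewrite double_count mulnC -sum_nat_const; apply: leq_sum => E.
  rewrite inE => /andP[_]; rewrite inE => /andP[/uniform_rsubsets <- _].
  by apply: subset_leq_card; apply/subsetP=> x; rewrite inE => /andP[].
rewrite sum_nat_const in le1.
rewrite -mulnA; apply: leq_trans (leq_mul (leqnn _) le1); rewrite mulnCA leq_mul2l.
by apply/orP; right; apply: exp_le_bin; nlia.
Qed.

Lemma good_disjoint : [disjoint X & L].
Proof. by rewrite disjoint_subset; apply/subsetP=> x; rewrite inE => /andP[]. Qed.

Lemma good_flex : {in X & L, forall x v, flex H c [set x; v]}.
Proof. by move=> x v; rewrite inE => /andP[_ /forall_inP h]; exact: h. Qed.

Lemma avoiding_good_or_bad E : E \in B -> E \subset X :|: bad_vertices.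
Proof.
rewrite inE => /andP[_]; rewrite disjoint_subset => /subsetP EL; apply/subsetP=> x /EL;
  rewrite inE => xL.
by rewrite in_setU in_setD in_setC xL andbT orbN.
Qed.

Hypothesis Xbig : s + 2 * r <= #|X|.

(** Disjoint members are the two ends of a path through L; members with a single
    common vertex form a tail, unless that vertex is the only good vertex of
    both. *)
Lemma good_members E E' : E \in B -> E' \in B -> E :&: X != set0 -> E' :&: X != set0 ->
  2 <= #|E :&: E'| \/ exists x, [/\ E :&: X = [set x], E' :&: X = [set x] & E :&: E' = [set x]].
Proof.
move=> BE BE' EX EX'; case: (leqP 2 #|E :&: E'|) => [|lt]; [by left | right].
move: (BE) (BE'); rewrite !inE => /andP[HE dE] /andP[HE' dE'].
have c1 : #|E :&: E'| = 1.
  apply/eqP; rewrite eqn_leq -ltnS lt /= lt0n cards_eq0; apply/negP=> /eqP EE.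
  case/set0Pn: EX => x0 /setIP[x0E x0X]; case/set0Pn: EX' => x1 /setIP[x1E x1X].
  exact: (no_bridge r3 s2 uH free good_disjoint good_flex cL Xbig HE HE' EE dE dE' x0E x1E x0X
    x1X).
have sub1 : E :&: X \subset E :&: E'.
  apply/subsetP=> x /setIP[xE xX]; rewrite inE xE /=; apply/negPn/negP=> nx.
  apply: (no_tail r3 s2 uH free good_disjoint good_flex cL Xbig HE' HE _ dE' dE xE nx xX).
  by rewrite setIC.
have sub2 : E' :&: X \subset E :&: E'.
  apply/subsetP=> x /setIP[xE xX]; rewrite inE xE andbT; apply/negPn/negP=> nx.
  exact: (no_tail r3 s2 uH free good_disjoint good_flex cL Xbig HE HE' c1 dE dE' xE nx xX).
have /cards1P[x xE] : #|E :&: E'| == 1 by rewrite c1.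
exists x; split=> //; apply/eqP; rewrite eqEcard.
  by rewrite -xE sub1 c1 card_gt0.
by rewrite -xE sub2 c1 card_gt0.
Qed.

Let B0 := [set E in B | E :&: X == set0].
Let B1 := [set E in B | E :&: X != set0].

Lemma sub_powerset_card (A : {set {set 'I_n}}) (D : {set 'I_n}) k : uniform k A ->
  {in A, forall E : {set 'I_n}, E \subset D} -> #|A| <= #|D| ^ k.
Proof.
move=> uA AD; apply: leq_trans (leq_bin_exp _ _); rewrite -cards_draws.
by apply: subset_leq_card; apply/subsetP=> E AE; rewrite inE AD //= uA.
Qed.

(** This subfamily lives on the bad vertices and is path-free. *)
Lemma card_B0 : #|B0| <= c * beta ^ (r - 1).
Proof.
have sB : B0 \subset H by apply/subsetP=> E; rewrite !inE -andbA => /andP[].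
have uB := uniformS sB uH.
apply: leq_trans (free_card_le_shadow r3 _ uB (path_freeS sB free)) _; first by nlia.
rewrite -/c leq_mul2l; apply/orP; right; rewrite subn1; apply: sub_powerset_card.
  by move=> W; rewrite inE => /andP[/uniform_rsubsets].
move=> W; rewrite shadowE => /andP[_ /degree_gt0[E]].
rewrite inE => /andP[BE /eqP EX] WE; apply: subset_trans WE _.
apply/subsetP=> x xE; have := subsetP (avoiding_good_or_bad BE) x xE.
by rewrite in_setU => /orP[xX|//]; move/setP/(_ x): EX; rewrite inE xE xX inE.
Qed.

(** All vertices but x are bad. *)
Lemma card_B1_single x (A : {set {set 'I_n}}) : A \subset B1 ->
  {in A, forall E : {set 'I_n}, E :&: X = [set x]} ->
  #|A| <= beta ^ (r - 1).
Proof.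
move=> AB AX.
have xE E : E \in A -> x \in E.
  by move/AX/setP/(_ x); rewrite !inE eqxx => /andP[].
have inj : {in A &, injective (fun E : {set 'I_n} => E :\ x)}.
  by move=> E E' /xE xE1 /xE xE2 e; rewrite -(setD1K xE1) -(setD1K xE2) e.
rewrite -(card_in_imset inj); apply: sub_powerset_card.
  move=> W /imsetP[E AE ->].
  have HE : E \in H by have := subsetP AB E AE; rewrite !inE -andbA => /andP[].
  by have := cardsD1 x E; rewrite xE // (uH HE); nlia.
move=> W /imsetP[E AE ->].
have BE : E \in B by have := subsetP AB E AE; rewrite inE => /andP[].
apply/subsetP=> y; rewrite !in_setD1 => /andP[yx yE].
have := subsetP (avoiding_good_or_bad BE) y yE; rewrite in_setU => /orP[yX|//].
by move/setP/(_ y): (AX E AE); rewrite in_setI in_set1 yE yX (negbTE yx).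
Qed.

Lemma uniform_B1 : uniform r B1.
Proof. by move=> E; rewrite !inE -andbA => /andP[/uH]. Qed.

Lemma B1P E : E \in B1 -> E \in B /\ E :&: X != set0.
Proof. by rewrite inE => /andP[]. Qed.

Lemma B1_pair E E' : E \in B1 -> E' \in B1 -> 2 <= #|E :&: E'| \/
  exists x, [/\ E :&: X = [set x], E' :&: X = [set x] & E :&: E' = [set x]].
Proof. by move=> /B1P[BE EX] /B1P[BE' EX']; exact: good_members. Qed.

Lemma card_B1_trace (A : {set {set 'I_n}}) (U : {set 'I_n}) u j : A \subset B1 ->
  #|U| <= u -> j <= r ->
  {in A, forall E, j <= #|E :&: U|} -> #|A| <= 2 ^ u * n ^ (r - j).
Proof.
move=> AB Uu jr AU.
apply: leq_trans (_ : #|[set E in B1 | j <= #|E :&: U|]| <= _).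
  by apply: subset_leq_card; apply/subsetP=> E AE; rewrite inE (subsetP AB) // AU.
apply: leq_trans (card_trace_le _ _ uniform_B1) _; rewrite jr mul1n leq_mul2r.
by rewrite leq_exp2l // Uu orbT.
Qed.

(** If E0 and E1 are members whose traces on the good vertices are not the same
    single vertex, every member meets E0 or E1 in a pair. *)
Lemma card_B1 : #|B1| <= beta ^ (r - 1) + 2 * 2 ^ r * n ^ (r - 2).
Proof.
have [->|/set0Pn[E0 BE0]] := eqVneq B1 set0; first by rewrite cards0.
have c0 : #|E0| <= r by rewrite (uniform_B1 BE0).
have r2 : 2 <= r by nlia.
have [/forall_inP h|/forall_inPn[E1 BE1 nE1]] := boolP [forall E in B1, 2 <= #|E :&: E0|].
  have := @card_B1_trace B1 E0 r 2 (subxx _) c0 r2 h; nia.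
have [|[x [E1x E0x _]]] := B1_pair BE1 BE0; first by rewrite (negbTE nE1).
have [/forall_inP h|/forall_inPn[E2 BE2 nE2]] := boolP [forall E in B1, E :&: X == [set x]].
  by apply: leq_trans (card_B1_single (subxx _) (fun E BE => eqP (h E BE))) (leq_addr _ _).
rewrite -(cardsID [set E | E :&: X == [set x]] B1) -mulnA mul2n -addnn.
apply: leq_trans (leq_addl _ _); apply: leq_add.
  apply: (@card_B1_trace _ E2) => //; [exact: subsetIl | by rewrite (uniform_B1 BE2) |].
  move=> E /setIP[BE]; rewrite inE => /eqP Ex.
  have [//|[y [Ey E2y _]]] := B1_pair BE BE2.
  by move: nE2; rewrite E2y -Ey Ex eqxx.
apply: (@card_B1_trace _ E0) => //; first exact: subsetDl.
move=> E /setDP[BE]; rewrite inE => nEx.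
have [//|[y [Ey E0y _]]] := B1_pair BE BE0.
by move: nEx; rewrite Ey -E0y E0x eqxx.
Qed.

(** If two members E1 and E2 meet in one vertex x only, every member whose trace is
    not x alone meets each of E1 and E2 twice, hence their union in three
    vertices; otherwise the family is 2-intersecting. *)
Lemma B1_kernel : (exists2 Q : {set 'I_n}, #|Q| = 2 & {in B1, forall E :
  {set 'I_n}, Q \subset E}) \/
  #|B1| <= beta ^ (r - 1) + 2 ^ (3 * r) * n ^ (r - 3).
Proof.
have [/forall_inP h|/forall_inPn[E1 BE1 /forall_inPn[E2 BE2 nE]]] :=
  boolP [forall E in B1, forall E' in B1, 2 <= #|E :&: E'|].
  have int : {in B1 &, forall E E', 2 <= #|E :&: E'|}.
    by move=> E E' BE BE'; have /forall_inP := h E BE; apply.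
  case: (intersecting_kernel uniform_B1 int) => [[Q cQ QB]|[U cU UB]]; first by left; exists Q.
  right; apply: leq_trans (leq_addl _ _); exact: (@card_B1_trace _ U).
right.
have [|[x [E1x E2x E12]]] := B1_pair BE1 BE2; first by rewrite (negbTE nE).
rewrite -(cardsID [set E | E :&: X == [set x]] B1); apply: leq_add.
  apply: (@card_B1_single x); first exact: subsetIl.
  by move=> E /setIP[_]; rewrite inE => /eqP.
apply: (@card_B1_trace _ (E1 :|: E2)) => //; first exact: subsetDl.
  by have [le _] := leq_card_setU E1 E2; move: le; rewrite (uniform_B1 BE1) (uniform_B1 BE2);
    nlia.
move=> E /setDP[BE]; rewrite inE => nEx.
have h1 : 2 <= #|E :&: E1|.
  by have [//|[y [Ey E1y _]]] := B1_pair BE BE1; move: nEx; rewrite Ey -E1y E1x eqxx.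
have h2 : 2 <= #|E :&: E2|.
  by have [//|[y [Ey E2y _]]] := B1_pair BE BE2; move: nEx; rewrite Ey -E2y E2x eqxx.
rewrite setIUr cardsU.
have : #|E :&: E1 :&: (E :&: E2)| <= 1.
  rewrite -(cards1 x) -E12; apply: subset_leq_card; apply/subsetP=> y.
  by rewrite !inE => /andP[/andP[_ ->] /andP[_ ->]].
by clear -h1 h2; lia.
Qed.
End Rigidity.

(** First m = O(n^(r-2)): members avoiding L number at most
    O(beta^(r-1)) + O(n^(r-2)), where beta, the number of bad vertices, is at most a
    constant times m / n^(r-2) and a small multiple of n; hence the first term is a
    small multiple of m, while m is at most K1 times the sum.  Then beta is bounded
    and the kernel of the members with good vertices gives Q.  If some member E'
    avoiding L does not contain Q, either a bad vertex exists and causes many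
    missing edges, or no r-set F above Q that is disjoint from L and from the rest
    of E' can belong to H. *)
Lemma rigidity r s K1 : 3 <= r -> 2 <= s -> exists q K, 0 < q /\
  eventually (fun n => forall (H : {set {set 'I_n}}) (L : {set 'I_n}),
    uniform r H -> path_free r (2 * s) H -> #|L| = s - 1 ->
    q * #|touching r L :\: H| <= n ^ (r - 1) ->
    #|touching r L :\: H| <= K1 * #|avoiding H L| ->
    exists Q : {set 'I_n}, [/\ #|Q| = 2, Q \subset ~: L,
      #|avoiding H L| <= K * n ^ (r - 2),
      #|H :\: extremal r L Q| <= K * n ^ (r - 3) &
      H :\: extremal r L Q != set0 -> n ^ (r - 2) <= K * #|extremal r L Q :\: H|]).
Proof.
move=> r3 s2; pose c := 2 * s * r; pose a1 := bin_scale (r - 2) * r; pose a2 := a1 ^ (r - 1).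
pose q := 2 * (K1 * (c + 1) * a2) + 2 * a1 + 1.
pose a3 := 2 * (K1 * (2 * 2 ^ r)); pose a4 := a1 * a3.
pose a5 := (c + 1) * a4 ^ (r - 1) + 2 * 2 ^ r.
pose a7 := (c + 1) * a4 ^ (r - 1) + 2 ^ (3 * r).
exists q, (a5 + a7 + a1 + bin_scale (r - 2)); split; first by rewrite /q; lia.
exists (2 * (c + r + r) + 2 * (2 * s + 2 * r) + 2) => n nN H L uH free cL.
set m := #|_ :\: H|; set b := #|avoiding H L| => qm mb.
have nbig : 2 * (c + r + r) <= n by lia.
have n0 : 0 < n by lia.
have np j : 0 < n ^ j by rewrite expn_gt0 n0.
set X := good_vertices r s H L; set beta := #|bad_vertices r s H L|.
have bm : beta * n ^ (r - 2) <= a1 * m by exact: bad_vertices_le.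
have nr : n ^ (r - 1) = n * n ^ (r - 2) by rewrite -expnS; congr (_ ^ _); clear -r3; lia.
have qb : q * beta <= a1 * n.
  rewrite -(leq_pmul2r (np (r - 2))) -[a1 * n * _]mulnA -nr -mulnA.
  apply: leq_trans (leq_mul (leqnn q) bm) _.
  by rewrite mulnCA leq_mul2l qm orbT.
(* At least about half of the vertices are good. *)
have b2 : 2 * beta <= n.
  have [a10|a10] := posnP a1.
    by move: qb; rewrite a10 mul0n leqn0 muln_eq0 => /orP[/eqP|/eqP->//]; rewrite /q; clear; lia.
  rewrite -(leq_pmul2l a10); apply: leq_trans qb; rewrite mulnA leq_mul2r; apply/orP; right.
  by rewrite /q; clear; lia.
have cXL : #|X| + beta + (s - 1) = n.
  have <- : #|~: L| = #|X| + beta.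
    rewrite -(cardsID X (~: L)); congr (_ + _); apply: eq_card => x.
    rewrite in_setI andbC; case: (boolP (x \in X)) => //= xX.
    by rewrite in_setC; have := subsetP (_ : X \subset ~: L) x xX;
      rewrite in_setC -disjoints_subset => -> //; exact: good_disjoint.
  by rewrite -cL addnC cardsC card_ord.
have Xbig : s + 2 * r <= #|X| by clear -cXL b2 nN s2; lia.
(* The point of the large constant q: beta is at most a1 n / q by qb, and r >= 3
leaves at least one such factor. *)
have qb3 : q * beta ^ (r - 1) <= a2 * m.
  have e1 : beta ^ (r - 1) = beta * beta ^ (r - 2) by rewrite -expnS; congr (_ ^ _); clear -r3;
    lia.
  have e2 : a2 = a1 * a1 ^ (r - 2) by rewrite /a2 -expnS; congr (_ ^ _); clear -r3; lia.
  have qq : q <= q ^ (r - 2).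
    by rewrite -[X in X <= _]expn1; apply: leq_pexp2l; [rewrite /q; clear; lia | clear -r3; lia].
  rewrite -(leq_pmul2r (np (r - 2))).
  apply: leq_trans (_ : (q * beta) ^ (r - 2) * (beta * n ^ (r - 2)) <= _).
    have -> : (q * beta) ^ (r - 2) * (beta * n ^ (r - 2)) = q ^ (r - 2) * (beta * beta ^ (r - 2)
      * n ^ (r - 2)).
      by rewrite expnMn; clear; nia.
    by rewrite e1 -mulnA leq_mul2r qq orbT.
  apply: leq_trans (leq_mul (leq_exp2r_weak (r - 2) qb) bm) _.
  rewrite expnMn e2; apply: eq_leq; clear; nia.
have cB : b <= (c + 1) * beta ^ (r - 1) + 2 * 2 ^ r * n ^ (r - 2).
  rewrite /b -(cardsID [set E : {set 'I_n} | E :&: X == set0] (avoiding H L)).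
  have h0 := card_B0 r3 s2 uH free cL Xbig.
  have h1 := card_B1 r3 s2 uH free cL Xbig.
  rewrite mulnDl mul1n -addnA; apply: leq_add.
  - apply: leq_trans h0; apply: subset_leq_card; apply/subsetP=> E /setIP[BE].
    by rewrite inE => EX; rewrite inE BE.
  - apply: leq_trans h1; apply: subset_leq_card; apply/subsetP=> E /setDP[BE].
    by rewrite inE => EX; rewrite inE BE.
have ma3 : m <= a3 * n ^ (r - 2).
  have q0 : 0 < q by rewrite /q; clear; lia.
  have le : q * m <= K1 * (c + 1) * a2 * m + q * (K1 * (2 * 2 ^ r * n ^ (r - 2))).
    apply: leq_trans (leq_mul (leqnn q) (leq_trans mb (leq_mul (leqnn K1) cB))) _.
    rewrite mulnDr mulnDr leq_add2r.
    rewrite -[X in _ <= X]mulnA; apply: leq_trans (leq_mul (leqnn (K1 * (c + 1))) qb3).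
    by apply: eq_leq; clear; nia.
  have le2 : 2 * (K1 * (c + 1) * a2 * m) <= q * m.
    by rewrite mulnA leq_mul2r; apply/orP; right; rewrite /q; clear; lia.
  rewrite -(leq_pmul2l q0) /a3.
  have -> : q * (2 * (K1 * (2 * 2 ^ r)) * n ^ (r - 2)) = 2 * (q * (K1 * (2 * 2 ^ r * n ^ (r -
    2)))).
    by clear; nia.
  by clear -le le2; lia.
have ba4 : beta <= a4.
  rewrite -(leq_pmul2r (np (r - 2))); apply: leq_trans bm _.
  by rewrite /a4 -mulnA leq_mul2l ma3 orbT.
have bp : beta ^ (r - 1) <= a4 ^ (r - 1) by apply: leq_exp2r_weak.
have ba5 : b <= a5 * n ^ (r - 2).
  apply: leq_trans cB _; rewrite /a5 [X in _ <= X]mulnDl leq_add2r.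
  apply: leq_trans (leq_pmulr _ (np (r - 2))); rewrite leq_mul2l bp orbT //.
set B := avoiding H L in b cB mb ba5 *.
pose B0 := [set E in B | E :&: X == set0]; pose B1 := [set E in B | E :&: X != set0].
have cB0 : #|B0| <= c * a4 ^ (r - 1).
  by apply: leq_trans (card_B0 r3 s2 uH free cL Xbig) _; rewrite leq_mul2l bp orbT.
have HB E Q : E \in H :\: extremal r L Q -> E \in B /\ ~~ (Q \subset E).
  case/setDP=> HE; rewrite extremalE (uH _ HE) eqxx /= negb_or negbK => /andP[EL QE].
  by rewrite inE HE -setI_eq0.
have [Q [cQ QL HQ]] : exists Q : {set 'I_n}, [/\ #|Q| = 2, Q \subset ~: L &
    #|H :\: extremal r L Q| <= a7 * n ^ (r - 3)].
  have small : #|B1| <= beta ^ (r - 1) + 2 ^ (3 * r) * n ^ (r - 3) -> exists Q : {set 'I_n},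
      [/\ #|Q| = 2, Q \subset ~: L & #|H :\: extremal r L Q| <= a7 * n ^ (r - 3)].
    move=> le1; have [|Q QL cQ] := @exists_subset_card _ (~: L) 2.
      by rewrite cardsCs setCK card_ord cL; clear -nN; lia.
    exists Q; split=> //; apply: leq_trans (_ : #|B0| + #|B1| <= _).
      apply: leq_trans (_ : #|B0 :|: B1| <= _); last by have [] := leq_card_setU B0 B1.
      apply: subset_leq_card; apply/subsetP=> E /HB[BE _].
      rewrite in_setU; case: (boolP (E :&: X == set0)) => EX; apply/orP; [left|right];
        by rewrite inE BE.
    apply: leq_trans (leq_add cB0 le1) _; rewrite addnA /a7 mulnDl leq_add2r.
    apply: leq_trans (leq_pmulr _ (np (r - 3))).
    by rewrite mulnDl mul1n leq_add2l.
  have [B10|/set0Pn[E1 BE1]] := eqVneq B1 set0; first by apply: small; rewrite B10 cards0.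
  case: (B1_kernel r3 s2 uH free cL Xbig) => [[Q cQ QB]|]; last exact: small.
  exists Q; split=> //.
    apply: subset_trans (QB _ BE1) _; rewrite -disjoints_subset.
    by move: BE1; rewrite inE => /andP[]; rewrite inE => /andP[].
  apply: leq_trans (_ : #|B0| <= _).
    apply: subset_leq_card; apply/subsetP=> E /HB[BE nQ]; rewrite inE BE /=.
    by apply: contraNT nQ => EX; apply: QB; rewrite inE BE.
  apply: leq_trans cB0 _; apply: leq_trans (leq_pmulr _ (np (r - 3))).
  by rewrite /a7; clear; nia.
exists Q; split=> //.
- by apply: leq_trans ba5 _; rewrite leq_mul2r; apply/orP; right; clear; lia.
- by apply: leq_trans HQ _; rewrite leq_mul2r; apply/orP; right; clear; lia.
case/set0Pn=> E' /HB[BE' QE'].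
have [b0|b0] := posnP beta; last first.
  apply: leq_trans (_ : a1 * m <= _); first by apply: leq_trans bm; rewrite leq_pmull.
  apply: leq_mul; first by clear; lia.
  by apply: subset_leq_card; apply: setSD; exact: touching_extremal.
(* From here on there are no bad vertices. *)
have goodX x : x \notin L -> x \in X.
  move=> xL; apply/negPn/negP=> xX; move: b0; rewrite /beta => /eqP.
  by rewrite cards_eq0 => /eqP/setP/(_ x); rewrite in_setD in_setC xL xX inE.
have cE' : #|E'| = r by move: BE'; rewrite inE => /andP[/uH].
have E'L : [disjoint E' & L] by move: BE'; rewrite inE => /andP[].
have subX (E : {set 'I_n}) : [disjoint E & L] -> E :&: X = E.
  rewrite disjoint_subset => /subsetP EL; apply/setIidPl/subsetP=> x /EL; rewrite inE;
    exact: goodX.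
pose Z := L :|: (E' :\: Q).
have QZ : Q \subset ~: Z.
  rewrite /Z setCU subsetI QL; apply/subsetP=> x xQ; by rewrite !inE xQ.
have cZ : #|Z| <= s + r.
  have [le _] := leq_card_setU L (E' :\: Q); apply: leq_trans le _.
  have := subset_leq_card (subsetDl E' Q); rewrite cL cE'; clear; lia.
have r2 : 2 <= r by exact: ltnW.
have := card_between QZ (_ : #|Q| <= r); rewrite cQ => /(_ r2) cF.
apply: leq_trans (_ : bin_scale (r - 2) * 'C(#|~: Z| - 2, r - 2) <= _).
  rewrite cardsCs setCK card_ord.
  apply: leq_trans (exp_le_bin (_ : 2 * ((s + r + 2) + (r - 2)) <= n)) _; first by clear -nN r3;
    lia.
  by rewrite leq_mul2l leq_bin2l ?orbT //; clear -cZ; lia.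
apply: leq_mul; first by clear; lia.
rewrite -cF; apply: subset_leq_card; apply/subsetP=> F; rewrite inE => /and3P[QF FZ /eqP cFr].
have FL : [disjoint F & L].
  by rewrite disjoints_subset; apply: subset_trans FZ _; rewrite setCS subsetUl.
rewrite in_setD extremalE cFr eqxx QF orbT; apply/andP; split=> //; apply/negP=> HF.
have BF : F \in B by rewrite inE HF.
have FX := subX F FL; have EX := subX E' E'L.
have [|||[x [Fx _ _]]] := good_members r3 s2 uH free cL Xbig BF BE'.
- by rewrite FX -card_gt0 cFr; clear -r3; lia.
- by rewrite EX -card_gt0 cE'; clear -r3; lia.
- have sub : F :&: E' \subset Q :&: E'.
    apply/subsetP=> x /setIP[xF xE]; rewrite inE xE andbT.
    have := subsetP FZ x xF; rewrite !inE xE andbT negb_or negbK; by case/andP.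
  have lt : #|Q :&: E'| < 2.
    rewrite -cQ; apply: proper_card; rewrite properE subsetIl /=.
    by apply: contra QE' => /subset_trans; apply; exact: subsetIr.
  by have := subset_leq_card sub; clear -lt; lia.
- by move: Fx; rewrite FX => e; move: cFr; rewrite e cards1; clear -r3; lia.
Qed.

(** * Auxiliary counts for the norm *)

(** The number of pairs of a t-set through a vertex and an r-set above it is of
    order n ^ (r - 1). *)
Lemma exp_le_flags n r t : 0 < t -> t <= r -> 0 < r -> 2 * r <= n ->
  n ^ (r - 1) <= bin_scale (r - 1) * ('C(n - 1, t - 1) * 'C(n - t, r - t)).
Proof.
move=> t0 tr r0 nr; rewrite bin_flags //; last by lia.
apply: leq_trans (exp_le_bin (_ : 2 * (1 + (r - 1)) <= n)) _; first by lia.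
by rewrite leq_mul2l leq_pmull ?orbT // bin_gt0; lia.
Qed.

Lemma eventually_flags A r t : 0 < t -> t <= r -> 2 <= r ->
  eventually (fun n => A * n ^ (r - 2) <= 'C(n - 1, t - 1) * 'C(n - t, r - t)).
Proof.
move=> t0 tr r2; exists (2 * r + (bin_scale (r - 1) * A).+1) => n nN.
have nr : 2 * r <= n by exact: leq_trans (leq_addr _ _) nN.
have lt : bin_scale (r - 1) * A < n by apply: leq_trans nN; exact: leq_addl.
rewrite -(leq_pmul2l (bin_scale_gt0 (r - 1))) mulnA.
apply: leq_trans (exp_le_flags t0 tr (ltnW r2) nr).
have := lower_order (r - 2) lt; rewrite (_ : (r - 2).+1 = r - 1); [exact: ltnW | clear -r2; lia].
Qed.

(** The left-hand side adds up the stars of the vertices of A; sets with two or more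
    points in A are counted repeatedly, but they are of lower order. *)
Lemma touching_count n s t (A : {set 'I_n}) : #|A| = s - 1 -> 0 < t ->
  (s - 1) * 'C(n - 1, t - 1) <= #|touching t A| + (s - 1) * (2 ^ (s - 1) * ((t - 1) * n ^ (t -
    2))).
Proof.
move=> cA t0; set R := rsubsets [set: 'I_n] t.
have uT : uniform t (touching t A) by move=> T; rewrite inE => /andP[/uniform_rsubsets].
have -> : (s - 1) * 'C(n - 1, t - 1) = \sum_(T in touching t A) #|T :&: A|.
  rewrite -sum_degree1 -cA -sum_nat_const; apply: eq_bigr => v vA.
  rewrite -(card_rsubsets_mem v t0); apply: eq_card => T.
  apply/idP/idP; rewrite inE ?sub1set => /andP[TR vT]; rewrite inE ?sub1set vT andbT.
    by rewrite inE TR; apply/set0Pn; exists v; rewrite inE vT.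
  by case/setIdP: TR.
apply: leq_trans (@sum_except _ _ (fun T : {set 'I_n} => #|T :&: A|) 1 #|A| _) _.
  by move=> T _; apply: subset_leq_card; exact: subsetIr.
rewrite mul1n leq_add2l cA leq_mul2l; apply/orP; right.
apply: leq_trans (card_trace_le A 2 uT) _; rewrite cA leq_mul2l leq_mul2r; apply/orP; right.
by apply/orP; right; case: (leqP 2 t) => // t2; rewrite subn_gt0.
Qed.

Lemma degree_touching n r (L T : {set 'I_n}) : #|T| <= r -> T :&: L != set0 ->
  degree (touching r L) T = 'C(n - #|T|, r - #|T|).
Proof.
move=> Tr /set0Pn[v /setIP[vT vL]]; rewrite -degree_complete //; apply: eq_card => E.
rewrite inE [RHS]inE [E \in touching _ _]inE -andbA; congr (_ && _).
case: (boolP (T \subset E)) => TE; last by rewrite andbF.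
by rewrite andbT; apply/set0Pn; exists v; rewrite inE vL (subsetP TE).
Qed.

Lemma uniform_touching n r (L : {set 'I_n}) : uniform r (touching r L).
Proof. by move=> E /setIdP[/uniform_rsubsets]. Qed.

Lemma uniform_extremal n r (A Q : {set 'I_n}) : uniform r (extremal r A Q).
Proof. by move=> E; rewrite extremalE => /andP[/eqP]. Qed.

Lemma setD_touching n r (H : {set {set 'I_n}}) (L : {set 'I_n}) : uniform r H ->
  H :\: touching r L = avoiding H L.
Proof.
move=> uH; apply/setP=> E; rewrite in_setD [RHS]inE andbC; case: (boolP (E \in H)) => //= HE.
by rewrite inE !inE subsetT (uH _ HE) eqxx /= negbK setI_eq0.
Qed.

Lemma card_touching_missing n r s k m (H : {set {set 'I_n}}) (L : {set 'I_n}) : #|L| = s - 1 ->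
  (forall v, v \in L -> k * missing r H [set v] <= m) -> k * #|touching r L :\: H| <= (s - 1) * m.
Proof.
move=> cL hv.
apply: leq_trans (_ : k * \sum_(v in L) missing r H [set v] <= _).
  rewrite leq_mul2l; apply/orP; right; apply: leq_trans (card_bigcup_le _ _).
  apply: subset_leq_card; apply/subsetP=> E;
    rewrite in_setD => /andP[HE /setIdP[ER /set0Pn[v /setIP[vE vL]]]].
  by apply/bigcupP; exists v => //; rewrite inE ER sub1set vE.
by rewrite big_distrr /= -cL -sum_nat_const; apply: leq_sum.
Qed.

(** A member through x either contains a vertex of L as well or avoids L. *)
Lemma degree_vertex_le n r (H : {set {set 'I_n}}) (L : {set 'I_n}) x : uniform r H ->
  2 <= r -> x \notin L ->
  degree H [set x] <= #|L| * 'C(n - 2, r - 2) + #|avoiding H L|.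
Proof.
move=> uH r2 xL.
have sub : [set E in H | [set x] \subset E] \subset
   (\bigcup_(v in L) [set E in H | [set x; v] \subset E]) :|: avoiding H L.
  apply/subsetP=> E /setIdP[HE xE]; rewrite in_setU.
  have [dE|nE] := boolP [disjoint E & L]; first by rewrite [E \in avoiding _ _]inE HE dE orbT.
  apply/orP; left; case/pred0Pn: nE => v /andP[/= vE vL]; apply/bigcupP; exists v => //.
  by rewrite inE HE subUset xE sub1set.
apply: leq_trans (subset_leq_card sub) _.
have [le _] := leq_card_setU (\bigcup_(v in L) [set E in H | [set x;
  v] \subset E]) (avoiding H L).
apply: leq_trans le _; rewrite leq_add2r; apply: leq_trans (card_bigcup_le _ _) _.
rewrite -sum_nat_const; apply: leq_sum => v vL.
have c2 : #|[set x; v]| = 2 by rewrite cards2 (_ : x != v) //; apply: contraNneq xL => ->.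
by rewrite -c2; apply: (degree_le_bin uH); rewrite c2.
Qed.

(** * Invariance of the norm under permutations *)

From mathcomp Require Import zify ring lra.
Import Order.TTheory GRing.Theory Num.Theory.

Lemma imset_imset_perm n (f : {perm 'I_n}) (E : {set 'I_n}) : f^-1%g @: (f @: E) = E.
Proof.
by rewrite -imset_comp (eq_imset (g := id)) ?imset_id // => x /=; rewrite permK.
Qed.

Lemma imset_perm_imset n (f : {perm 'I_n}) (E : {set 'I_n}) : f @: (f^-1%g @: E) = E.
Proof.
by rewrite -imset_comp (eq_imset (g := id)) ?imset_id // => x /=; rewrite permKV.
Qed.

Lemma degree_perm n (f : {perm 'I_n}) (H : {set {set 'I_n}}) (T : {set 'I_n}) :
  degree [set f @: E | E : {set 'I_n} in H] (f @: T) = degree H T.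
Proof.
rewrite /degree -[RHS](card_imset _ (imset_inj (@perm_inj _ f))); apply: eq_card => E.
rewrite !inE; apply/andP/imsetP => [[/imsetP[F HF ->] sub]|[F]].
  exists F => //; rewrite inE HF /=.
  by have := imsetS f^-1%g sub; rewrite !imset_imset_perm.
by rewrite inE => /andP[HF sub] ->; split; [exact: imset_f | exact: imsetS].
Qed.

Lemma tpnorm_perm n (R : realType) t (p : R) (f : {perm 'I_n}) (H : {set {set 'I_n}}) :
  tpnorm t p [set f @: E | E : {set 'I_n} in H] = tpnorm t p H.
Proof.
rewrite /tpnorm (reindex (fun T : {set 'I_n} => f @: T)) /=; last first.
  exists (fun T : {set 'I_n} => f^-1%g @: T) => T _.
    exact: imset_imset_perm.
  exact: imset_perm_imset.
apply: eq_big => [T|T _]; last by rewrite degree_perm.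
by rewrite !inE !subsetT card_imset //; exact: perm_inj.
Qed.

Lemma extremal_perm n r (f : {perm 'I_n}) (A Q : {set 'I_n}) :
  [set f @: E | E : {set 'I_n} in extremal r A Q] = extremal r (f @: A) (f @: Q).
Proof.
have key (E : {set 'I_n}) : (f @: E \in extremal r (f @: A) (f @: Q)) = (E \in extremal r A Q).
  rewrite !extremalE card_imset; last exact: perm_inj.
  have -> : (f @: Q \subset f @: E) = (Q \subset E).
    apply/idP/idP => [sub|]; last exact: imsetS.
    by have := imsetS f^-1%g sub; rewrite !imset_imset_perm.
  by rewrite -imsetI ?imset_eq0 // => x y _ _; exact: perm_inj.
apply/setP=> E; apply/imsetP/idP => [[F HF ->]|HE]; first by rewrite key.
by exists (f^-1%g @: E); rewrite ?imset_perm_imset // -key imset_perm_imset.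
Qed.

Lemma perm_of_uniq (T : finType) (s1 s2 : seq T) : uniq s1 -> uniq s2 -> size s1 = size s2 ->
  s1 =i predT -> exists f : {perm T}, forall x, f x = nth x s2 (index x s1).
Proof.
move=> u1 u2 ss all1.
have lt x : index x s1 < size s2 by rewrite -ss index_mem all1.
have inj : injective (fun x => nth x s2 (index x s1)).
  move=> x y /eqP; rewrite (set_nth_default y x (lt x)) nth_uniq // => /eqP e.
  by rewrite -[x](nth_index x (all1 x)) e (set_nth_default y x) ?index_mem ?all1 // nth_index
    ?all1.
by exists (perm inj) => x; rewrite permE.
Qed.

Lemma exists_perm_sets n (A Q A' Q' : {set 'I_n}) :
  #|A| = #|A'| -> #|Q| = #|Q'| -> [disjoint A & Q] -> [disjoint A' & Q'] ->
  exists f : {perm 'I_n}, f @: A = A' /\ f @: Q = Q'.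
Proof.
move=> cA cQ dAQ dAQ'.
pose S (A Q : {set 'I_n}) := enum A ++ enum Q ++ enum (~: (A :|: Q)).
have uS (B P : {set 'I_n}) : [disjoint B & P] -> uniq (S B P).
  move=> dBP; rewrite /S !cat_uniq !enum_uniq /= andbT; apply/andP; split.
    apply/hasPn=> x; rewrite mem_cat !mem_enum in_setC in_setU => /orP[xP|/norP[]//].
    by apply/negP=> xB; move: dBP; rewrite disjoint_subset => /subsetP/(_ x xB); rewrite inE xP.
  by apply/hasPn=> x; rewrite !mem_enum in_setC in_setU negb_or => /andP[].
have sS (B P : {set 'I_n}) : [disjoint B & P] -> size (S B P) = n.
  move=> dBP; rewrite /S !size_cat -!cardE addnA -[RHS]card_ord -(cardsC (B :|: P)).
  by rewrite cardsU disjoint_setI0 // cards0 subn0.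
have allS (B P : {set 'I_n}) : S B P =i predT.
  move=> x; rewrite /S !mem_cat !mem_enum in_setC in_setU inE.
  by case: (x \in B); case: (x \in P).
have [|f fE] := perm_of_uniq (uS _ _ dAQ) (uS _ _ dAQ') _ (allS A Q); first by rewrite !sS.
exists f; split; apply/eqP; rewrite eqEcard card_imset ?cA ?cQ ?leqnn ?andbT; try exact: perm_inj.
  apply/subsetP=> _ /imsetP[x xA ->]; rewrite fE /S index_cat mem_enum xA.
  have lt : index x (enum A) < size (enum A') by rewrite -cardE -cA cardE index_mem mem_enum.
  by rewrite nth_cat lt -mem_enum mem_nth.
apply/subsetP=> _ /imsetP[x xQ ->]; rewrite fE /S index_cat mem_enum.
have /negbTE-> : x \notin A by move: dAQ;
  rewrite disjoint_sym disjoint_subset => /subsetP/(_ x xQ).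
rewrite nth_cat -!cardE -cA ltnNge leq_addr /= addKn index_cat mem_enum xQ.
have lt : index x (enum Q) < size (enum Q') by rewrite -cardE -cQ cardE index_mem mem_enum.
by rewrite nth_cat lt -mem_enum mem_nth.
Qed.

(** The norm is an isomorphism invariant, and all admissible pairs are equivalent
    under permutations. *)
Lemma tpnorm_extremal n (R : realType) r s t (p : R) (A Q A' Q' : {set 'I_n}) :
  admissible s A Q -> admissible s A' Q' ->
  tpnorm t p (extremal r A Q) = tpnorm t p (extremal r A' Q').
Proof.
have dj (B P : {set 'I_n}) : P \subset ~: B -> [disjoint B & P].
  by rewrite disjoint_sym disjoints_subset.
move=> [cA cQ QA] [cA' cQ' QA'].
have cAA : #|A| = #|A'| by rewrite cA.
have cQQ : #|Q| = #|Q'| by rewrite cQ.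
have [f [<- <-]] := exists_perm_sets cAA cQQ (dj _ _ QA) (dj _ _ QA').
by rewrite -extremal_perm tpnorm_perm.
Qed.

(** * Comparing norms *)

Local Open Scope ring_scope.

Lemma powR_split (R : realType) (x p : R) : 0 <= x -> 1 < p -> x `^ p = x * x `^ (p - 1).
Proof. by move=> x0 p1; rewrite mulr_powRB1 //; lra. Qed.

Lemma powR_sub_ge (R : realType) (x y p : R) : 1 < p -> 0 <= y -> y <= x ->
  x `^ (p - 1) * (x - y) <= x `^ p - y `^ p.
Proof.
move=> p1 y0 yx; have x0 : 0 <= x by lra.
rewrite (powR_split x0 p1) (powR_split y0 p1) mulrBr [x `^ _ * x]mulrC lerD2l lerN2 mulrC.
by rewrite ler_wpM2r //; apply: ge0_ler_powR; rewrite ?nnegrE //; lra.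
Qed.

Lemma bernoulli_ge (R : realType) (z : R) N : 0 <= z <= 1 -> 1 - N%:R * (1 - z) <= z ^+ N.
Proof.
move=> /andP[z0 z1]; elim: N => [|N IH]; first by rewrite expr0; lra.
have zN : 0 <= z ^+ N <= 1 by rewrite exprn_ge0 // exprn_ile1.
rewrite exprS -natr1; nra.
Qed.

(** The mean value inequality, with p rounded up to an integer N so that it follows
    from Bernoulli's inequality for y / x. *)
Lemma powR_sub_le (R : realType) (x y p : R) N : 1 < p -> p <= N%:R -> 0 <= y -> y <= x ->
  x `^ p - y `^ p <= N%:R * (x `^ (p - 1) * (x - y)).
Proof.
move=> p1 pN y0 yx; have [x0|x0] := eqVneq x 0.
  have y00 : y = 0 by lra.
  by rewrite x0 y00 !subrr !mulr0.
have xp : 0 < x by lra.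
pose z := y / x; have yE : y = x * z by rewrite /z mulrCA mulfV // mulr1.
have z0 : 0 <= z by rewrite divr_ge0 // ltW.
have z1 : z <= 1 by rewrite ler_pdivrMr // mul1r.
have zN : z ^+ N <= z `^ p.
  have [->|zn] := eqVneq z 0.
    have p0 : p != 0 by rewrite gt_eqF //; lra.
    by rewrite powR0 //; case: N pN => [|N'] pN; [lra | rewrite expr0n].
  by rewrite -powR_mulrn // ger_powR // lt0r zn z0.
have := @bernoulli_ge R z N; rewrite z0 z1 => /(_ isT) bern.
rewrite yE (powRM _ (ltW xp) z0) (powR_split (ltW xp) p1).
have q0 : 0 < x `^ (p - 1) by exact: powR_gt0.
have : x * x `^ (p - 1) * (1 - N%:R * (1 - z)) <= x * x `^ (p - 1) * z `^ p.
  apply: ler_wpM2l; last exact: le_trans bern zN.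
  by apply: mulr_ge0; apply: ltW.
lra.
Qed.

Lemma degree_split n (G H : {set {set 'I_n}}) (T : {set 'I_n}) :
  degree G T = (degree (G :&: H) T + degree (G :\: H) T)%N.
Proof.
rewrite /degree -(cardsID H); congr (_ + _)%N; apply: eq_card => E; rewrite !inE.
  by rewrite -!andbA; congr (_ && _); rewrite andbC.
by rewrite andbA.
Qed.

Lemma sum_incidence n t (R : realType) (X : {set {set 'I_n}}) (w : {set 'I_n} -> R) :
  \sum_(T in rsubsets [set: 'I_n] t) w T * (degree X T)%:R =
  \sum_(E in X) \sum_(T in rsubsets [set: 'I_n] t | T \subset E) w T.
Proof.
have e (T : {set 'I_n}) : (degree X T)%:R = \sum_(E in X) (T \subset E)%:R :> R.
  rewrite /degree -sum1_card natr_sum big_mkcond [RHS]big_mkcond /=; apply: eq_bigr => E _.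
  by rewrite inE; case: (E \in X); case: (T \subset E).
rewrite (eq_bigr (fun T => \sum_(E in X) w T * (T \subset E)%:R)) => [|T _];
  last by rewrite e mulr_sumr.
rewrite exchange_big /=; apply: eq_bigr => E _; rewrite big_mkcondr /=.
by apply: eq_bigr => T _; case: (T \subset E); rewrite ?mulr1 ?mulr0.
Qed.

(** Both norms are compared with that of G :&: H.  Each member of G outside H
    contributes at least u ^ (p - 1) to the first difference; each member of H
    outside G contributes at most a constant times (k u) ^ (p - 1) to the second. *)
Lemma norm_compare n r t (R : realType) (p : R) N K k u (G H : {set {set 'I_n}}) :
  1 < p -> p <= N%:R -> uniform r H ->
  N%:R * 'C(r, t)%:R * k%:R `^ (p - 1) <= K%:R -> (0 < u)%N ->
  (forall E, E \in G :\: H -> exists T :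
    {set 'I_n}, [/\ #|T| = t, T \subset E & (u <= degree G T)%N]) ->
  (forall E (T : {set 'I_n}), E \in H :\: G -> #|T| = t -> T \subset E ->
    (degree H T <= k * u)%N) ->
  tpnorm t p G <= tpnorm t p H -> (#|G :\: H| <= K * #|H :\: G|)%N.
Proof.
move=> p1 pN uH leK u0 lowG upH leGH.
pose F := G :&: H; pose q := p - 1.
have q0 : 0 <= q by rewrite /q; lra.
have uq : 0 < u%:R `^ q :> R by rewrite powR_gt0 ?ltr0n.
have h1 : #|G :\: H|%:R * u%:R `^ q <= tpnorm t p G - tpnorm t p F.
  rewrite /tpnorm -sumrB.
  apply: le_trans (_ : \sum_(T in rsubsets [set: 'I_n] t) (degree G T)%:R `^ q * (degree (G :\:
    H) T)%:R <= _).
    rewrite sum_incidence -sumr_const mulr_suml; apply: ler_sum => E /lowG[T [cT TE uT]].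
    have TR : (T \in rsubsets [set: 'I_n] t) && (T \subset E) by rewrite TE !inE subsetT cT eqxx.
    rewrite mul1r (bigD1 T TR) /=; apply: ler_wpDr; first by apply: sumr_ge0 => *;
      exact: powR_ge0.
    by apply: ge0_ler_powR; rewrite ?nnegrE ?ler_nat.
  apply: ler_sum => T _; have eq := degree_split G H T.
  have -> : (degree (G :\: H) T)%:R = (degree G T)%:R - (degree F T)%:R :> R.
    by rewrite eq natrD addrAC subrr add0r.
  by apply: powR_sub_ge; rewrite ?ler_nat // /F eq leq_addr.
have h2 : tpnorm t p H - tpnorm t p F <=
  N%:R * ('C(r, t)%:R * (k%:R `^ q * u%:R `^ q) * #|H :\: G|%:R).
  rewrite /tpnorm -sumrB.
  apply: le_trans (_ : N%:R * \sum_(T in rsubsets [set: 'I_n] t) (degree H T)%:R `^ q * (degree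
    (H :\: G) T)%:R <= _).
    rewrite mulr_sumr; apply: ler_sum => T _; have eq := degree_split H G T.
    have -> : (degree (H :\: G) T)%:R = (degree H T)%:R - (degree F T)%:R :> R.
      by rewrite eq natrD /F setIC addrAC subrr add0r.
    by apply: powR_sub_le; rewrite ?ler_nat // /F setIC eq leq_addr.
  apply: ler_wpM2l => //; rewrite sum_incidence [X in _ <= X]mulrC -sumr_const mulr_suml.
  apply: ler_sum => E HE; rewrite mul1r.
  have cE : #|E| = r by move: HE; rewrite inE => /andP[_ /uH].
  apply: le_trans (_ : \sum_(T in rsubsets [set: 'I_n] t | T \subset E) (k%:R `^ q * u%:R `^ q)
    <= _).
    apply: ler_sum => T /andP[TR TE]; rewrite -powRM //; apply: ge0_ler_powR;
      rewrite ?nnegrE ?mulr_ge0 //.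
    by rewrite -natrM ler_nat; apply: (upH E T HE) => //; exact: uniform_rsubsets TR.
  rewrite sumr_const mulr_natl; apply: ler_wpMn2l; first by rewrite mulr_ge0 ?powR_ge0.
  rewrite -cE -cards_draws; apply: eq_leq; apply: eq_card => T.
  by rewrite !inE; rewrite unfold_in /= !inE subsetT /= andbC.
have key : #|G :\: H|%:R * u%:R `^ q <= (K * #|H :\: G|)%:R * u%:R `^ q :> R.
  apply: le_trans h1 _; apply: le_trans (_ : tpnorm t p H - tpnorm t p F <= _);
    first by rewrite lerD2r.
  apply: le_trans h2 _; rewrite natrM.
  have -> : N%:R * ('C(r, t)%:R * (k%:R `^ q * u%:R `^ q) * #|H :\: G|%:R) =
     (N%:R * 'C(r, t)%:R * k%:R `^ q) * (#|H :\: G|%:R * u%:R `^ q) by ring.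
  by rewrite -[X in _ <= X]mulrA; apply: ler_wpM2r => //; rewrite mulr_ge0 ?powR_ge0.
by move: key; rewrite ler_pM2r // ler_nat.
Qed.

(** * Sharp weight forces nearly full sets *)

Lemma tpnormS n (R : realType) t (p : R) (G H : {set {set 'I_n}}) : 0 <= p -> G \subset H ->
  tpnorm t p G <= tpnorm t p H.
Proof.
move=> p0 GH; apply: ler_sum => T _; apply: ge0_ler_powR; rewrite ?nnegrE //.
by rewrite ler_nat; exact: degreeS.
Qed.

Lemma exists_nat_ge (R : realType) (x : R) : exists M : nat, x <= M%:R /\ (0 < M)%N.
Proof.
have [n hn] : exists n : nat, x <= n%:R.
  exists (Num.truncn `|x|).+1; apply: le_trans (ler_norm x) _; apply: ltW.
  exact: truncnS_gt.
by exists n.+1; split=> //; apply: le_trans hn _; rewrite ler_nat.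
Qed.

(** With q = p - 1, P = D ^ q and w = 'C(n - 1, t - 1) D, the norm of H divided by
    P is at most eps w + a + rho b.  Here the first term bounds the sets that are not
    dense, a and b are the total degrees of the dense sets that are nearly full and
    of those that are not, and rho = (1 - 1/k') ^ q < 1.  As a + b is at most
    (s - 1 + eps) w and the norm is at least (s - 1 - eps) w P, b is small and a is
    almost (s - 1) w. *)
Lemma many_nearfull (R : realType) (p : R) r s t k' : 1 < p -> (3 <= r)%N -> (2 <= s)%N ->
  (0 < t)%N ->
  (t < r)%N -> (0 < k')%N -> exists k, (0 < k)%N /\
  eventually (fun n => forall (H : {set {set 'I_n}}) (A : {set 'I_n}), uniform r H ->
    path_free r (2 * s) H ->
    #|A| = (s - 1)%N -> tpnorm t p (touching r A) <= tpnorm t p H ->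
    (k' * (s - 1) * 'C(n - 1, t - 1) <=
      k' * #|[set T in dense_family r t k H | nearfull r t k' H T]| + 'C(n - 1, t - 1))%N).
Proof.
move=> p1 r3 s2 t0 tr k'0; pose q := p - 1; have q0 : 0 < q by rewrite /q; lra.
have k'R : 0 < k'%:R :> R by rewrite ltr0n.
have k'1 : 1 <= k'%:R :> R by rewrite ler1n.
have inv : 0 < k'%:R^-1 :> R by rewrite invr_gt0.
have inv1 : k'%:R^-1 <= 1 :> R by rewrite invf_le1.
pose rho := (1 - k'%:R^-1 : R) `^ q.
have rho0 : 0 <= rho by exact: powR_ge0.
have rho1 : rho < 1.
  have <- : 1 `^ q = 1 :> R by rewrite powR1.
  by apply: gt0_ltr_powR => //; rewrite ?nnegrE; lra.
(* The total error in the last step is (2 + 3 / (1 - rho)) eps w. *)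
pose eps := (1 - rho) / (5 * k'%:R).
have eps0 : 0 < eps by rewrite divr_gt0 ?mulr_gt0 //; lra.
have epsE : 5 * k'%:R * eps = 1 - rho by rewrite /eps mulrCA mulfV ?mulr1 // gt_eqF // mulr_gt0.
pose c := (2 * s * r)%N; pose k5 := ('C(r, t) * (c * bin_scale (r - 1)))%N.
have k50 : 0 < k5%:R :> R.
  by rewrite ltr0n /k5 muln_gt0 bin_gt0 (ltnW tr) muln_gt0 bin_scale_gt0 andbT /c; clear -s2 r3;
    lia.
(* k is chosen so large that (bin_scale (r - t) / k) ^ q k5 <= eps. *)
pose y := (eps / k5%:R) `^ q^-1.
have y0 : 0 < y by rewrite powR_gt0 // divr_gt0.
have yq : y `^ q = eps / k5%:R by rewrite /y -powRrM mulVf ?gt_eqF // powRr1 // ltW // divr_gt0.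
have [k [hk k0]] := exists_nat_ge ((bin_scale (r - t))%:R / y).
have kR : 0 < k%:R :> R by rewrite ltr0n.
pose eta := ((bin_scale (r - t))%:R / k%:R : R) `^ q.
have eta0 : 0 <= eta by exact: powR_ge0.
have etak : eta * k5%:R <= eps.
  rewrite -ler_pdivlMr // -yq; apply: ge0_ler_powR;
    rewrite ?nnegrE ?divr_ge0 ?(ltW q0) ?(ltW y0) //.
  by rewrite ler_pdivrMr // mulrC -ler_pdivrMr.
exists k; split=> //.
have [M [hM M0]] := exists_nat_ge (eps^-1).
have epsM : 1 <= eps * M%:R by rewrite mulrC -ler_pdivrMr // div1r.
have [K evK] := dense_weight r3 s2 k0 t0 tr.
pose K2 := (K + (s - 1) * 'C(r - 1, t - 1))%N.
have r2 : (2 <= r)%N by exact: ltnW.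
have ev1 := eventually_flags (M * K2) t0 (ltnW tr) r2.
have ev2 := eventually_lower_order (M * ((s - 1) * 2 ^ (s - 1))) t.
apply: eventually_mono (eventually_and evK (eventually_and ev1 (eventually_and ev2
  (eventually_ge (2 * (r + t)))))) => n [hK [h1 [h2 nN]]] H A uH free cA leN.
have nr : (2 * r <= n)%N by clear -nN; lia.
have n0 : (0 < n)%N by clear -nN r3; lia.
set N1 := 'C(n - 1, t - 1) in h1 h2 *; set D := 'C(n - t, r - t) in h1 *.
have D0 : (0 < D)%N by rewrite bin_gt0; clear -nN tr; lia.
have N10 : (0 < N1)%N by rewrite bin_gt0; clear -nN tr; lia.
pose P : R := D%:R `^ q; have P0 : 0 < P by rewrite powR_gt0 ?ltr0n.
pose w : R := N1%:R * D%:R.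
have w0 : 0 < w by rewrite mulr_gt0 ?ltr0n.
set S := [set T in dense_family r t k H | nearfull r t k' H T].
pose S' := [set T in dense_family r t k H | ~~ nearfull r t k' H T].
pose a : R := \sum_(T in S) (degree H T)%:R; pose b : R := \sum_(T in S') (degree H T)%:R.
have b0 : 0 <= b by apply: sumr_ge0.
have degD T : T \in rsubsets [set: 'I_n] t -> (degree H T <= D)%N.
  move=> /uniform_rsubsets cT; rewrite /D -cT; apply: (degree_le_bin uH).
  by rewrite cT ltnW.
have ptw T : T \in rsubsets [set: 'I_n] t -> (degree H T)%:R `^ p <=
   P * (eta * (degree H T)%:R + (T \in S)%:R * (degree H T)%:R + rho * ((T \in S')%:R * (degree
     H T)%:R)).
  move=> TR; set d : R := (degree H T)%:R; have d0 : 0 <= d by [].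
  have dD : d <= D%:R by rewrite ler_nat degD.
  rewrite (powR_split d0 p1) -/q.
  have TSE : (T \in S) = (T \in dense_family r t k H) && nearfull r t k' H T by rewrite inE.
  have TSE' : (T \in S') = (T \in dense_family r t k H) && ~~ nearfull r t k' H T by rewrite inE.
  have cT : #|T| = t by exact: uniform_rsubsets TR.
  rewrite TSE TSE'; have [dT|dT] := boolP (T \in dense_family r t k H); last first.
    rewrite !mul0r mulr0 !addr0 [d * _]mulrC mulrA; apply: ler_wpM2r => //.
    apply: le_trans (_ : ((bin_scale (r - t))%:R / k%:R * D%:R) `^ q <= _);
      last by rewrite powRM ?divr_ge0 // mulrC.
    apply: ge0_ler_powR; rewrite ?nnegrE ?mulr_ge0 ?divr_ge0 ?(ltW q0) ?invr_ge0 //.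
    rewrite mulrAC ler_pdivlMr // mulrC -!natrM ler_nat.
    have hn : (2 * (t + (r - t)) <= n)%N by clear -nN tr; lia.
    apply: (leq_trans _ (exp_le_bin hn)).
    by move: dT; rewrite inE TR /= -ltnNge => /ltnW.
  have [nf|nf] := boolP (nearfull r t k' H T) => /=.
    rewrite mul1r mul0r mulr0 addr0 mulrC; apply: le_trans (_ : P * d <= _).
      by apply: ler_wpM2r => //; apply: ge0_ler_powR; rewrite ?nnegrE ?(ltW q0).
    by apply: ler_wpM2l; [exact: ltW | rewrite lerDr mulr_ge0].
  rewrite mul1r mul0r addr0 mulrC; apply: le_trans (_ : P * (rho * d) <= _).
    rewrite mulrA; apply: ler_wpM2r => //; rewrite mulrC /rho /P -powRM ?subr_ge0 //.
    apply: ge0_ler_powR; rewrite ?nnegrE ?mulr_ge0 ?subr_ge0 ?(ltW p1) //.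
    move: nf; rewrite /nearfull cT eqxx /= -ltnNge -(ltr_nat R) natrM.
    have := missingE (T := T) uH; rewrite cT => /(_ (ltnW tr)) /(congr1 (fun x => x%:R : R)).
    rewrite natrD -/D -/d => e; have -> : (missing r H T)%:R = D%:R - d by rewrite -e addrK.
    rewrite mulrC -ltr_pdivrMr // => h.
    by rewrite mulrBl mul1r [_^-1 * _]mulrC lerBrDr -lerBrDl ltW.
  by apply: ler_wpM2l; [exact: ltW | rewrite lerDr mulr_ge0].
have upper : tpnorm t p H <= P * (eps * w + a + rho * b).
  apply: le_trans (ler_sum _ _) _; first by move=> T TR; exact: (ptw T TR).
  rewrite -mulr_sumr; apply: ler_wpM2l; first exact: ltW.
  rewrite !big_split /= -!mulr_sumr.
  have sumS (V : {set {set 'I_n}}) : V \subset dense_family r t k H ->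
     \sum_(T in rsubsets [set: 'I_n] t) (T \in V)%:R * (degree H T)%:R = \sum_(T in V) (degree H
       T)%:R :> R.
    move=> /subsetP sV; rewrite big_mkcond [RHS]big_mkcond /=; apply: eq_bigr => T _.
    case: (boolP (T \in V)) => [/sV|]; last by rewrite mul0r if_same.
    by rewrite inE => /andP[-> _]; rewrite mul1r.
  rewrite !sumS; try by apply/subsetP=> T; rewrite inE => /andP[].
  rewrite -/a -/b !lerD2r -natr_sum (sum_degree t uH).
  have le : ('C(r, t) * #|H| <= k5 * (N1 * D))%N.
    rewrite /k5 -mulnA leq_mul2l; apply/orP; right.
    have l0 : (0 < 2 * s)%N by clear -s2; lia.
    apply: leq_trans (free_card_le_shadow r3 l0 uH free) _.
    rewrite -[X in (_ <= X)%N]mulnA leq_mul2l; apply/orP; right.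
    apply: leq_trans (card_shadow_le r H) _; rewrite -subn1.
    by apply: exp_le_flags => //; [exact: ltnW | clear -r3; lia].
  apply: le_trans (_ : eta * (k5%:R * w) <= _).
    by apply: ler_wpM2l => //; rewrite /w -!natrM ler_nat.
  by rewrite mulrA; apply: ler_wpM2r => //; exact: ltW.
have lower : P * ((s - 1)%:R * w - eps * w) <= tpnorm t p (touching r A).
  pose tau := #|touching t A|.
  have le1 : P * (tau%:R * D%:R) <= tpnorm t p (touching r A).
    rewrite mulrCA -sumr_const mulr_suml.
    apply: le_trans (_ : \sum_(T in touching t A) (degree (touching r A) T)%:R `^ p <= _).
      apply: ler_sum => T; rewrite inE => /andP[/uniform_rsubsets cT TA].
      rewrite degree_touching ?cT //; last exact: ltnW.
      by rewrite mul1r -/D (powR_split _ p1) // mulrC.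
    rewrite /tpnorm [X in _ <= X](bigID (mem (touching t A))) /=.
    rewrite [X in _ <= X + _](eq_bigl (mem (touching t A))) => [|T]; last first.
      by apply: andb_idl => /setIdP[].
    by rewrite lerDl; apply: sumr_ge0 => *; exact: powR_ge0.
  apply: le_trans le1; apply: ler_wpM2l; first exact: ltW.
  have := touching_count cA t0; rewrite -/N1 -/tau; set e := (_ * (_ * _))%N => le2.
  have le3 : (M * e <= N1)%N by apply: leq_trans h2; rewrite /e !mulnA.
  have e1 : (s - 1)%:R * N1%:R <= tau%:R + e%:R :> R by rewrite -natrM -natrD ler_nat.
  have e2 : M%:R * e%:R <= N1%:R :> R by rewrite -natrM ler_nat.
  have e3 : e%:R <= eps * N1%:R.
    apply: le_trans (_ : eps * (M%:R * e%:R) <= _); last by apply: ler_wpM2l => //; exact: ltW.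
    by rewrite mulrA ler_peMl.
  rewrite /w [(s - 1)%:R * _]mulrA [eps * _]mulrA -mulrBl; apply: ler_wpM2r => //.
  lra.
have dsum : a + b <= (s - 1)%:R * w + eps * w.
  have [C _ [le _ _ _]] := hK H uH free.
  have eab : a + b = (\sum_(T in dense_family r t k H) degree H T)%:R.
    rewrite natr_sum [RHS](bigID (fun T => nearfull r t k' H T)) /= /a /b.
    by congr (_ + _); apply: eq_bigl => T; rewrite inE.
  have le2 : (\sum_(T in dense_family r t k H) degree H T <=
    (s - 1) * (N1 * D) + K2 * n ^ (r - 2))%N.
    apply: leq_trans le _; rewrite /N1 /D bin_flags //; last exact: ltnW.
    (* Pascal's rule; the flag identity uses 'C(n - 1, r - 1). *)
    have pasc : ('C(n, r - 1) <= 'C(n - 1, r - 1) + n ^ (r - 2))%N.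
      have -> : (n = (n - 1).+1)%N by clear -n0; lia.
      have -> : (r - 1 = (r - 2).+1)%N by clear -r3; lia.
      rewrite binS subn1 /= subn1 leq_add2l; apply: leq_trans (leq_bin_exp _ _) _.
      by apply: leq_exp2r_weak.
    apply: leq_trans (leq_add (leq_mul (leqnn _) pasc) (leqnn _)) _.
    by rewrite /K2; apply: eq_leq; clear; nia.
  have e1 : a + b <= (s - 1)%:R * w + (K2 * n ^ (r - 2))%:R.
    by rewrite eab /w -!natrM -natrD ler_nat.
  apply: le_trans e1 _; rewrite lerD2l.
  have e2 : M%:R * (K2 * n ^ (r - 2))%:R <= w by rewrite /w -!natrM ler_nat mulnA.
  apply: le_trans (_ : eps * (M%:R * (K2 * n ^ (r - 2))%:R) <= _);
    last by apply: ler_wpM2l => //; exact: ltW.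
  by rewrite mulrA ler_peMl.
have aS : a <= #|S|%:R * D%:R.
  rewrite -sumr_const mulr_suml; apply: ler_sum => T; rewrite inE => /andP[].
  rewrite inE => /andP[TR _] _; by rewrite mul1r ler_nat degD.
have comb : (s - 1)%:R * w - eps * w <= eps * w + a + rho * b.
  rewrite -(ler_pM2l P0); apply: le_trans lower (le_trans leN upper).
clear ptw upper lower leN.
have fin : k'%:R * ((s - 1)%:R * w) - w <= k'%:R * a.
  have bs : (1 - rho) * b <= 3 * (eps * w).
    have -> : (1 - rho) * b = (a + b) - (a + rho * b) by ring.
    lra.
  have bs2 : 5 * (k'%:R * b) <= 3 * w.
    have d0 : 0 < 1 - rho by lra.
    rewrite -(ler_pM2l d0).
    have -> : (1 - rho) * (5 * (k'%:R * b)) = 5 * k'%:R * ((1 - rho) * b) by ring.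
    apply: le_trans (_ : 5 * k'%:R * (3 * (eps * w)) <= _); first by rewrite ler_wpM2l ?mulr_ge0.
    by rewrite -epsE le_eqVlt; apply/orP; left; apply/eqP; ring.
  have ew : 5 * (k'%:R * (eps * w)) <= w.
    have -> : 5 * (k'%:R * (eps * w)) = (1 - rho) * w by rewrite -epsE; ring.
    by rewrite ler_piMl ?(ltW w0) //; lra.
  have rb : rho * b <= b by rewrite ler_piMl // ltW.
  have : k'%:R * ((s - 1)%:R * w - eps * w) <= k'%:R * (eps * w + a + b).
    by rewrite ler_wpM2l // (le_trans comb) // lerD2l.
  rewrite !mulrDr mulrN => h; lra.
have : (k' * (s - 1) * N1)%:R * D%:R <= (k' * #|S| + N1)%:R * D%:R :> R.
  rewrite natrD !natrM mulrDl.
  have e1 : k'%:R * a <= k'%:R * (#|S|%:R * D%:R) by rewrite ler_wpM2l.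
  move: fin; rewrite /w => fin; lra.
by rewrite ler_pM2r ?ltr0n // ler_nat.
Qed.

(** * The extremal families *)

(** Stability supplies L, a comparison with the family of all sets meeting L gives
    the hypothesis of rigidity, and a comparison with the family of L and Q removes
    the exceptions. *)
Lemma extremal_unique (R : realType) (p : R) r s t : 1 < p -> (3 <= r)%N -> (2 <= s)%N ->
  (0 < t)%N -> (t < r)%N ->
  eventually (fun n => forall (H : {set {set 'I_n}}) (A Q : {set 'I_n}), uniform r H ->
    path_free r (2 * s) H ->
    admissible s A Q -> tpnorm t p (extremal r A Q) <= tpnorm t p H ->
    exists A' Q' : {set 'I_n}, admissible s A' Q' /\ H = extremal r A' Q').
Proof.
move=> p1 r3 s2 t0 tr; have p0 : 0 <= p by lra.
have [N [pN _]] := exists_nat_ge p.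
have [K1 [hK1 _]] := exists_nat_ge (N%:R * 'C(r, t)%:R * 1%:R `^ (p - 1)).
have [q [K [q0 evR]]] := rigidity K1 r3 s2.
pose k2 := (s + K * bin_scale (r - 2))%N.
have [K3 [hK3 _]] := exists_nat_ge (N%:R * 'C(r, t)%:R * k2%:R `^ (p - 1)).
pose k' := (4 * s * bin_scale (r - t - 1) + 4 * t + 1 + 3 * (s - 1) * q)%N.
have k'1 : (4 * s * bin_scale (r - t - 1) <= k')%N by rewrite /k' -!addnA leq_addr.
have k'2 : (4 * t < k')%N by rewrite /k' addn1 addSn ltnS -addnA addnCA leq_addr.
have k'3 : (3 * (s - 1) * q <= k')%N by rewrite /k' leq_addl.
have k'0 : (0 < k')%N by apply: leq_ltn_trans k'2.
have [k [k0 evN]] := many_nearfull p1 r3 s2 t0 tr k'0.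
have evS := stability r3 s2 k0 t0 tr k'1 k'2.
apply: eventually_mono (eventually_and evR (eventually_and evN (eventually_and evS
  (eventually_ge (2 * (r + s + t) + (K * (K3 * K)).+1))))).
move=> n [hR [hN [hS nN]]] H A Q uH free adm leN; have [cA _ _] := adm.
have nbig : (2 * (r + s + t) <= n)%N by exact: leq_trans (leq_addr _ _) nN.
have n0 : (0 < n)%N by clear -nbig r3; lia.
have touch (L : {set 'I_n}) : #|L| = (s - 1)%N -> tpnorm t p (touching r L) <= tpnorm t p H.
  move=> cL; have [|Q' QL cQ] := @exists_subset_card _ (~: L) 2.
    by rewrite cardsCs setCK card_ord cL; clear -nbig r3; lia.
  have adm' : admissible s L Q' by [].
  apply: le_trans (tpnormS _ p0 (touching_extremal r L Q')) _.
  by rewrite (tpnorm_extremal r t p adm' adm).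
have [L cL missL] := hS H uH free (hN H A uH free cA (touch A cA)).
have mle : (q * #|touching r L :\: H| <= n ^ (r - 1))%N.
  have le1 := card_touching_missing cL missL.
  have s1 : (0 < 3 * (s - 1))%N by clear -s2; lia.
  rewrite -(leq_pmul2l s1) mulnA.
  apply: leq_trans (leq_mul k'3 (leqnn _)) (leq_trans le1 _).
  rewrite mulnA [((s - 1) * 3)%N]mulnC leq_mul2l; apply/orP; right.
  by apply: leq_trans (leq_bin_exp _ _) (leq_exp2r_weak _ _); exact: leq_subr.
pose D := 'C(n - t, r - t).
have D0 : (0 < D)%N by rewrite bin_gt0; clear -nbig tr; lia.
have tr' := ltnW tr.
have t12 : (2 <= t)%N \/ (t < 2)%N by case: (leqP 2 t); [left | right].
have touch_deg (T : {set 'I_n}) : #|T| = t -> T :&: L != set0 -> degree (touching r L) T = D.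
  by move=> cT TL; rewrite degree_touching ?cT.
have touchT (E : {set 'I_n}) : #|E| = r -> E :&: L != set0 ->
    exists T : {set 'I_n}, [/\ #|T| = t, T \subset E & T :&: L != set0].
  move=> cE /set0Pn[v /setIP[vE vL]].
  have [|||T [vT TE cT]] := @exists_between _ [set v] E t; rewrite ?sub1set ?cards1 ?cE //.
  by exists T; split=> //; apply/set0Pn; exists v; rewrite inE vL -sub1set vT.
have degH (T : {set 'I_n}) : #|T| = t -> (degree H T <= D)%N.
  by move=> cT; rewrite /D -cT; apply: (degree_le_bin uH); rewrite cT.
have mb : (#|touching r L :\: H| <= K1 * #|avoiding H L|)%N.
  rewrite -(setD_touching L uH).
  apply: (norm_compare p1 pN uH hK1 D0 _ _ (touch L cL)).
    move=> E; rewrite in_setD => /andP[_ TE]; have cE := uniform_touching TE.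
    case/setIdP: TE => _ EL; have [T [cT sT TL]] := touchT E cE EL.
    by exists T; rewrite touch_deg.
  by move=> E T _ cT _; rewrite mul1n degH.
have [Q' [cQ' QL' cB cX rig]] := hR H L uH free cL mle mb.
have adm' : admissible s L Q' by [].
exists L, Q'; split=> //; set G := extremal r L Q' in cX rig *.
(* A member of G above Q' is compared through a t-set comparable with Q', whose
degree is at least the number of r-sets above its union with Q'; this union
has size maxn t 2. *)
pose u := 'C(n - maxn t 2, r - maxn t 2).
have u0 : (0 < u)%N by rewrite bin_gt0; clear -nbig tr r3; lia.
have uD : (u <= D)%N.
  rewrite /u /D; have [t2|t1] := t12; first by rewrite (maxn_idPl t2).
  have -> : maxn t 2 = t.+1 by clear -t0 t1; lia.
  have -> : (n - t = (n - t.+1).+1)%N by clear -nbig t0 r3; lia.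
  have -> : (r - t = (r - t.+1).+1)%N by clear -tr; lia.
  by rewrite binS leq_addl.
have cmp : (#|G :\: H| <= K3 * #|H :\: G|)%N.
  apply: (norm_compare p1 pN uH hK3 u0); last by rewrite (tpnorm_extremal r t p adm' adm).
    move=> E; rewrite in_setD => /andP[_ GE]; have cE := uniform_extremal GE.
    move: GE; rewrite extremalE => /andP[_].
    have [EL _|EL /= QE] := boolP (E :&: L != set0).
      have [T [cT sT TL]] := touchT E cE EL; exists T; split=> //.
      by apply: leq_trans uD _; rewrite -(touch_deg T cT TL); apply: degreeS;
        exact: touching_extremal.
    have [T [cT TE cTQ]] : exists T :
      {set 'I_n}, [/\ #|T| = t, T \subset E & #|T :|: Q'| = maxn t 2].
      have [t2|t1] := t12.
        have [|||T [QT TE cT]] := @exists_between _ Q' E t; rewrite ?cQ' ?cE //.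
        by exists T; rewrite (setUidPl QT) (maxn_idPl t2).
      have [|T TQ cT] := @exists_subset_card _ Q' t; first by rewrite cQ' ltnW.
      exists T; rewrite (setUidPr TQ) cQ' (maxn_idPr (ltnW t1)); split=> //.
      exact: subset_trans TQ QE.
    exists T; split=> //.
    have le : (#|T :|: Q'| <= r)%N by rewrite cTQ geq_max tr' ltnW.
    rewrite /u -cTQ -(degree_complete le); apply: subset_leq_card; apply/subsetP=> F /setIdP[FR].
    rewrite subUset => /andP[TF QF].
    by rewrite inE TF andbT extremalE (uniform_rsubsets FR) eqxx QF orbT.
  move=> E T; rewrite in_setD => /andP[nG HE] cT TE.
  have [t2|t1] := t12.
    apply: leq_trans (degH T cT) _; rewrite /u (maxn_idPl t2) leq_pmull //.
    by rewrite /k2; clear -s2; lia.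
  have t1' : t = 1%N by clear -t0 t1; lia.
  have /cards1P[x xT] : #|T| == 1%N by rewrite cT t1'.
  have xL : x \notin L.
    apply: contra nG => xL; rewrite extremalE (uH _ HE) eqxx /=; apply/orP; left.
    by apply/set0Pn; exists x; rewrite inE xL andbT (subsetP TE) // xT inE.
  have uE : u = 'C(n - 2, r - 2) by rewrite /u t1'.
  rewrite xT; apply: leq_trans (degree_vertex_le uH (ltnW r3) xL) _.
  rewrite cL -uE /k2 mulnDl; apply: leq_add; first by rewrite leq_mul2r leq_subr orbT.
  apply: leq_trans cB _; rewrite -mulnA leq_mul2l; apply/orP; right; rewrite uE.
  by apply: exp_le_bin; clear -nbig r3; lia.
have HG : H :\: G = set0.
  have [//|ne] := eqVneq (H :\: G) set0; have le1 := rig ne.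
  have le2 : (n ^ (r - 2) <= K * (K3 * K) * n ^ (r - 3))%N.
    apply: leq_trans le1 _; rewrite -[X in (_ <= X)%N]mulnA leq_mul2l; apply/orP; right.
    by apply: leq_trans cmp _; rewrite -[X in (_ <= X)%N]mulnA leq_mul2l cX orbT.
  have lt : (K * (K3 * K) < n)%N by apply: leq_trans nN; exact: leq_addl.
  have := lower_order (r - 3) lt; rewrite (_ : (r - 3).+1 = r - 2)%N; last by clear -r3; lia.
  by rewrite ltnNge le2.
apply/eqP; rewrite eqEsubset -!setD_eq0 HG eqxx /=.
by move: cmp; rewrite HG cards0 muln0 leqn0 cards_eq0.
Qed.

Local Close Scope ring_scope.

Theorem theorem1p6 (R : realType) (r s t : nat) (p : R)
    (hr : 3 <= r) (hs : 2 <= s) (ht1 : 1 <= t) (htr : t <= r - 1)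
    (hp : (1 < p)%R) :
  exists N : nat, forall n : nat, N <= n ->
    forall H : {set {set 'I_n}},
      H \subset rsubsets [set: 'I_n] r -> path_free r (2 * s) H ->
      forall A Q : {set 'I_n}, admissible s A Q ->
        (tpnorm t p H <= tpnorm t p (extremal r A Q))%R /\
        (tpnorm t p H = tpnorm t p (extremal r A Q) <->
         exists A' Q' : {set 'I_n},
           admissible s A' Q' /\ isomorphic H (extremal r A' Q')).
Proof.
have tr : t < r by clear -hr htr; lia.
have [N hN] := extremal_unique hp hr hs ht1 tr.
exists N => n nN H /uniform_sub uH free A Q adm.
have key := hN n nN H A Q uH free adm; split.
  case: (leP (tpnorm t p H) (tpnorm t p (extremal r A Q))) => // lt.
  have [A' [Q' [adm' HE]]] := key (ltW lt).
  by move: lt; rewrite HE (tpnorm_extremal r t p adm' adm) ltxx.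
split=> [eq|[A' [Q' [adm' [f fH]]]]].
  have [|A' [Q' [adm' HE]]] := key; first by rewrite eq.
  exists A', Q'; split=> //; exists 1%g; rewrite HE.
  rewrite (eq_imset (g := id)) ?imset_id // => E.
  by rewrite (eq_imset (g := id)) ?imset_id // => x; rewrite perm1.
by rewrite -(tpnorm_perm t p f H) fH (tpnorm_extremal r t p adm' adm).
Qed.
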